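(* Let $\mathbf{u}_0,\mathbf{v}_0\in X$ and $\mathbf{b}\in C([0,T];X)$. Then, for either choice (a) or (b) of the degradation factor $\gamma$ described in the context, the initial value problem $$\rho\,\ddot{\mathbf{u}}(t,\mathbf{x})+\mathcal{L}^\epsilon[\mathbf{u}](t,\mathbf{x})=\mathbf{b}(t,\mathbf{x}),\qquad \mathbf{u}(0,\mathbf{x})=\mathbf{u}_0(\mathbf{x}),\quad \dot{\mathbf{u}}(0,\mathbf{x})=\mathbf{v}_0(\mathbf{x}),$$ for $t\in[0,T]$, $\mathbf{x}\in\Omega$, has a unique solution $\mathbf{u}$ in $C^2([0,T];X)$, with two strong derivatives in time.
   Context: Let $d\in\{2,3\}$, $\Omega\subset\mathbb{R}^d$ a bounded domain, $T>0$, $\epsilon>0$ and $\rho>0$ constants. Put $H_\epsilon(\mathbf{x})=\{\mathbf{y}:|\mathbf{y}-\mathbf{x}|<\epsilon\}$, let $\omega_d$ be the volume of the unit ball of $\mathbb{R}^d$ and $V_d^\epsilon=\omega_d\epsilon^d$. Function space: $\mathcal{U}=\{\mathbf{w}:\mathbf{w}(\mathbf{x})=\mathbb{Q}\mathbf{x}+\mathbf{c},\ \mathbb{Q}\in\mathbb{R}^{d\times d},\ \mathbb{Q}^T=-\mathbb{Q},\ \mathbf{c}\in\mathbb{R}^d\}$ (rigid motions), and $X=\{\mathbf{u}\in L^\infty(\Omega;\mathbb{R}^d):\int_\Omega\mathbf{u}\cdot\mathbf{w}\,d\mathbf{x}=0\ \text{for all }\mathbf{w}\in\mathcal{U}\}$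 with the $L^\infty$ norm. $C^2([0,T];X)$ has norm $\sup_{0\le t\le T}\sum_{i=0}^2\|\partial_t^i\mathbf{u}(t)\|_X$. Kernel: $\rho^\epsilon(\mathbf{y},\mathbf{x})=\chi_\Omega(\mathbf{y})J(|\mathbf{y}-\mathbf{x}|/\epsilon)/(\epsilon V_d^\epsilon)$, where $\chi_\Omega$ is the characteristic function of $\Omega$ and $J:[0,\infty)\to[0,\infty)$ is decreasing, positive on $[0,1)$, with $J(0)=M<\infty$ and $J=0$ on $[1,\infty)$. Strain: $\mathbf{e}=(\mathbf{y}-\mathbf{x})/|\mathbf{y}-\mathbf{x}|$, $S(\mathbf{y},\mathbf{x},\mathbf{u}(t))=\frac{\mathbf{u}(t,\mathbf{y})-\mathbf{u}(t,\mathbf{x})}{|\mathbf{y}-\mathbf{x}|}\cdot\mathbf{e}$, and $r(t,\mathbf{u})=\sqrt{|\mathbf{y}-\mathbf{x}|}\,S(\mathbf{y},\mathbf{x},\mathbf{u}(t))$. Potential: there are constants $r^-<r^e<0<r^c<r^+$; $g:\mathbb{R}\to\mathbb{R}$ is $C^2$, with $g',g''$ bounded, $g=C^-$ for $r\le r^-$, $g=C^+$ for $r\ge r^+$ (so $g'=0$ there); $g$ is convex on $[r^e,r^c]$ and concave on $[r^-,r^e]$ and on $[r^c,r^+]$. Degradation factor, one of the following: (a) $\gamma(\mathbf{u})(\mathbf{y},\mathbf{x},t)=h\big(\int_0^t(r(\tau,\mathbf{u})-r^+)^+\,d\tau\big)$, where $(\cdot)^+$ is the positive part and $h\ge 0$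 is smooth, equal to $1$ for negative arguments, decreasing to zero on $[0,x^D)$, and zero on $[x^D,\infty)$, for some $x^D>0$; (b) $\gamma(\mathbf{u})(\mathbf{y},\mathbf{x},t)=h\big(\sqrt{|\mathbf{y}-\mathbf{x}|}\,S^*(t,\mathbf{y},\mathbf{x},\mathbf{u})\big)$, where $S^*(t,\mathbf{y},\mathbf{x},\mathbf{u})=\max_{0\le\tau\le t}S(\mathbf{y},\mathbf{x},\mathbf{u}(\tau))$ and $h\ge0$ is smooth, equal to $1$ on $(-\infty,r^+]$, decreasing to zero on $[r^+,r^D]$, and zero on $[r^D,\infty)$, for some $r^D>r^+$. Force density: $\mathcal{L}^\epsilon[\mathbf{u}](t,\mathbf{x})=-\int_\Omega\frac{2\rho^\epsilon(\mathbf{y},\mathbf{x})}{\sqrt{|\mathbf{y}-\mathbf{x}|}}\,\gamma(\mathbf{u})(\mathbf{y},\mathbf{x},t)\,g'(r(t,\mathbf{u}))\,\mathbf{e}\,d\mathbf{y}$. *)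

(* Defs.v *)
From HB Require Import structures.
From mathcomp Require Import all_boot all_order all_algebra.
From mathcomp Require Import all_classical all_reals all_analysis.
Set Implicit Arguments. Unset Strict Implicit. Unset Printing Implicit Defensive.
Import Order.TTheory GRing.Theory Num.Def Num.Theory.
Import numFieldNormedType.Exports.
Local Open Scope classical_set_scope.
Local Open Scope ring_scope.

(** The product sigma-algebra on row vectors, i.e. the one generated by the
    coordinate functions (as the library does for tuples). *)
Section measurable_rV.
Context (R : realType) (n : nat).

Let coors : 'I_n -> 'rV[R]_n -> R := fun i x => x 0 i.

Let rV_set0 : g_sigma_preimage coors set0.
Proof. exact: sigma_algebra0. Qed.

Let rV_setC A : g_sigma_preimage coors A -> g_sigma_preimage coors (~` A).
Proof. exact: sigma_algebraC. Qed.

Let rV_bigcup (F : _^nat) : (forall i, g_sigma_preimage coors (F i)) ->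
  g_sigma_preimage coors (\bigcup_i (F i)).
Proof. exact: sigma_algebra_bigcup. Qed.

HB.instance Definition _ :=
  @isMeasurable.Build (measure_tuple_display default_measure_display)
    'rV[R]_n (g_sigma_preimage coors) rV_set0 rV_setC rV_bigcup.

Lemma measurable_coord (i : 'I_n) :
  measurable_fun [set: 'rV[R]_n] (fun x : 'rV[R]_n => x 0 i).
Proof.
move=> _ Y mY; rewrite setTI; apply: sub_sigma_algebra => /=.
rewrite -bigcup_seq/=; exists i => /=; first by rewrite mem_index_enum.
by exists Y => //; rewrite setTI.
Qed.

Lemma measurable_fun_coordP d (T : measurableType d) (f : T -> 'rV[R]_n) :
  measurable_fun [set: T] f <->
  forall i, measurable_fun [set: T] (fun t => f t 0 i).
Proof.
split=> [mf i|mf].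
  exact: (measurableT_comp (measurable_coord i) mf).
move=> _ A mA; rewrite setTI; move: A mA.
have: g_sigma_preimage coors `<=` [set A | measurable (f @^-1` A)].
  apply: smallest_sub.
    split => /=.
    - by rewrite preimage_set0; exact: measurable0.
    - by move=> A /=; rewrite setTD preimage_setC; exact: measurableC.
    - by move=> F mF /=; rewrite preimage_bigcup; exact: bigcup_measurable.
  rewrite -bigcup_seq/=; apply: bigcup_sub => i _ A [B mB <-] /=.
  rewrite setTI; have := mf i measurableT B mB.
  by rewrite setTI.
by apply.
Qed.

End measurable_rV.

Section lebesgue_rV.
Context (R : realType).

Definition rV_cons n (p : R * 'rV[R]_n) : 'rV[R]_n.+1 :=
  row_mx (p.1)%:M p.2.

Definition rV_uncons n (v : 'rV[R]_n.+1) : R * 'rV[R]_n :=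
  (v 0 0, \row_j v 0 (lift ord0 j)).

Lemma rV_consK n (p : R * 'rV[R]_n) : rV_uncons (rV_cons p) = p.
Proof.
case: p => a v; rewrite /rV_uncons /rV_cons /=; congr pair.
  by rewrite mxE; case: splitP => // j _; rewrite ord1 mxE eqxx mulr1n.
apply/rowP => j; rewrite !mxE; case: splitP => [k|k].
  by rewrite ord1 /= /bump.
by rewrite /= /bump !add1n => -[jk]; congr (v _ _); exact/val_inj.
Qed.

Lemma preimage_rV_consK n (B : set (R * 'rV[R]_n)) :
  @rV_cons n @^-1` (@rV_uncons n @^-1` B) = B.
Proof. by rewrite predeqE => p; rewrite /preimage /mkset rV_consK. Qed.

Lemma measurable_rV_cons n :
  measurable_fun [set: measurableTypeR R * 'rV[R]_n] (@rV_cons n).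
Proof.
apply/measurable_fun_coordP => i.
have [j ->|->] := unliftP ord0 i.
  apply: (@eq_measurable_fun _ _ _ _ _ (fun p : R * 'rV_n => p.2 0 j)).
    by move=> p _; rewrite -[in LHS](rV_consK p) /= mxE.
  exact: (measurableT_comp (measurable_coord j) measurable_snd).
apply: (@eq_measurable_fun _ _ _ _ _ (fun p : R * 'rV_n => p.1)).
  by move=> p _; rewrite -[in LHS](rV_consK p).
exact: measurable_fst.
Qed.

Lemma measurable_rV_uncons n :
  measurable_fun [set: 'rV[R]_n.+1] (@rV_uncons n : _ -> measurableTypeR R * 'rV[R]_n).
Proof.
apply: measurable_fun_pair; first exact: measurable_coord.
apply/measurable_fun_coordP => i.
under eq_fun do rewrite mxE.
exact: measurable_coord.
Qed.

Section lebesgue_rV_step.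
Context n (mu : {sigma_finite_measure set 'rV[R]_n -> \bar R}).

Definition lebesgue_rV_step :=
  pushforward ((@lebesgue_measure R) \x mu)%E (@rV_cons n).

Let step0 : lebesgue_rV_step set0 = 0%E.
Proof. by rewrite /lebesgue_rV_step /pushforward preimage_set0 measure0. Qed.

Let step_ge0 A : (0 <= lebesgue_rV_step A)%E.
Proof. by rewrite /lebesgue_rV_step /pushforward measure_ge0. Qed.

Let step_additive : semi_sigma_additive lebesgue_rV_step.
Proof.
pose m := measure_function_pushforward__canonical__measure_function_Measure
  ((@lebesgue_measure R) \x mu)%E (@measurable_rV_cons n).
exact: (@measure_semi_sigma_additive _ _ _ m).
Qed.

HB.instance Definition _ :=
  isMeasure.Build _ _ _ lebesgue_rV_step step0 step_ge0 step_additive.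

Let step_sigma_finite : sigma_finite setT lebesgue_rV_step.
Proof.
have /sigma_finiteP[F [TF ndF Foo]] := sigma_finiteT (@lebesgue_measure R).
have /sigma_finiteP[G [TG ndG Goo]] := sigma_finiteT mu.
exists (fun k => @rV_uncons n @^-1` (F k `*` G k)).
  rewrite -preimage_bigcup (_ : \bigcup_k _ = setT) ?preimage_setT//.
  rewrite -setXTT TF TG predeqE => -[x y]; split.
    by move=> [/= k _ []/= ? ?]; split; exists k.
  move=> [/= [k _ Fkx] [l _ Gly]]; exists (maxn k l) => //; split.
  - by move: x Fkx; exact/subsetPset/ndF/leq_maxl.
  - by move: y Gly; exact/subsetPset/ndG/leq_maxr.
move=> k; have [mF Fk] := Foo k; have [mG Gk] := Goo k; split.
  rewrite -[X in measurable X]setTI; apply: measurable_rV_uncons => //.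
  exact: measurableX.
rewrite /lebesgue_rV_step /pushforward preimage_rV_consK.
by rewrite product_measure1E// lte_mul_pinfty// ge0_fin_numE.
Qed.

HB.instance Definition _ := Measure_isSigmaFinite.Build _ _ _
  lebesgue_rV_step step_sigma_finite.

End lebesgue_rV_step.

(** Lebesgue measure on R^(n+1) is the product of the Lebesgue measures on R
    and on R^n; [lebesgue_rV_box] below is its characteristic property. *)
Fixpoint lebesgue_rV n : {sigma_finite_measure set 'rV[R]_n -> \bar R} :=
  if n is n'.+1 then lebesgue_rV_step (lebesgue_rV n') else \d_(0 : 'rV[R]_0).

Lemma lebesgue_rV_box n (a b : 'rV[R]_n) : (forall i, a 0 i <= b 0 i) ->
  lebesgue_rV n [set x : 'rV[R]_n | forall i, x 0 i \in `[a 0 i, b 0 i]] =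
  (\prod_(i < n) (b 0 i - a 0 i))%:E.
Proof.
elim: n a b => [|n IH] a b ab.
  rewrite big_ord0 /= diracE mem_set//= => i; by case: i.
pose a' := (rV_uncons a).2; pose b' := (rV_uncons b).2.
have -> : [set x : 'rV[R]_n.+1 | forall i, x 0 i \in `[a 0 i, b 0 i]] =
    @rV_uncons n @^-1`
      (`[a 0 0, b 0 0]%classic `*` [set x : 'rV[R]_n | forall i, x 0 i \in `[a' 0 i, b' 0 i]]).
  apply/seteqP; split => x /=.
    by move=> h; split=> [|i]; [exact: h|rewrite !mxE; exact: h].
  move=> [h0 h] i; have [j ->|->//] := unliftP ord0 i.
  by have := h j; rewrite !mxE.
rewrite /= /lebesgue_rV_step /pushforward.
pose B := [set x : 'rV[R]_n | forall i, x 0 i \in `[a' 0 i, b' 0 i]].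
rewrite -/B.
have mB : measurable B.
  rewrite (_ : B = \bigcap_(i in [set: 'I_n])
      ((fun x : 'rV[R]_n => x 0 i) @^-1` `[a' 0 i, b' 0 i]%classic)); last first.
    by apply/seteqP; split=> x /= h i; [move=> _|]; exact: h.
  apply: fin_bigcap_measurable => // i _.
  by rewrite -[X in measurable X]setTI; apply: measurable_coord.
rewrite preimage_rV_consK.
rewrite product_measure1E//= IH; last by move=> i; rewrite !mxE.
rewrite lebesgue_measure_itv/= lte_fin big_ord_recl EFinM.
case: ltgtP (ab ord0) => // [abl _|-> _].
  rewrite -EFinB; congr (_ * _)%E; congr EFin.
  by apply: eq_bigr => i _; rewrite !mxE.
by rewrite subrr mul0e mul0e.
Qed.

End lebesgue_rV.

Section spaces.
Context (R : realType) (d : nat).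
Implicit Types (Omega : set 'rV[R]_d) (v : 'rV[R]_d -> 'rV[R]_d).
Implicit Types (u w : R -> 'rV[R]_d -> 'rV[R]_d) (T t : R).

Definition dotrv (x y : 'rV[R]_d) : R := \sum_(i < d) x 0 i * y 0 i.

(** The library norm on matrices is the max norm, hence this definition. *)
Definition enorm (x : 'rV[R]_d) : R := Num.sqrt (dotrv x x).

Definition bounded_domain Omega : Prop :=
  [/\ open Omega, connected Omega, Omega !=set0 & bounded_set Omega].

(** x |-> Q x + c with Q antisymmetric; as vectors are rows, Q x is written
    [x *m Q^T]. *)
Definition rigid_motion v : Prop :=
  exists (Q : 'M[R]_d) (c : 'rV[R]_d),
    Q^T = - Q /\ v = (fun x => x *m Q^T + c).

(** Elements of L^oo(Omega; R^d) are given by representatives, of which only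
    the values on Omega matter; they are identified by a.e. equality. *)
Definition Linfty_norm Omega v : \bar R :=
  'N[lebesgue_rV R d]_+oo[EFin \o ((fun x => enorm (v x)) \_ Omega)]%E.

Definition in_X Omega v : Prop :=
  [/\ measurable_fun Omega v,
      (Linfty_norm Omega v < +oo)%E &
      forall z, rigid_motion z ->
        \int[lebesgue_rV R d]_(x in Omega) dotrv (v x) (z x) = 0].

(** Membership in C([0,T]; X). *)
Definition in_C0X Omega T u : Prop :=
  forall t, t \in `[0, T] ->
    in_X Omega (u t) /\
    Linfty_norm Omega (fun x => u s x - u t x)
      @[s --> within [set` `[0, T]] (nbhs t)] --> 0%E.

(** [u'] is the derivative of [u] on [0,T] for the norm of X (one-sided at the
    end points). *)
Definition strong_derivative Omega T u u' : Prop :=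
  forall t, t \in `[0, T] ->
    Linfty_norm Omega (fun x => (s - t)^-1 *: (u s x - u t x) - u' t x)
      @[s --> within [set` `[0, T]] t^'] --> 0%E.

(** [u] belongs to C^2([0,T]; X), with successive derivatives [u1] and [u2]. *)
Definition in_C2X Omega T u u1 u2 : Prop :=
  [/\ in_C0X Omega T u, in_C0X Omega T u1, in_C0X Omega T u2,
      strong_derivative Omega T u u1 & strong_derivative Omega T u1 u2].

(** The integral over the past in [gammaA] and the maximum over the past in
    [gammaB] below are pointwise in (y, x), so they are not invariant under an
    independent choice of the representative of u(t) for each t.  They are
    computed on a version of [u] with continuous paths: every element of
    C([0,T]; L^oo(Omega; R^d)) has one, and any two of them have the same paths
    outside of a null set of points. *)
Definition continuous_version Omega T u w : Prop :=
  (forall t, t \in `[0, T] ->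
     measurable_fun Omega (w t) /\ w t = u t %[ae lebesgue_rV R d in Omega]) /\
  (forall x, Omega x -> {within `[0, T], continuous (fun t => w t x)}).

End spaces.

Section model.
Context (R : realType) (d : nat).
Implicit Types (Omega : set 'rV[R]_d) (v : 'rV[R]_d -> 'rV[R]_d).
Implicit Types (w : R -> 'rV[R]_d -> 'rV[R]_d) (x y : 'rV[R]_d) (t : R).
Implicit Types (J g h : R -> R).

(** "Decreasing" is understood as nonincreasing (J vanishes on [1, +oo)), here
    and for the degradation profiles h below. *)
Definition influence_function (M : R) J : Prop :=
  [/\ forall r, 0 <= r -> 0 <= J r,
      forall r s, 0 <= r -> r <= s -> J s <= J r,
      forall r, 0 <= r < 1 -> 0 < J r,
      J 0 = M &
      forall r, 1 <= r -> J r = 0].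

Definition unit_ball_volume : R :=
  fine (lebesgue_rV R d [set x | enorm x < 1]).

Definition rho_kernel Omega J (eps : R) y x : R :=
  \1_Omega y * J (enorm (y - x) / eps) /
  (eps * (unit_ball_volume * eps ^+ d)).

Definition bond_direction y x : 'rV[R]_d := (enorm (y - x))^-1 *: (y - x).

Definition strain y x v : R :=
  dotrv ((enorm (y - x))^-1 *: (v y - v x)) (bond_direction y x).

Definition scaled_strain y x v : R := Num.sqrt (enorm (y - x)) * strain y x v.

Definition cohesive_potential (rm re rc rp : R) g : Prop :=
  [/\ rm < re, re < 0, 0 < rc & rc < rp] /\
  [/\ forall r, derivable g r 1,
      forall r, derivable g^`()%classic r 1,
      continuous g^`(2)%classic,
      bounded_fun (g^`()%classic) & bounded_fun (g^`(2)%classic)] /\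
  [/\ exists Cm, forall r, r <= rm -> g r = Cm,
      exists Cp, forall r, rp <= r -> g r = Cp,
      convex_function (`[re, rc]%classic : set R) g,
      convex_function (`[rm, re]%classic : set R) (\- g) &
      convex_function (`[rc, rp]%classic : set R) (\- g)].

Definition smooth (f : R -> R) : Prop := forall n r, derivable f^`(n)%classic r 1.

Definition gammaA (rp : R) h w y x t : R :=
  h (\int[@lebesgue_measure R]_(s in `[0, t])
       Num.max (scaled_strain y x (w s) - rp) 0).

Definition max_strain t y x w : R := sup [set strain y x (w s) | s in `[0, t]].

Definition gammaB h w y x t : R :=
  h (Num.sqrt (enorm (y - x)) * max_strain t y x w).

Definition degradation_profileA (xD : R) h : Prop :=
  [/\ 0 < xD, smooth h & forall r, 0 <= h r] /\
  [/\ forall r, r < 0 -> h r = 1,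
      forall r s, 0 <= r -> r <= s -> s < xD -> h s <= h r &
      forall r, xD <= r -> h r = 0].

Definition degradation_profileB (rp rD : R) h : Prop :=
  [/\ rp < rD, smooth h & forall r, 0 <= h r] /\
  [/\ forall r, r <= rp -> h r = 1,
      forall r s, rp <= r -> r <= s -> s <= rD -> h s <= h r &
      forall r, rD <= r -> h r = 0].

Definition degradation_factor (rp : R)
    (gamma : (R -> 'rV[R]_d -> 'rV[R]_d) -> 'rV[R]_d -> 'rV[R]_d -> R -> R) :=
  (exists xD h, degradation_profileA xD h /\ gamma = gammaA rp h) \/
  (exists rD h, degradation_profileB rp rD h /\ gamma = gammaB h).

Definition force_density Omega J (eps : R) g
    (gamma : (R -> 'rV[R]_d -> 'rV[R]_d) -> 'rV[R]_d -> 'rV[R]_d -> R -> R)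
    w t x : 'rV[R]_d :=
  - \row_(i < d) \int[lebesgue_rV R d]_(y in Omega)
      (2 * rho_kernel Omega J eps y x / Num.sqrt (enorm (y - x)) *
       gamma w y x t * g^`()%classic (scaled_strain y x (w t)) *
       bond_direction y x 0 i).

(** [u] is in C^2([0,T]; X), satisfies the equation of motion in X (i.e. almost
    everywhere in Omega) at every time of [0,T], and the initial conditions. *)
Definition solution Omega (T eps rho : R) J g
    (gamma : (R -> 'rV[R]_d -> 'rV[R]_d) -> 'rV[R]_d -> 'rV[R]_d -> R -> R)
    (b : R -> 'rV[R]_d -> 'rV[R]_d) (u0 v0 : 'rV[R]_d -> 'rV[R]_d)
    (u : R -> 'rV[R]_d -> 'rV[R]_d) : Prop :=
  exists u1 u2 w : R -> 'rV[R]_d -> 'rV[R]_d,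
    [/\ in_C2X Omega T u u1 u2,
        continuous_version Omega T u w,
        u 0 = u0 %[ae lebesgue_rV R d in Omega],
        u1 0 = v0 %[ae lebesgue_rV R d in Omega] &
        forall t, t \in `[0, T] ->
          (fun x => rho *: u2 t x + force_density Omega J eps g gamma w t x)
          = b t %[ae lebesgue_rV R d in Omega]].

End model.

(* Main.v *)
(** The force is Lipschitz in the history of the displacement.  The prefactor
    [1 / sqrt |y - x|] of the force and the Lipschitz constants of the scaled
    strain and of the degradation factor, of order [1 / sqrt |y - x|] too, combine
    into the kernel [1 / |y - x|], whose integral over [Omega] is bounded
    uniformly in [x] since [d >= 2].  The bond forces being central and symmetric,
    Fubini's theorem shows that the force is orthogonal to rigid motions, so that
    it maps C([0,T]; X) to itself.

    Existence: replacing the data by representatives that are bounded and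
    continuous in time, uniformly in [x], the equation integrated twice in time
    is a contraction for the supremum norm weighted by [e^(- lam t)] with [lam]
    large, everywhere in [Omega].  Integrals over time preserve measurability and
    orthogonality because they are bounded pointwise limits of Riemann sums.

    Uniqueness: if the difference of two solutions is almost everywhere at most
    [C e^(lam t)] for all times, the same contraction estimate, obtained from
    the mean value inequality for the essential supremum norm, improves [C] to
    [C / 2].

    All estimates use the max norm [`|x|], with [`|x| <= enorm x <= d * `|x|]. *)
Require Import Defs.
From HB Require Import structures.
From mathcomp Require Import all_boot all_order all_algebra.
From mathcomp Require Import all_classical all_reals all_analysis.
From mathcomp Require Import measurable_realfun ess_sup_inf ring.
Set Implicit Arguments. Unset Strict Implicit. Unset Printing Implicit Defensive.
Import Order.TTheory GRing.Theory Num.Def Num.Theory.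
Import numFieldNormedType.Exports.
Local Open Scope classical_set_scope.
Local Open Scope ring_scope.

(** * Continuous functions of time *)

Section time_paths.
Context {R : realType}.
Implicit Types (T t s a b c e r del C : R).

(** The obstacle is that the degradation factor depends on whole histories at fixed points, whereas
    elements of X are classes modulo null sets, with a different null set for each time. Hence three
    kinds of paths: [in_C0X] (classes), [X_path] (bounded at every point and continuous in time
    uniformly in space) and [measurable_path] (continuous in time at each point only), the last
    being all that the continuous version of an arbitrary solution offers. The Lipschitz estimate of
    the force is proved for measurable paths, from a bound at the point [x] itself and a bound for
    almost every [y]; in this form it serves existence and uniqueness alike.

    Memory is harmless in the contraction because the weight e^(lam t) increases: a weighted bound
    at all times bounds the whole past of [t] by its value at [t].

    For case (b), measurability in space of the maximum over the past comes from maxima over finite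
    grids of times. *)

Definition path_continuous {V : normedModType R} T (f : R -> V) :=
  forall t, 0 <= t <= T -> forall e, 0 < e -> exists2 del : R, 0 < del &
    forall s, 0 <= s <= T -> `|s - t| < del -> `|f s - f t| <= e.

Lemma path_continuousP (V : normedModType R) T (f : R -> V) :
  {within `[0, T], continuous f} <-> path_continuous T f.
Proof.
split=> [/subspace_continuousP cf t t0T e e0|cf].
  have := cf t; rewrite /= in_itv => /(_ t0T)/cvgrPdist_le /(_ e e0).
  move=> [del /= del0 H]; exists del => // s s0T std.
  rewrite distrC; apply: H => /=; first by rewrite /ball /= distrC.
  by rewrite in_itv.
apply/subspace_continuousP => t; rewrite /= in_itv /= => t0T.
apply/cvgrPdist_le => e e0; have [del del0 H] := cf t t0T e e0.
exists del => //= s /= std.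
by rewrite in_itv /= => s0T; rewrite distrC; apply: H => //; rewrite distrC.
Qed.

(** Compactness of [0, T] for a quantity known only through its upper bounds: [B t C] reads as a
    bound by [C] at time [t]. It is applied to norms, to suprema over [Omega] and to bounds almost
    everywhere. *)
Lemma segment_locally_bounded T (B : R -> R -> Prop) :
  (forall t C C', C <= C' -> B t C -> B t C') ->
  (forall t, 0 <= t <= T -> exists2 del : R, 0 < del & exists C,
     forall s, 0 <= s <= T -> `|s - t| < del -> B s C) ->
  exists C, forall t, 0 <= t <= T -> B t C.
Proof.
move=> Bmono Bloc.
have /compact_near_coveringP cpt := @segment_compact R 0 T.
(* The parameter of the covering is the bound, along the filter at infinity: near each time every
   large bound works, hence one bound works for all times. *)
case: (cpt _ (pinfty_nbhs R) (fun C s => 0 <= s <= T -> B s C) _).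
  move=> t; rewrite /= in_itv /= => /Bloc[del del0 [C HC]].
  exists ([set s | `|s - t| < del], [set C' | C < C']) => /=.
    split; last by exists C; split => //; exact: num_real.
    by exists del => //= s /=; rewrite distrC.
  by move=> [s C'] [/= st CC'] s0T; apply: Bmono (ltW CC') _; exact: HC.
move=> C [_ H]; exists (C + 1) => t t0T.
by apply: H; rewrite ?ltrDl//= in_itv.
Qed.

Lemma path_continuous_bounded (V : normedModType R) T (f : R -> V) :
  path_continuous T f -> exists C, forall t, 0 <= t <= T -> `|f t| <= C.
Proof.
move=> cf; apply: segment_locally_bounded => [t C C' CC' h|t t0T].
  exact: le_trans CC'.
have [del del0 H] := cf t t0T 1 ltr01; exists del => //.
exists (`|f t| + 1) => s s0T st; rewrite -(subrK (f t) (f s)) addrC.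
by rewrite (le_trans (ler_normD _ _))// lerD2l H.
Qed.

(** Heine's theorem, by the same covering argument with the modulus as parameter, along the filter
    of small positive numbers. *)
Lemma path_uniformly_continuous (V : normedModType R) T (f : R -> V) e :
  path_continuous T f -> 0 < e ->
  exists2 del : R, 0 < del & forall s t, 0 <= s <= T -> 0 <= t <= T ->
    `|s - t| < del -> `|f s - f t| <= e.
Proof.
move=> cf e0.
have /compact_near_coveringP cpt := @segment_compact R 0 T.
case: (cpt _ (0^'+) (fun del t => 0 <= t <= T ->
    forall s, 0 <= s <= T -> `|s - t| < del -> `|f s - f t| <= e) _).
  move=> t; rewrite /= in_itv /= => t0T.
  have [del del0 H] := cf t t0T (e / 2) (divr_gt0 e0 (ltr0n _ 2)).
  have del20 : 0 < del / 2 by rewrite divr_gt0.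
  exists ([set s | `|s - t| < del / 2], [set r | r < del / 2]) => /=.
    split; first by exists (del / 2) => //= s /=; rewrite distrC.
    exists (del / 2) => //= r /=; rewrite sub0r normrN => rd _.
    exact: le_lt_trans (ler_norm _) rd.
  move=> [s r] [/= st rd] s0T q q0T qs.
  rewrite -(subrKA (f t)) (le_trans (ler_normD _ _))// [leRHS]splitr lerD//.
    apply: H => //; rewrite -(subrKA s) (le_lt_trans (ler_normD _ _))//.
    by rewrite [ltRHS]splitr ltrD// (lt_trans qs).
  rewrite distrC; apply: H => //; apply: lt_trans st _.
  by rewrite ltr_pdivrMr// ltr_pMr// ltr1n.
move=> del /= del0 H; exists (del / 2); first by rewrite divr_gt0.
move=> s t s0T t0T st; apply: (H (del / 2)) => //.
- by rewrite /= sub0r normrN gtr0_norm ?divr_gt0// ltr_pdivrMr// ltr_pMr// ltr1n.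
- by rewrite divr_gt0.
Qed.

(** Convertible to the integral in [gammaA], to which the estimates below thus apply directly. *)
Definition prim (f : R -> R) t : R :=
  \int[@lebesgue_measure R]_(s in `[0, t]) f s.

Lemma path_continuousW (V : normedModType R) T T' (f : R -> V) :
  T' <= T -> path_continuous T f -> path_continuous T' f.
Proof.
move=> TT' cf t /andP[t0 tT] e e0.
have [|del del0 H] := cf t _ e e0; first by rewrite t0 (le_trans tT).
by exists del => // s /andP[s0 sT]; apply: H; rewrite s0 (le_trans sT).
Qed.

Lemma path_integrable T (f : R -> R) : path_continuous T f ->
  (@lebesgue_measure R).-integrable `[0, T] (EFin \o f).
Proof.
move=> /path_continuousP; apply: continuous_compact_integrable.
exact: segment_compact.
Qed.

(** Common source of the Lipschitz bound ([c = 0]), of the derivative ([c = f t]) and of the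
    convergence of Riemann sums ([c] the value at the left grid point). *)
Lemma prim_incr T (f : R -> R) a b c e : path_continuous T f ->
  0 <= a -> a <= b -> b <= T ->
  (forall s, a <= s <= b -> `|f s - c| <= e) ->
  `|prim f b - prim f a - (b - a) * c| <= e * (b - a).
Proof.
move=> cf a0 ab bT H; rewrite /prim.
have mI : measurable ([set` Interval (BRight a) (BRight b)] : set R) by [].
have fI : (@lebesgue_measure R).-integrable `[0, b] (EFin \o f).
  exact: path_integrable (path_continuousW bT cf).
have fI' : (@lebesgue_measure R).-integrable `]a, b] (EFin \o f).
  apply: integrableS fI => //; apply: subset_itvr.
  by rewrite bnd_simp.
have cI r : (@lebesgue_measure R).-integrable `]a, b] (EFin \o (fun=> r)).
  have : (@lebesgue_measure R).-integrable `[0, b] (EFin \o (fun=> r)).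
    apply: (@path_integrable b (fun=> r)) => t _ e' e'0; exists 1 => // s _ _.
    by rewrite subrr normr0 ltW.
  by apply: integrableS => //; apply: subset_itvr; rewrite bnd_simp.
have lE : fine (@lebesgue_measure R `]a, b]) = b - a.
  rewrite lebesgue_measure_itv /= lte_fin; by case: ltgtP ab => //= -> _; rewrite subrr.
rewrite Rintegral_itvB//.
have abs s : s \in `]a, b] -> a <= s <= b.
  by rewrite in_itv /= => /andP[/ltW -> ->].
have l1 : (c - e) * (b - a) <= \int[@lebesgue_measure R]_(s in `]a, b]) f s.
  rewrite -lE -Rintegral_cst//; apply: le_Rintegral => // s /abs /H.
  by rewrite ler_norml lerBrDr addrC => /andP[].
have l2 : \int[@lebesgue_measure R]_(s in `]a, b]) f s <= (c + e) * (b - a).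
  rewrite -lE -Rintegral_cst//; apply: le_Rintegral => // s /abs /H.
  by rewrite ler_norml lerBlDl => /andP[].
rewrite ler_norml; apply/andP; split.
  have -> : - (e * (b - a)) = (c - e) * (b - a) - (b - a) * c by ring.
  by rewrite lerD2r.
have -> : e * (b - a) = (c + e) * (b - a) - (b - a) * c by ring.
by rewrite lerD2r.
Qed.

Lemma prim0 f : prim f 0 = 0.
Proof. by rewrite /prim set_itv1 Rintegral_set1. Qed.

Lemma prim_lipschitz T (f : R -> R) C s t : path_continuous T f ->
  (forall t, 0 <= t <= T -> `|f t| <= C) -> 0 <= s <= T -> 0 <= t <= T ->
  `|prim f s - prim f t| <= C * `|s - t|.
Proof.
move=> cf fC; wlog st : s t / t <= s.
  move=> H s0T t0T; have [ts|/ltW st] := leP t s; first exact: H.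
  by rewrite distrC [X in C * X]distrC; exact: H.
move=> /andP[s0 sT] /andP[t0 tT].
rewrite [X in C * X]ger0_norm ?subr_ge0//.
have := @prim_incr T f t s 0 C cf t0 st sT.
rewrite mulr0 subr0; apply=> r /andP[tr rs]; rewrite subr0; apply: fC.
by rewrite (le_trans t0)//= (le_trans rs).
Qed.

(** The modulus [del] is given rather than produced, so that [tint_derivative] can use one modulus
    for all points of [Omega]. *)
Lemma prim_derivative T (f : R -> R) t e : path_continuous T f ->
  0 <= t <= T -> forall del,
  (forall s, 0 <= s <= T -> `|s - t| < del -> `|f s - f t| <= e) ->
  forall s, 0 <= s <= T -> `|s - t| < del ->
  `|prim f s - prim f t - (s - t) * f t| <= e * `|s - t|.
Proof.
move=> cf /andP[t0 tT] del H s /andP[s0 sT] std.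
have [st|/ltW ts] := leP s t.
  have -> : prim f s - prim f t - (s - t) * f t =
      - (prim f t - prim f s - (t - s) * f t) by ring.
  rewrite normrN [`|s - t|]distrC [`|t - s|]ger0_norm ?subr_ge0//.
  apply: (prim_incr cf) => // r /andP[sr rt]; apply: H.
    by rewrite (le_trans s0)//= (le_trans rt).
  apply: le_lt_trans std; rewrite distrC [leRHS]distrC !ger0_norm ?subr_ge0//.
  by rewrite lerD2l lerN2.
rewrite [`|s - t|]ger0_norm ?subr_ge0//.
apply: (prim_incr cf) => // r /andP[tr rs]; apply: H.
  by rewrite (le_trans t0)//= (le_trans rs).
by apply: le_lt_trans std; rewrite !ger0_norm ?subr_ge0// lerD2r.
Qed.

Definition grid t (n k : nat) : R := t * (k%:R / n.+1%:R).

Lemma grid_ge0 t n k : 0 <= t -> 0 <= grid t n k.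
Proof. by move=> t0; rewrite mulr_ge0// divr_ge0. Qed.

Lemma grid_le t n k : 0 <= t -> (k <= n.+1)%N -> grid t n k <= t.
Proof.
move=> t0 kn; rewrite -[leRHS]mulr1 ler_wpM2l// ler_pdivrMr ?ltr0n//.
by rewrite mul1r ler_nat.
Qed.

Lemma grid_step t n k : grid t n k.+1 - grid t n k = t / n.+1%:R.
Proof. by rewrite /grid -mulrBr -mulrBl -natrB// subSnn mul1r. Qed.

Lemma mesh_small t del : 0 < del ->
  exists N, forall n, (N <= n)%N -> t / n.+1%:R < del.
Proof.
move=> del0; exists (Num.bound `|t / del|) => n Nn.
rewrite ltr_pdivrMr ?ltr0n// mulrC -ltr_pdivrMr//.
apply: le_lt_trans (ler_norm _) _.
apply: lt_le_trans (archi_boundP (normr_ge0 _)) _.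
by rewrite ler_nat ltnW.
Qed.

Lemma prim_riemann T (f : R -> R) t : path_continuous T f -> 0 <= t <= T ->
  (t / n.+1%:R * \sum_(k < n.+1) f (grid t n k)) @[n --> \oo] --> prim f t.
Proof.
move=> cf /andP[t0 tT]; apply/cvgrPdist_le => e e0.
(* The cells contribute at most [e / (t + 1) * t] in total; [t + 1] instead of [t] admits
   [t = 0]. *)
have e'0 : 0 < e / (t + 1) by rewrite divr_gt0// ltr_wpDl.
have [del del0 H] := path_uniformly_continuous cf e'0.
have [N HN] := mesh_small t del0.
near=> n.
have -> : prim f t = \sum_(0 <= k < n.+1) (prim f (grid t n k.+1) - prim f (grid t n k)).
  rewrite telescope_sumr// {2}/grid mul0r mulr0 prim0 subr0.
  by rewrite /grid divff ?mulr1// pnatr_eq0.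
rewrite big_mkord mulr_sumr -sumrB (le_trans (ler_norm_sum _ _ _))//.
have -> : e = (\sum_(k < n.+1) e / n.+1%:R).
  by rewrite sumr_const card_ord -[RHS]mulr_natr divfK// pnatr_eq0.
apply: ler_sum => k _.
have k1 : grid t n k <= grid t n k.+1.
  by rewrite -subr_ge0 grid_step divr_ge0.
have tn0 : 0 <= t / n.+1%:R by rewrite divr_ge0.
have g1 := grid_le t0 (ltn_ord k).
have g0 : grid t n k <= t by rewrite (le_trans k1).
have := @prim_incr T f (grid t n k) (grid t n k.+1) (f (grid t n k))
  (e / (t + 1)) cf (grid_ge0 _ _ t0) k1.
rewrite grid_step => /(_ (le_trans g1 tT)) P.
apply: le_trans (P _) _.
  move=> s /andP[ks sk]; apply: H.
  - by rewrite (le_trans (grid_ge0 _ _ t0) ks)//= (le_trans sk)// (le_trans g1).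
  - by rewrite grid_ge0//= (le_trans g0).
  rewrite ger0_norm ?subr_ge0// (@le_lt_trans _ _ (t / n.+1%:R))//.
    by rewrite -(grid_step t n k) lerD2r.
  by apply: HN; near: n; exists N.
rewrite mulrA ler_wpM2r ?invr_ge0// -[leRHS]mulr1 -mulrA ler_wpM2l ?(ltW e0)//.
by rewrite mulrC ler_pdivrMr ?mul1r ?lerDl// ltr_wpDl.
Unshelve. all: by end_near.
Qed.

(** Convertible to [max_strain] when [f] is the strain along a path. *)
Definition psup (f : R -> R) t : R := sup [set f s | s in `[0, t]].

Lemma psup_ge T (f : R -> R) s t : path_continuous T f -> t <= T -> 0 <= s <= t ->
  f s <= psup f t.
Proof.
move=> cf tT st; have [C HC] := path_continuous_bounded (path_continuousW tT cf).
apply: ub_le_sup; last by exists s => //=; rewrite in_itv.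
exists C => y [r /=]; rewrite in_itv /= => /HC rC <-.
exact: le_trans (ler_norm _) rC.
Qed.

Lemma psup_le f t C : 0 <= t -> (forall s, 0 <= s <= t -> f s <= C) ->
  psup f t <= C.
Proof.
move=> t0 H; apply: ge_sup.
  by exists (f 0), 0 => //=; rewrite in_itv /= lexx.
by move=> y [s /=]; rewrite in_itv /= => /H sC <-.
Qed.

(** Counterpart of [prim_riemann] for [gammaB]. The grid has [n.+2] points, both ends included; the
    default value [f 0] of the maximum is the value at the point of index 0. *)
Lemma psup_grid T (f : R -> R) t : path_continuous T f -> 0 <= t <= T ->
  (\big[Num.max/f 0]_(k < n.+2) f (grid t n k)) @[n --> \oo] --> psup f t.
Proof.
move=> cf /andP[t0 tT]; apply/cvgrPdist_le => e e0.
have [del del0 H] := path_uniformly_continuous cf e0.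
have [N HN] := mesh_small t del0.
near=> n.
have tn : t / n.+1%:R < del by apply: HN; near: n; exists N.
rewrite ger0_norm; last first.
  rewrite subr_ge0; apply: bigmax_le => [|k _].
    by apply: psup_ge cf tT _; rewrite lexx.
  by apply: psup_ge cf tT _; rewrite grid_ge0//= grid_le// -ltnS.
rewrite lerBlDl; apply: psup_le => // s /andP[s0 st].
have s0T : 0 <= s <= T by rewrite s0 (le_trans st).
have [k kn ks] : exists2 k, (k < n.+2)%N & `|s - grid t n k| < del.
  have [t00|t_neq0] := eqVneq t 0.
    exists 0 => //; rewrite /grid mul0r mulr0 subr0 ger0_norm//.
    by rewrite (le_lt_trans st)// t00.
  have tgt0 : 0 < t by rewrite lt_neqAle eq_sym t_neq0.
  (* Index of the last grid point at or before [s], hence at distance less than the mesh. *)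
  pose k := Num.truncn (s * n.+1%:R / t).
  have sn0 : 0 <= s * n.+1%:R / t by rewrite divr_ge0// mulr_ge0.
  have /andP[k1 k2] := truncn_itv sn0.
  exists k.
    rewrite ltnS -(ler_nat R) (le_trans k1)// ler_pdivrMr// mulrC.
    by rewrite ler_wpM2l.
  have gs : grid t n k <= s.
    by rewrite /grid mulrA ler_pdivrMr ?ltr0n// mulrC -ler_pdivlMr.
  rewrite ger0_norm ?subr_ge0// (lt_trans _ tn)// -(grid_step t n k).
  rewrite ltrD2r /grid mulrA ltr_pdivlMr ?ltr0n// [ltRHS]mulrC.
  by rewrite -ltr_pdivrMr.
have gT : 0 <= grid t n k <= T.
  by rewrite grid_ge0//= (le_trans _ tT)// grid_le// -ltnS.
rewrite -lerBlDr (le_trans _ (le_bigmax _ _ (Ordinal kn)))//= lerBlDr -lerBlDl.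
by rewrite (le_trans (ler_norm _))// H.
Unshelve. all: by end_near.
Qed.

(* Mean value inequality with the bound [A e^(lam t)], by real induction on
   [0, T].  It is stated for an arbitrary relation [B t C], read as "the norm at
   time [t] is at most [C]", because the norm will be an essential supremum. *)
Lemma growth_bound T lam A (B : R -> R -> Prop) : 0 <= lam -> 0 <= A ->
  (forall t C C', C <= C' -> B t C -> B t C') ->
  (forall t C, 0 <= t <= T -> (forall e, 0 < e -> B t (C + e)) -> B t C) ->
  (forall c, 0 <= c <= T -> forall e, 0 < e -> exists2 del : R, 0 < del &
    forall s, 0 <= s <= T -> `|s - c| < del -> forall C,
    (c <= s -> B c C -> B s (C + (s - c) * (A * lam * expR (lam * c) + e))) /\
    (s <= c -> B s C -> B c (C + (c - s) * (A * lam * expR (lam * c) + e)))) ->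
  B 0 A -> forall t, 0 <= t <= T -> B t (A * expR (lam * t)).
Proof.
move=> lam0 A0 Bmono Bclosed Bstep B0.
(* The additional slope [e] absorbs the error allowed in the step hypothesis; it is then sent to 0
   by closedness. *)
suff H e : 0 < e -> forall t, 0 <= t <= T -> B t (A * expR (lam * t) + e * t).
  move=> t t0T; apply: Bclosed => // e e0; move: (t0T) => /andP[t0 tT].
  have e'0 : 0 < e / (t + 1) by rewrite divr_gt0// ltr_wpDl.
  apply: Bmono (H _ e'0 t t0T); rewrite lerD2l mulrAC -mulrA.
  rewrite -[leRHS]mulr1 ler_wpM2l ?(ltW e0)// ler_pdivrMr ?ltr_wpDl// mul1r lerDl//.
move=> e0; pose psi t := A * expR (lam * t) + e * t.
have K0 c : 0 <= A * lam * expR (lam * c) + e.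
  by rewrite addr_ge0 ?(ltW e0)// mulr_ge0 ?expR_ge0// mulr_ge0.
have psi_up s t : s <= t -> psi s <= psi t.
  move=> st; rewrite lerD// ler_wpM2l//; last exact: ltW.
  by rewrite ler_expR ler_wpM2l.
(* [psi] lies above its tangent at [s], by [1 + x <= e^x]. *)
have psi_step s t : s <= t ->
    psi s + (t - s) * (A * lam * expR (lam * s) + e) <= psi t.
  move=> st; rewrite /psi.
  have -> : A * expR (lam * s) + e * s + (t - s) * (A * lam * expR (lam * s) + e)
     = A * (expR (lam * s) * (1 + lam * (t - s))) + e * t by ring.
  rewrite lerD2r ler_wpM2l//.
  have -> : expR (lam * t) = expR (lam * s) * expR (lam * (t - s)).
    by rewrite -expRD; congr expR; ring.
  by rewrite ler_wpM2l ?expR_ge0// expR_ge1Dx.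
move=> t /andP[t0 tT].
pose S := [set r | 0 <= r <= T /\ forall s, 0 <= s <= r -> B s (psi s)].
have T0 := le_trans t0 tT.
have S0 : S 0.
  split; first by rewrite lexx.
  move=> s; rewrite -eq_le => /eqP <-.
  by rewrite /psi !mulr0 expR0 mulr1 addr0.
have supS : has_sup S.
  by split; [exists 0|exists T => r [/andP[]]].
pose c := sup S.
have c0 : 0 <= c by apply: ub_le_sup => //; case: supS.
have cT : c <= T by apply: ge_sup; [exists 0|move=> r [/andP[]]].
have below s : 0 <= s -> s < c -> B s (psi s).
  move=> s0 sc; have := @sup_adherent _ S (c - s).
  rewrite subr_gt0 => /(_ sc supS)[r [_ Hr]].
  rewrite -/c subKr => sr; apply: Hr; rewrite s0/=; exact: ltW.
(* The slope in [Bstep] is the one at [c], so [psi_step] from an earlier [s] does not apply. Instead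
   [s] is so close to [c] that the increment is at most [eta], and closedness removes [eta]. *)
have Bc : B c (psi c).
  have [c00|cn0] := eqVneq c 0.
    by rewrite c00; case: S0 => _; apply; rewrite lexx.
  have cgt0 : 0 < c by rewrite lt_neqAle eq_sym cn0.
  apply: Bclosed => [|eta eta0]; first by rewrite c0.
  have [|del del0 Hdel] := Bstep c _ e e0; first by rewrite c0.
  pose K := A * lam * expR (lam * c) + e.
  (* The first entry keeps [s] within the reach of [Bstep], the second gives [m * K <= eta]. *)
  pose m := Num.min (del / 2) (eta / (K + 1)).
  have K10 : 0 < K + 1 by rewrite ltr_wpDl// K0.
  have m0 : 0 < m by rewrite lt_min !divr_gt0.
  pose s := Num.max 0 (c - m).
  have s0 : 0 <= s by rewrite le_max lexx.
  have sc : s < c by rewrite gt_max cgt0 ltrBlDr ltrDl.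
  have csm : c - s <= m by rewrite lerBlDr addrC -lerBlDr le_max lexx orbT.
  have [||_ /(_ (ltW sc) (below _ s0 sc))] := Hdel s _ _ (psi s).
  - by rewrite s0 (le_trans (ltW sc)).
  - rewrite distrC gtr0_norm ?subr_gt0// (le_lt_trans csm)//.
    rewrite gt_min; apply/orP; left.
    by rewrite ltr_pdivrMr// ltr_pMr// ltr1n.
  apply: Bmono; apply: lerD; first exact/psi_up/ltW.
  rewrite -/K (@le_trans _ _ (eta / (K + 1) * K))//.
    rewrite ler_wpM2r ?K0// (le_trans csm)//; by rewrite ge_min lexx orbT.
  rewrite mulrAC ler_pdivrMr// ler_wpM2l ?(ltW eta0)// lerDl//.
have Sc : S c.
  split; first by rewrite c0.
  move=> s /andP[s0]; rewrite le_eqVlt => /predU1P[->//|]; exact: below.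
have [cltT|Tc] := ltP c T; last first.
  by case: Sc => _; apply; rewrite t0 (le_trans tT).
have [|del del0 Hdel] := Bstep c _ e e0; first by rewrite c0.
(* If [c < T], the forward half of [Bstep] carries the bound beyond [c], against the choice of [c]
   as supremum. *)
pose t' := Num.min T (c + del / 2).
have ct' : c < t' by rewrite lt_min cltT ltrDl divr_gt0.
suff St' : S t'.
  have : t' <= c by apply: ub_le_sup => //; case: supS.
  by rewrite leNgt ct'.
have t'T : t' <= T by rewrite ge_min lexx.
split; first by rewrite t'T (le_trans c0)// ltW.
move=> s /andP[s0 st']; have [sc|cs] := leP s c.
  by case: Sc => _; apply; rewrite s0.
have [||/(_ (ltW cs) Bc) + _] := Hdel s _ _ (psi c).
- by rewrite s0 (le_trans st').
- rewrite gtr0_norm ?subr_gt0// ltrBlDl (le_lt_trans st')//.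
  rewrite gt_min; apply/orP; right.
  by rewrite ltrD2l ltr_pdivrMr// ltr_pMr// ltr1n.
by apply: Bmono; apply: psi_step; exact: ltW.
Qed.

(** [growth_bound] for the absolute value; its use for bounds almost everywhere is [ae_growth]. *)
Lemma prim_growth T lam A f : 0 <= lam -> 0 <= A -> path_continuous T f ->
  (forall s, 0 <= s <= T -> `|f s| <= A * lam * expR (lam * s)) ->
  forall t, 0 <= t <= T -> `|prim f t| <= A * expR (lam * t).
Proof.
move=> lam0 A0 cf fA; apply: (@growth_bound T lam A (fun t C => `|prim f t| <= C)) => //.
- by move=> t C C' CC' h; exact: le_trans CC'.
- by move=> t C _ h; apply/ler_addgt0Pr.
- move=> c cT e e0; have [del del0 H] := cf c cT e e0.
  exists del => // s sT sc C.
  have P := prim_derivative cf cT H sT sc.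
  have fc : `|s - c| * `|f c| <= `|s - c| * (A * lam * expR (lam * c)).
    by rewrite ler_wpM2l// fA.
  have Q : `|prim f s - prim f c| <= `|s - c| * (A * lam * expR (lam * c) + e).
    rewrite mulrDr -(subrK ((s - c) * f c) (prim f s - prim f c)).
    rewrite (le_trans (ler_normD _ _))// addrC lerD//; first by rewrite normrM.
    by rewrite [leRHS]mulrC.
  split=> [cs hc|cs hs].
    rewrite -(subrK (prim f c) (prim f s)) (le_trans (ler_normD _ _))// addrC.
    by rewrite lerD// -[s - c]ger0_norm ?subr_ge0.
  rewrite -(subrK (prim f s) (prim f c)) (le_trans (ler_normD _ _))// addrC.
  rewrite lerD// distrC -[X in X * _]ger0_norm ?subr_ge0//.
  by rewrite [X in X * _]distrC.
- by rewrite prim0 normr0.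
Qed.

Lemma psup_dist T (f g : R -> R) t C : path_continuous T f ->
  path_continuous T g -> 0 <= t <= T ->
  (forall s, 0 <= s <= t -> `|f s - g s| <= C) ->
  `|psup f t - psup g t| <= C.
Proof.
move=> cf cg /andP[t0 tT] H.
have half (p q : R -> R) : path_continuous T q ->
    (forall s, 0 <= s <= t -> `|p s - q s| <= C) -> psup p t - psup q t <= C.
  move=> cq pq; rewrite lerBlDr; apply: psup_le => // s st.
  rewrite -(subrK (q s) (p s)) lerD ?(psup_ge cq)//.
  by rewrite (le_trans (ler_norm _))// pq.
rewrite ler_norml; apply/andP; split; last exact: half.
by rewrite lerNl opprB half// => s st; rewrite distrC H.
Qed.

Lemma psup_homo T (f : R -> R) s t : path_continuous T f -> 0 <= s -> s <= t ->
  t <= T -> psup f s <= psup f t.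
Proof.
move=> cf s0 st tT; apply: psup_le => // r /andP[r0 rs].
by apply: psup_ge cf tT _; rewrite r0 (le_trans rs).
Qed.

(** The two maxima differ only by the values of [f] between [s] and [t]. Variations are measured
    from [f t], so that for [s < t] these values are compared with [f s] through [f t], whence the
    factor 2. *)
Lemma psup_time T (f : R -> R) s t C : path_continuous T f -> 0 <= s <= T ->
  0 <= t <= T ->
  (forall r, 0 <= r <= T -> `|r - t| <= `|s - t| -> `|f r - f t| <= C) ->
  `|psup f s - psup f t| <= C *+ 2.
Proof.
move=> cf /andP[s0 sT] /andP[t0 tT] H.
have C0 : 0 <= C.
  by rewrite (le_trans (normr_ge0 (f t - f t)))// H ?t0// subrr normr0.
have [st|/ltW ts] := leP s t.
  rewrite distrC ger0_norm ?subr_ge0 ?(psup_homo cf)// lerBlDr.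
  apply: psup_le => // r /andP[r0 rt]; have [rs|/ltW sr] := leP r s.
    by rewrite -[leLHS]add0r lerD ?mulrn_wge0// (psup_ge cf)// r0.
  rewrite -(subrK (f s) (f r)) lerD//; last by rewrite (psup_ge cf)// s0 lexx.
  rewrite -(subrKA (f t)) mulr2n lerD//.
    rewrite (le_trans (ler_norm _))// H//; first by rewrite r0 (le_trans rt).
    by rewrite distrC [leRHS]distrC !ger0_norm ?subr_ge0// lerD2l lerN2.
  by rewrite (le_trans (ler_norm _))// distrC H// s0.
rewrite ger0_norm ?subr_ge0 ?(psup_homo cf)// lerBlDr.
apply: psup_le => // r /andP[r0 rs]; have [rt|/ltW tr] := leP r t.
  by rewrite -[leLHS]add0r lerD ?mulrn_wge0// (psup_ge cf)// r0.
rewrite -(subrK (f t) (f r)) lerD//; last by rewrite (psup_ge cf)// t0 lexx.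
rewrite (@le_trans _ _ C)//; last by rewrite mulr2n lerDl.
rewrite (le_trans (ler_norm _))// H//; first by rewrite r0 (le_trans rs).
by rewrite !ger0_norm ?subr_ge0// lerD2r.
Qed.

End time_paths.

(** * Strains *)

Section vectors.
Context {R : realType} {d : nat}.
Implicit Types (x y z : 'rV[R]_d) (v : 'rV[R]_d -> 'rV[R]_d) (c : R).

Lemma dotrvDl x y z : dotrv (x + y) z = dotrv x z + dotrv y z.
Proof.
by rewrite /dotrv -big_split; apply: eq_bigr => i _; rewrite mxE mulrDl.
Qed.

Lemma dotrvZl c x y : dotrv (c *: x) y = c * dotrv x y.
Proof. by rewrite /dotrv mulr_sumr; apply: eq_bigr => i _; rewrite mxE mulrA. Qed.

Lemma dotrvC x y : dotrv x y = dotrv y x.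
Proof. by apply: eq_bigr => i _; rewrite mulrC. Qed.

Lemma dotrvNl x y : dotrv (- x) y = - dotrv x y.
Proof. by rewrite -scaleN1r dotrvZl mulN1r. Qed.

Lemma dotrvBl x y z : dotrv (x - y) z = dotrv x z - dotrv y z.
Proof. by rewrite dotrvDl dotrvNl. Qed.

Lemma coord_le_norm x i : `|x 0 i| <= `|x|.
Proof.
rewrite [leRHS]/Num.norm/= mx_normrE.
exact: (le_bigmax _ (fun j : 'I_1 * 'I_d => `|x j.1 j.2|) (0, i)).
Qed.

Lemma norm_le_coord x c : 0 <= c -> (forall i, `|x 0 i| <= c) -> `|x| <= c.
Proof.
move=> c0 H; rewrite [leLHS]/Num.norm/= mx_normrE.
by apply: bigmax_le => // -[i j] _ /=; rewrite ord1.
Qed.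

Lemma enorm_ge0 x : 0 <= enorm x.
Proof. exact: sqrtr_ge0. Qed.

Lemma coord_le_enorm x i : `|x 0 i| <= enorm x.
Proof.
rewrite -sqrtr_sqr ler_wsqrtr// /dotrv (bigD1 i)//= expr2 lerDl.
by apply: sumr_ge0 => j _; rewrite -expr2 sqr_ge0.
Qed.

Lemma norm_le_enorm x : `|x| <= enorm x.
Proof. by apply: norm_le_coord (enorm_ge0 x) (coord_le_enorm x). Qed.

Lemma dotrv_le x y : `|dotrv x y| <= d%:R * (`|x| * `|y|).
Proof.
rewrite (le_trans (ler_norm_sum _ _ _))// mulrC.
rewrite (@le_trans _ _ (\sum_(i < d) `|x| * `|y|))//; last first.
  by rewrite sumr_const card_ord mulr_natr.
by apply: ler_sum => i _; rewrite normrM ler_pM// coord_le_norm.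
Qed.

Lemma enorm_le_norm x : enorm x <= d%:R * `|x|.
Proof.
rewrite -[leRHS]ger0_norm ?mulr_ge0// -sqrtr_sqr ler_wsqrtr//.
rewrite (le_trans (ler_norm _))// (le_trans (dotrv_le x x))//.
rewrite exprMn -expr2 ler_wpM2r ?sqr_ge0//.
by rewrite -natrX ler_nat; case: d => // n; rewrite expnS leq_pmulr// expn_gt0.
Qed.

Lemma enormN x : enorm (- x) = enorm x.
Proof. by rewrite /enorm dotrvNl dotrvC dotrvNl opprK. Qed.

Lemma enormC x y : enorm (x - y) = enorm (y - x).
Proof. by rewrite -enormN opprB. Qed.

Lemma enormZ c x : enorm (c *: x) = `|c| * enorm x.
Proof.
rewrite /enorm dotrvZl dotrvC dotrvZl mulrA -expr2 sqrtrM ?sqr_ge0//.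
by rewrite sqrtr_sqr.
Qed.

Lemma bond_directionC y x : bond_direction y x = - bond_direction x y.
Proof. by rewrite /bond_direction enormC -scalerN opprB. Qed.

Lemma bond_direction_le1 y x : `|bond_direction y x| <= 1.
Proof.
rewrite (le_trans (norm_le_enorm _))// /bond_direction enormZ.
rewrite ger0_norm ?invr_ge0 ?enorm_ge0//.
by have [->|n0] := eqVneq (enorm (y - x)) 0; rewrite ?invr0 ?mul0r// mulVf.
Qed.

Lemma strainC y x v : strain y x v = strain x y v.
Proof.
rewrite /strain bond_directionC enormC dotrvC dotrvNl dotrvC -dotrvNl.
by rewrite -scalerN opprB.
Qed.

Lemma scaled_strainC y x v : scaled_strain y x v = scaled_strain x y v.
Proof. by rewrite /scaled_strain strainC enormC. Qed.

Lemma strainB y x v v' :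
  strain y x v - strain y x v' = strain y x (fun z => v z - v' z).
Proof.
rewrite /strain -dotrvBl -scalerBr; congr (dotrv (_ *: _) _).
by apply/rowP => i; rewrite !mxE; ring.
Qed.

Lemma strain_le y x v C : `|v y| <= C -> `|v x| <= C ->
  `|strain y x v| <= d%:R * 2 * C * (enorm (y - x))^-1.
Proof.
move=> vy vx; rewrite (le_trans (dotrv_le _ _))//.
have i0 : 0 <= (enorm (y - x))^-1 by rewrite invr_ge0 enorm_ge0.
rewrite -2!mulrA ler_wpM2l// normrZ ger0_norm// mulrA [leRHS]mulrC.
rewrite (le_trans (ler_piMr _ (bond_direction_le1 y x)))//.
  by rewrite mulr_ge0.
apply: ler_wpM2l => //.
by rewrite (le_trans (ler_normB _ _))// mulr_natl mulr2n lerD.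
Qed.

(** Valid at [c = 0] since the inverse of 0 is 0. It weakens the singularity of the strain from 1 /
    |y - x| to 1 / sqrt |y - x| in the scaled strain. *)
Lemma sqrtMinv c : 0 <= c -> Num.sqrt c * c^-1 = (Num.sqrt c)^-1.
Proof.
move=> c0; have [->|cn0] := eqVneq c 0; first by rewrite sqrtr0 invr0 mul0r.
have s0 : Num.sqrt c != 0 by rewrite sqrtr_eq0 -ltNge lt_neqAle eq_sym cn0.
by rewrite -[X in _ * X^-1](sqr_sqrtr c0) expr2 invfM mulrA divff// mul1r.
Qed.

Lemma scaled_strain_le y x v C : `|v y| <= C -> `|v x| <= C ->
  `|scaled_strain y x v| <= d%:R * 2 * C * (Num.sqrt (enorm (y - x)))^-1.
Proof.
move=> vy vx; rewrite normrM ger0_norm ?sqrtr_ge0//.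
rewrite -(sqrtMinv (enorm_ge0 _)) mulrCA ler_wpM2l ?sqrtr_ge0//.
exact: strain_le.
Qed.

Lemma scaled_strainB y x v v' : scaled_strain y x v - scaled_strain y x v' =
  scaled_strain y x (fun z => v z - v' z).
Proof. by rewrite /scaled_strain -mulrBr strainB. Qed.

Lemma antisym_quad (Q : 'M[R]_d) x : Q^T = - Q -> dotrv (x *m Q^T) x = 0.
Proof.
move=> QN.
have dotE y z : dotrv y z = (y *m z^T) 0 0.
  by rewrite mxE; apply: eq_bigr => i _; rewrite !mxE.
have : dotrv (x *m Q^T) x = dotrv (x *m Q) x.
  by rewrite dotrvC !dotE trmx_mul trmxK mulmxA.
rewrite QN mulmxN dotrvNl => /eqP; rewrite eq_sym -subr_eq0 opprK.
by rewrite -mulr2n mulrn_eq0 /= => /eqP ->; rewrite oppr0.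
Qed.

(* A rigid motion moves [y] relative to [x] orthogonally to the bond. *)
Lemma rigid_motion_bond v y x : rigid_motion v ->
  dotrv (bond_direction y x) (v y) = dotrv (bond_direction y x) (v x).
Proof.
move=> [Q [c [QN ->]]]; apply/eqP; rewrite -subr_eq0 !(dotrvC (bond_direction _ _)).
rewrite -dotrvBl opprD addrACA subrr addr0 -mulmxBl dotrvC dotrvZl dotrvC.
by rewrite antisym_quad// mulr0.
Qed.

End vectors.

(** * Measurability and the singular kernel *)

Section measurability_rV.
Context {R : realType} {n : nat}.
Implicit Types (D : set 'rV[R]_n) (x y : 'rV[R]_n) (r e : R).

Lemma measurable_fun_rVP d (T : measurableType d) (A : set T)
    (f : T -> 'rV[R]_n) : measurable A ->
  measurable_fun A f <-> forall i, measurable_fun A (fun t => f t 0 i).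
Proof.
move=> mA; split=> [mf i|mf].
  exact: (measurableT_comp (measurable_coord i) mf).
pose g : T -> 'rV[R]_n := fun t => \row_i (((fun t => f t 0 i) \_ A) t).
apply: (@eq_measurable_fun _ _ _ _ A g).
  by move=> t tA; apply/rowP => i; rewrite mxE patchT.
apply: (@measurable_funS _ _ _ _ setT) => //.
apply/measurable_fun_coordP => i.
apply: (@eq_measurable_fun _ _ _ _ _ ((fun t => f t 0 i) \_ A)).
  by move=> t _; rewrite mxE.
by have /(measurable_restrictT _ mA) := mf i.
Qed.

Lemma measurable_box (I : 'I_n -> interval R) :
  measurable [set x : 'rV[R]_n | forall i, x 0 i \in I i].
Proof.
rewrite (_ : mkset _ = \bigcap_(i in [set: 'I_n])
      ((fun x : 'rV[R]_n => x 0 i) @^-1` [set` I i])); last first.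
  by apply/seteqP; split=> x /= h i; [move=> _|]; exact: h.
apply: fin_bigcap_measurable => // i _.
by rewrite -[X in measurable X]setTI; apply: measurable_coord.
Qed.

(** The sigma-algebra is generated by the coordinates, not by the open sets; an open set is the
    union of the countably many boxes with rational center and side parameter [k] that it
    contains. *)
Lemma open_measurable_rV (A : set 'rV[R]_n) : open A -> measurable A.
Proof.
move=> oA.
pose box (k : {ffun 'I_n -> rat} * nat) := [set x : 'rV[R]_n |
  forall i, x 0 i \in `](ratr (k.1 i) - k.2.+1%:R^-1), (ratr (k.1 i) + k.2.+1%:R^-1)[].
pose F k := if `[< box k `<=` A >] then box k else set0.
have -> : A = \bigcup_k F k.
  apply/seteqP; split=> [x Ax|x [k _]]; last first.
    by rewrite /F; case: ifPn => // /asboolP; exact.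
  move: oA; rewrite openE => /(_ _ Ax)/nbhs_ballP[e /= e0 xeA].
  (* A box of half-side 1 / (N + 1) whose center is that close to [x] stays in the ball of radius
     [e], as the norm is the max norm. *)
  have [N N2e] : exists N : nat, N.+1%:R^-1 < e / 2.
    exists (Num.bound (e / 2)^-1).
    rewrite invf_plt ?posrE ?ltr0n ?divr_gt0//.
    apply: lt_trans (archi_boundP _) _; first by rewrite invr_ge0 divr_ge0 ?ltW.
    by rewrite ltr_nat.
  have Nx i : exists q : rat, ratr q \in `](x 0 i - N.+1%:R^-1), (x 0 i + N.+1%:R^-1)[.
    have [|q qx] := @rat_in_itvoo R (x 0 i - N.+1%:R^-1) (x 0 i + N.+1%:R^-1).
      by rewrite ltrD2l gtrN.
    by exists q.
  pose q := [ffun i => projT1 (cid (Nx i))].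
  have qx i : `|ratr (q i) - x 0 i| < N.+1%:R^-1.
    rewrite /q ffunE; case: cid => /= r; rewrite in_itv /= => rx.
    by rewrite ltr_distl.
  exists (q, N) => //; rewrite /F; case: ifPn => [_|/asboolPn]; last first.
    case=> y /= yq; apply: xeA; rewrite -ball_normE /= distrC.
    rewrite (@le_lt_trans _ _ (N.+1%:R^-1 *+ 2))//; last first.
      by rewrite mulr2n [ltRHS]splitr ltrD.
    apply: norm_le_coord => [|i]; first by rewrite mulrn_wge0.
    rewrite !mxE -(subrKA (ratr (q i))) (le_trans (ler_normD _ _))// mulr2n lerD//.
      by have := yq i; rewrite in_itv /= -ltr_distl => /ltW.
    exact/ltW.
  by move=> i /=; rewrite in_itv /= -ltr_distl distrC.
apply: countable_bigcupT_measurable; first exact: countableP.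
move=> k; rewrite /F; case: ifP => // _; exact: measurable_box.
Qed.

End measurability_rV.

Section measurable_enorm.
Context {R : realType} {n : nat} {d : measure_display} {T : measurableType d}.
Variables (A : set T) (mA : measurable A).
Implicit Types f g : T -> 'rV[R]_n.

Lemma measurable_dotrv f g : measurable_fun A f -> measurable_fun A g ->
  measurable_fun A (fun t => dotrv (f t) (g t)).
Proof.
move=> /(measurable_fun_rVP _ mA) mf /(measurable_fun_rVP _ mA) mg.
by apply: measurable_sum => i; apply: measurable_funM.
Qed.

Lemma measurable_sqrt (h : T -> R) : measurable_fun A h ->
  measurable_fun A (fun t => Num.sqrt (h t)).
Proof.
move=> mh; apply: measurableT_comp mh.
by apply: continuous_measurable_fun; exact: sqrt_continuous.
Qed.

(** The inverse is discontinuous at 0; it agrees on nonnegative numbers, 0 included, with the real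
    power of exponent -1, which is measurable. *)
Lemma measurable_inv_ge0 (h : T -> R) : (forall t, A t -> 0 <= h t) ->
  measurable_fun A h -> measurable_fun A (fun t => (h t)^-1).
Proof.
move=> h0 mh; apply: (@eq_measurable_fun _ _ _ _ A (fun t => h t `^ (-1))).
  by move=> t; rewrite inE => At; rewrite powR_inv1// h0.
exact: (measurableT_comp (@measurable_powR R (-1)) mh).
Qed.

Lemma measurable_enorm f : measurable_fun A f ->
  measurable_fun A (fun t => enorm (f t)).
Proof. by move=> mf; apply: measurable_sqrt; exact: measurable_dotrv. Qed.

Lemma measurable_rVB f g : measurable_fun A f -> measurable_fun A g ->
  measurable_fun A (fun t => f t - g t).
Proof.
move=> /(measurable_fun_rVP _ mA) mf /(measurable_fun_rVP _ mA) mg.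
apply/(measurable_fun_rVP _ mA) => i.
under eq_fun do rewrite !mxE.
exact: measurable_funB.
Qed.

Lemma measurable_rVD f g : measurable_fun A f -> measurable_fun A g ->
  measurable_fun A (fun t => f t + g t).
Proof.
move=> /(measurable_fun_rVP _ mA) mf /(measurable_fun_rVP _ mA) mg.
apply/(measurable_fun_rVP _ mA) => i.
under eq_fun do rewrite !mxE.
exact: measurable_funD.
Qed.

Lemma measurable_rVZ (h : T -> R) g : measurable_fun A h -> measurable_fun A g ->
  measurable_fun A (fun t => h t *: g t).
Proof.
move=> mf /(measurable_fun_rVP _ mA) mg.
apply/(measurable_fun_rVP _ mA) => i.
under eq_fun do rewrite !mxE.
exact: measurable_funM.
Qed.

End measurable_enorm.

(** * Uniform integrability of the kernel 1 / |y - x| *)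

Section singular_kernel.
Context {R : realType} {d : nat}.
Local Notation mu := (lebesgue_rV R d).
Implicit Types (x y : 'rV[R]_d) (Omega : set 'rV[R]_d) (r : R).

(** Cubes replace balls because [lebesgue_rV_box] gives their measure; the end points are row
    vectors to fit that lemma. *)
Definition cube x r := [set y : 'rV[R]_d | forall i,
  y 0 i \in `[(x - const_mx r) 0 i, (x + const_mx r) 0 i]].

Lemma cube_measure x r : 0 <= r -> mu (cube x r) = ((2 * r) ^+ d)%:E.
Proof.
move=> r0; rewrite /cube lebesgue_rV_box; last first.
  by move=> i; rewrite !mxE lerD2l -subr_ge0 opprK addr_ge0.
congr EFin; rewrite (eq_bigr (fun=> 2 * r)); last first.
  by move=> i _; rewrite !mxE; ring.
by rewrite prodr_const card_ord.
Qed.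

Lemma in_cube x y r : enorm (y - x) <= r -> cube x r y.
Proof.
move=> yxr i; rewrite !mxE in_itv /= -ler_distl.
by have := coord_le_enorm (y - x) i; rewrite !mxE => /le_trans; apply.
Qed.

Lemma bounded_set_cube Omega : bounded_set Omega ->
  exists2 r, 0 < r & Omega `<=` cube 0 r /\
    forall x y, Omega x -> Omega y -> enorm (y - x) <= r.
Proof.
move=> [r [_ rO]].
have r10 : 0 < `|r| + 1 by rewrite ltr_wpDl.
have H x : Omega x -> `|x| <= `|r| + 1.
  by apply: rO; rewrite (le_lt_trans (ler_norm _))// ltrDl.
have le2 : `|r| + 1 <= (d%:R * 2 + 1) * (`|r| + 1).
  by rewrite ler_peMl ?(ltW r10)// lerDr mulr_ge0.
(* [d * 2] bounds the diameter for the Euclidean norm; the added 1 makes the radius positive and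
   sufficient for the cube, even when [d] is 0. *)
exists ((d%:R * 2 + 1) * (`|r| + 1)).
  by rewrite mulr_gt0// ltr_wpDl// mulr_ge0.
split=> [x Ox i|x y Ox Oy].
  rewrite !mxE in_itv /= -ler_distl subr0.
  by rewrite (le_trans (coord_le_norm _ _))// (le_trans (H _ Ox)).
rewrite (le_trans (enorm_le_norm _))// mulrDl mul1r.
rewrite (@le_trans _ _ (d%:R * 2 * (`|r| + 1)))//; last by rewrite lerDl ltW.
rewrite -mulrA ler_wpM2l// (le_trans (ler_normB _ _))// mulr_natl mulr2n.
by rewrite lerD// H.
Qed.

(** For [a > 0], the least [k] with [r / 2 ^+ k.+1 < a] places [a] in a dyadic shell; [a = 0] is put
    in the shell 0, its inverse being 0. *)
Lemma inv_le_dyadic a r : 0 < r -> 0 <= a -> a <= r -> exists k : nat,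
  a <= r / 2 ^+ k /\ a^-1 <= 2 ^+ k.+1 / r.
Proof.
move=> r0; rewrite le_eqVlt => /predU1P[<-|a0] ar.
  by exists 0; rewrite invr0 !divr_ge0// ltW.
have ex : exists k, r / 2 ^+ k.+1 < a.
  exists (Num.bound (r / a)).
  rewrite ltr_pdivrMr ?exprn_gt0// mulrC -ltr_pdivrMr//.
  apply: lt_trans (archi_boundP _) _; first by rewrite divr_ge0 ?ltW.
  by rewrite -natrX ltr_nat (ltn_trans _ (ltn_expl _ _)).
case: (ex_minnP ex) => k rk kmin; exists k; split.
  case: k rk kmin => [_ _|k rk kmin]; first by rewrite expr0 divr1.
  by rewrite leNgt; apply/negP => /kmin; rewrite ltnn.
rewrite -[leRHS]invrK lef_pV2 ?posrE ?invr_gt0 ?divr_gt0 ?exprn_gt0//.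
by rewrite invf_div ltW.
Qed.

(* [1 / |y - x|] is at most the sum over [k] of [2^(k+1) / r] times the indicator
   of the cube of half-side [r / 2^k] centered at [x]; the integrals of these
   functions form a geometric series as soon as [d >= 2]. *)
Lemma singular_kernel_integral Omega : (2 <= d)%N -> measurable Omega ->
  bounded_set Omega -> exists2 K : R, 0 <= K & forall x, Omega x ->
  (\int[mu]_(y in Omega) ((enorm (y - x))^-1)%:E <= K%:E)%E.
Proof.
move=> d2 mO /bounded_set_cube[r r0 [_ rO]].
(* The term of index k integrates to at most (2^(k+1) / r) (2 r / 2^k)^d, and the factor (2^-k)^d is
   at most (2^-k)^2 as [d >= 2]. What remains is (2 / r) (2 r)^d / 2^k, whose sum over k is this
   constant. *)
exists (4 / r * (2 * r) ^+ d).
  by rewrite mulr_ge0// ?divr_ge0 ?exprn_ge0 ?mulr_ge0 ?ltW.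
move=> x Ox.
pose f k y : \bar R := (2 ^+ k.+1 / r * \1_(cube x (r / 2 ^+ k)) y)%:E.
have f0 k y : (0 <= f k y)%E.
  by rewrite lee_fin mulr_ge0// divr_ge0 ?exprn_ge0 ?ltW.
have mf k : measurable_fun Omega (f k).
  apply/measurable_EFinP; apply: measurable_funM => //.
  by apply: measurable_indic; exact: measurable_box.
rewrite (@le_trans _ _ (\int[mu]_(y in Omega) \sum_(0 <= k <oo) f k y)%E)//.
  apply: ge0_le_integral => //.
  - by move=> y _; rewrite lee_fin invr_ge0 enorm_ge0.
  - apply/measurable_EFinP; apply: measurable_inv_ge0 => //.
      by move=> y _; exact: enorm_ge0.
    by apply: measurable_enorm => //; apply: measurable_rVB.
  - by apply: ge0_emeasurable_sum.
  move=> y Oy; have [k [yk ky]] := inv_le_dyadic r0 (enorm_ge0 (y - x)) (rO _ _ Ox Oy).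
  have := @nneseries_lim_ge R (f^~ y) xpredT 0 k.+1 (fun n _ _ => f0 n y).
  apply: le_trans; rewrite big_nat_recr//= (@le_trans _ _ (f k y))//.
    by rewrite lee_fin indicE mem_set ?mulr1//; exact: in_cube.
  by rewrite leeDr// sume_ge0.
rewrite integral_nneseries//.
have fk k : (\int[mu]_(y in Omega) f k y <=
    ((4 / r * (2 * r) ^+ d) / (2 ^ (k + 1))%:R)%:E)%E.
  rewrite (@le_trans _ _ (\int[mu]_y f k y)%E)//.
    apply: ge0_subset_integral => //.
    apply/measurable_EFinP; apply: measurable_funM => //.
    by apply: measurable_indic; exact: measurable_box.
  under eq_integral do rewrite /f EFinM.
  rewrite ge0_integralZl_EFin//; last 2 first.
  - by apply/measurable_EFinP/measurable_indic; exact: measurable_box.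
  - by rewrite divr_ge0 ?exprn_ge0 ?ltW.
  rewrite integral_indic//; last exact: measurable_box.
  rewrite setIT (_ : _ (cube _ _) = ((2 * (r / 2 ^+ k)) ^+ d)%:E); last first.
    by apply: cube_measure; rewrite divr_ge0 ?exprn_ge0 ?ltW.
  rewrite -EFinM lee_fin mulrA exprMn.
  have p1 : 1 <= (2 : R) ^+ k by rewrite exprn_ege1// ler1n.
  have p0 : 0 < (2 : R) ^+ k by rewrite exprn_gt0.
  have -> : 4 / r * (2 * r) ^+ d / (2 ^ (k + 1))%:R =
      2 ^+ k.+1 / r * ((2 * r) ^+ d * (2 ^+ k)^-1 ^+ 2) :> R.
    rewrite natrX addn1 exprS; field.
    by rewrite gt_eqF//= gt_eqF.
  apply: ler_wpM2l; first by rewrite divr_ge0 ?exprn_ge0 ?ltW.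
  apply: ler_wpM2l; first by rewrite exprn_ge0 ?mulr_ge0 ?ltW.
  by rewrite ler_wiXn2l// ?invr_ge0 ?invf_le1// ltW.
apply: (@le_trans _ _ (\sum_(0 <= k <oo)
    ((4 / r * (2 * r) ^+ d) / (2 ^ (k + 1))%:R)%:E)%E).
  apply: lee_nneseries => [k *|k *]; last exact: fk.
  by apply: integral_ge0 => y _; exact: f0.
have := @cvg_geometric_eseries_half R (4 / r * (2 * r) ^+ d) 0.
by rewrite expr0 divr1 => /cvg_lim <-.
Qed.

End singular_kernel.

(** * The space X *)

Section bounded_fields.
Context {R : realType} {d : nat}.
Local Notation mu := (lebesgue_rV R d).
Implicit Types (x y : 'rV[R]_d) (Omega : set 'rV[R]_d) (r C : R).
Implicit Types (v z : 'rV[R]_d -> 'rV[R]_d).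

Lemma bounded_set_measure Omega : measurable Omega -> bounded_set Omega ->
  (mu Omega < +oo)%E.
Proof.
move=> mO /bounded_set_cube[r r0 [Or _]].
rewrite (@le_lt_trans _ _ (mu (cube 0 r)))//.
  by apply: le_measure => //; rewrite inE//; exact: measurable_box.
rewrite (_ : _ (cube _ _) = ((2 * r) ^+ d)%:E) ?ltry//.
by apply: cube_measure; rewrite ltW.
Qed.

Lemma rigid_motion_measurable Omega z : measurable Omega -> rigid_motion z ->
  measurable_fun Omega z.
Proof.
move=> mO [Q [c [_ ->]]]; apply/(measurable_fun_rVP _ mO) => i.
under eq_fun do rewrite !mxE.
apply: measurable_funD => //; apply: measurable_sum => j.
apply: measurable_funM => //; apply: (measurable_funS measurableT) => //.
exact: measurable_coord.
Qed.

Lemma rigid_motion_bounded Omega z : bounded_set Omega -> rigid_motion z ->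
  exists C, forall x, Omega x -> `|z x| <= C.
Proof.
move=> [r [_ rO]] [Q [c [_ ->]]].
have H x : Omega x -> `|x| <= `|r| + 1.
  by apply: rO; rewrite (le_lt_trans (ler_norm _))// ltrDl.
exists (\sum_i \sum_j (`|r| + 1) * `|Q^T j i| + `|c|) => x Ox.
rewrite (le_trans (ler_normD _ _))// lerD2r; apply: norm_le_coord.
  by do 2 apply: sumr_ge0 => ? _; rewrite mulr_ge0// addr_ge0.
move=> i; rewrite (@le_trans _ _ (\sum_j (`|r| + 1) * `|Q^T j i|))//; last first.
  rewrite [leRHS](bigD1 i)//= lerDl.
  by do 2 apply: sumr_ge0 => ? _; rewrite mulr_ge0// addr_ge0.
rewrite mxE (le_trans (ler_norm_sum _ _ _))//; apply: ler_sum => j _.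
by rewrite normrM ler_wpM2r// (le_trans (coord_le_norm _ _))// H.
Qed.

Definition bounded_on Omega v := exists C, forall x, Omega x -> `|v x| <= C.

(* Representatives, bounded everywhere and not only almost everywhere, of the
   elements of X. *)
Definition bounded_X Omega v := [/\ measurable_fun Omega v, bounded_on Omega v &
  forall z, rigid_motion z -> \int[mu]_(x in Omega) dotrv (v x) (z x) = 0].

Section fixed_domain.
Variables (Omega : set 'rV[R]_d) (mO : measurable Omega).
Hypothesis bO : bounded_set Omega.

Lemma bounded_rigid_integrable v z : measurable_fun Omega v ->
  bounded_on Omega v -> rigid_motion z ->
  mu.-integrable Omega (fun x => (dotrv (v x) (z x))%:E).
Proof.
move=> mv [C vC] rz; have [C' zC'] := rigid_motion_bounded bO rz.
apply: (@measurable_bounded_integrable _ _ _ mu _ Omega) => //.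
- exact: bounded_set_measure.
- apply: measurable_dotrv => //; exact: rigid_motion_measurable.
exists (d%:R * (`|C| * `|C'|)); split; first exact: num_real.
move=> e eC x Ox /=; apply/ltW/(le_lt_trans _ eC).
rewrite (le_trans (dotrv_le _ _))// ler_wpM2l// ler_pM//.
  by rewrite (le_trans (vC _ Ox))// ler_norm.
by rewrite (le_trans (zC' _ Ox))// ler_norm.
Qed.

Lemma bounded_X_lin a v v' : bounded_X Omega v -> bounded_X Omega v' ->
  bounded_X Omega (fun x => a *: v x + v' x).
Proof.
move=> [mv bv ov] [mv' bv' ov']; split.
- apply: measurable_rVD => //; apply: measurable_rVZ => //.
- case: bv bv' => [C vC] [C' vC']; exists (`|a| * C + C') => x Ox.
  rewrite (le_trans (ler_normD _ _))// lerD ?vC'// normrZ ler_wpM2l// vC//.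
move=> z rz.
under eq_Rintegral do rewrite dotrvDl dotrvZl.
rewrite RintegralD//; last 2 first.
- exact: (integrableZl mO a (bounded_rigid_integrable mv bv rz)).
- exact: bounded_rigid_integrable.
rewrite RintegralZl//; last exact: bounded_rigid_integrable.
by rewrite ov// ov'// mulr0 addr0.
Qed.

Lemma bounded_X0 : bounded_X Omega (fun=> 0).
Proof.
split=> //; first by exists 0 => x _; rewrite normr0.
move=> z _; under eq_Rintegral do rewrite -[0](scale0r 0) dotrvZl mul0r.
by rewrite Rintegral_cst// mul0r.
Qed.

Lemma bounded_XZ a v : bounded_X Omega v -> bounded_X Omega (fun x => a *: v x).
Proof.
move=> bv; have := bounded_X_lin a bv bounded_X0.
by under eq_fun do rewrite addr0.
Qed.

Lemma bounded_XD v v' : bounded_X Omega v -> bounded_X Omega v' ->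
  bounded_X Omega (fun x => v x + v' x).
Proof.
move=> bv bv'; have := bounded_X_lin 1 bv bv'.
by under eq_fun do rewrite scale1r.
Qed.

Lemma bounded_X_sum n (f : nat -> 'rV[R]_d -> 'rV[R]_d) :
  (forall k, (k < n)%N -> bounded_X Omega (f k)) ->
  bounded_X Omega (fun x => \sum_(k < n) f k x).
Proof.
elim: n => [_|n IH bf].
  by under eq_fun do rewrite big_ord0; exact: bounded_X0.
under eq_fun do rewrite big_ord_recr.
by apply: bounded_XD; [apply: IH => k kn; apply: bf; exact: ltnW|exact: bf].
Qed.

(** Orthogonality passes to the limit by dominated convergence, a constant being integrable on the
    bounded [Omega]. This closure property serves both for Riemann sums in time and for limits of
    iterates. *)
Lemma bounded_X_cvg (f : nat -> 'rV[R]_d -> 'rV[R]_d) v C :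
  (forall n, bounded_X Omega (f n)) ->
  (forall n x, Omega x -> `|f n x| <= C) ->
  (forall x, Omega x -> forall i, f n x 0 i @[n --> \oo] --> v x 0 i) ->
  bounded_X Omega v.
Proof.
move=> bf fC fv.
have vC x : Omega x -> `|v x| <= `|C|.
  move=> Ox; apply: norm_le_coord => // i.
  apply/ler_addgt0Pr => e e0; have /cvgrPdist_le /(_ e e0)[N _] := fv x Ox i.
  move=> /(_ N (leqnn N)) /= Ne.
  rewrite -(subrK (f N x 0 i) (v x 0 i)) (le_trans (ler_normD _ _))// addrC.
  rewrite lerD// (le_trans (coord_le_norm _ _))// (le_trans (fC _ _ Ox))//.
  exact: ler_norm.
have mv : measurable_fun Omega v.
  apply/(measurable_fun_rVP _ mO) => i.
  apply: (@measurable_fun_cvg _ _ _ _ (fun n x => f n x 0 i)) => [n|x Ox].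
    by have [/(measurable_fun_rVP _ mO)] := bf n.
  exact: fv.
split=> //; first by exists `|C|.
move=> z rz.
have [C' zC'] := rigid_motion_bounded bO rz.
case: (@dominated_convergence _ _ _ mu Omega mO
  (fun n x => (dotrv (f n x) (z x))%:E) (fun x => (dotrv (v x) (z x))%:E)
  (fun x => (d%:R * (`|C| * `|C'|))%:E)).
- move=> n; apply/measurable_EFinP; apply: measurable_dotrv => //.
    by case: (bf n).
  exact: rigid_motion_measurable.
- apply/measurable_EFinP; apply: measurable_dotrv => //.
  exact: rigid_motion_measurable.
- apply: aeW => x Ox; apply: cvg_EFin; first exact: nearW.
  have : (dotrv (f n x) (z x)) @[n --> \oo] --> dotrv (v x) (z x).
    rewrite /dotrv; apply: (@cvg_big R 'I_d +%R 0 xpredT (@add_continuous R)) => i _.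
    by apply: cvgM; [exact: fv|exact: cvg_cst].
  exact.
- apply: (@measurable_bounded_integrable _ _ _ mu _ Omega) => //.
    exact: bounded_set_measure.
  exists (d%:R * (`|C| * `|C'|)); split; first exact: num_real.
  move=> e eC x Ox /=; rewrite ger0_norm ?mulr_ge0//; exact: ltW.
- apply: aeW => x n Ox; rewrite abse_EFin lee_fin.
  rewrite (le_trans (dotrv_le _ _))// ler_wpM2l// ler_pM//.
    by rewrite (le_trans (fC _ _ Ox))// ler_norm.
  by rewrite (le_trans (zC' _ Ox))// ler_norm.
move=> _ _; rewrite /= (_ : (fun n => _) = cst 0%E); last first.
  apply/funext => n; have [mf ubf /(_ _ rz)] := bf n.
  move=> fn0; rewrite /= -[RHS]/(0%:E) -fn0 /Rintegral fineK//.
  by apply: integrable_fin_num => //; exact: bounded_rigid_integrable.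
by move=> /cvg_lim h; rewrite /Rintegral -h// lim_cst.
Qed.

End fixed_domain.

(** * The essential supremum norm as bounds almost everywhere *)

Section essential_bounds.
Variables (Omega : set 'rV[R]_d).

(** The sign of [C] accounts for two zeros: the extension of the field by 0 outside [Omega], and the
    norm, which is 0 by convention if the whole space has measure 0. *)
Lemma Linfty_norm_leP v C : 0 <= C -> (Linfty_norm Omega v <= C%:E)%E <->
  (\forall x \ae mu, Omega x -> enorm (v x) <= C).
Proof.
move=> C0; rewrite /Linfty_norm unlock /=.
have H : (ess_sup mu (abse \o (EFin \o (fun x => enorm (v x)) \_ Omega)) <= C%:E)%E
    <-> (\forall x \ae mu, Omega x -> enorm (v x) <= C).
  split=> [/ess_supP h|h].
    apply: filterS h => x /=; rewrite lee_fin => + Ox; rewrite patchT ?inE//.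
    by apply: le_trans; exact: ler_norm.
  apply/ess_supP; apply: filterS h => x /= h.
  rewrite lee_fin; have [Ox|nOx] := pselect (Omega x).
    by rewrite patchT ?inE// ger0_norm ?enorm_ge0//; exact: h.
  by rewrite patchC ?inE// normr0.
case: ifPn => [_|]; first exact: H.
rewrite -leNgt => mu0; split=> [_|_]; last by rewrite lee_fin.
exists setT; split => //.
by apply/eqP; rewrite eq_le mu0 measure_ge0.
Qed.

Lemma Linfty_norm_le v C : 0 <= C ->
  (\forall x \ae mu, Omega x -> `|v x| <= C) ->
  (Linfty_norm Omega v <= (d%:R * C)%:E)%E.
Proof.
move=> C0 H; apply/Linfty_norm_leP; first by rewrite mulr_ge0.
apply: filterS H => x H Ox.
by rewrite (le_trans (enorm_le_norm _))// ler_wpM2l// H.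
Qed.

Lemma Linfty_norm_ae v C : 0 <= C -> (Linfty_norm Omega v <= C%:E)%E ->
  \forall x \ae mu, Omega x -> `|v x| <= C.
Proof.
move=> C0 /(Linfty_norm_leP _ C0); apply: filterS => x H Ox.
by rewrite (le_trans (norm_le_enorm _))// H.
Qed.

Lemma Linfty_norm_ge0 v : (0 <= Linfty_norm Omega v)%E.
Proof. exact: Lnorm_ge0. Qed.

Lemma Linfty_norm_fin v : (Linfty_norm Omega v < +oo)%E ->
  \forall x \ae mu, Omega x -> `|v x| <= fine (Linfty_norm Omega v).
Proof.
move=> vy; apply: Linfty_norm_ae; first exact/fine_ge0/Linfty_norm_ge0.
by rewrite fineK// ge0_fin_numE// Linfty_norm_ge0.
Qed.

(** Replaces convergence in X by bounds almost everywhere for the max norm; the factor [d] between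
    the norms is absorbed in [e]. *)
Lemma Linfty_cvg0P (F : set_system R) (FF : Filter F)
    (f : R -> 'rV[R]_d -> 'rV[R]_d) :
  Linfty_norm Omega (f s) @[s --> F] --> 0%E <->
  forall e, 0 < e -> \forall s \near F,
    \forall x \ae mu, Omega x -> `|f s x| <= e.
Proof.
split=> [cf e e0|H].
  have : nbhs (0 : \bar R)%E [set y | (y < e%:E)%E].
    by apply: open_nbhs_nbhs; split; [exact: open_ereal_lt_ereal|rewrite /= lte_fin].
  move=> /cf h; have {}h : \forall s \near F, (Linfty_norm Omega (f s) < e%:E)%E.
    exact: h.
  by apply: filterS h => s /ltW; apply: Linfty_norm_ae; exact: ltW.
have H' e : 0 < e -> \forall s \near F, (Linfty_norm Omega (f s) <= e%:E)%E.
  move=> e0; have e'0 : 0 < e / (d%:R + 1) by rewrite divr_gt0// ltr_wpDl.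
  apply: filterS (H _ e'0) => s /(Linfty_norm_le (ltW e'0)) /le_trans; apply.
  by rewrite lee_fin mulrCA ger_pMr// ler_pdivrMr ?ltr_wpDl// mul1r lerDl.
apply/fine_cvgP; split.
  apply: filterS (H' 1 ltr01) => s fs.
  by rewrite ge0_fin_numE ?Linfty_norm_ge0// (le_lt_trans fs)// ltry.
apply/cvgr0Pnorm_le => e e0; apply: filterS (H' e e0) => s fs /=.
rewrite ger0_norm ?fine_ge0 ?Linfty_norm_ge0// -lee_fin fineK//.
by rewrite ge0_fin_numE ?Linfty_norm_ge0// (le_lt_trans fs)// ltry.
Qed.

Lemma bounded_X_in_X v : measurable Omega -> bounded_X Omega v -> in_X Omega v.
Proof.
move=> mO [mv [C vC] ov]; split=> //.
rewrite (le_lt_trans (@Linfty_norm_le v `|C| _ _)) ?ltry//.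
apply: aeW => x Ox.
by rewrite (le_trans (vC _ Ox))// ler_norm.
Qed.

Lemma ae_eq_bounded_X v v' : measurable Omega -> in_X Omega v ->
  measurable_fun Omega v' -> bounded_on Omega v' ->
  (\forall x \ae mu, Omega x -> v' x = v x) -> bounded_X Omega v'.
Proof.
move=> mO [mv _ ov] mv' bv' vv'; split=> // z rz; rewrite -(ov z rz).
rewrite /Rintegral; congr fine; apply: ae_eq_integral => //.
- apply/measurable_EFinP; apply: measurable_dotrv => //.
  exact: rigid_motion_measurable.
- apply/measurable_EFinP; apply: measurable_dotrv => //.
  exact: rigid_motion_measurable.
by apply: filterS vv' => x vv' Ox; rewrite vv'.
Qed.

(** The field is set to 0 where it exceeds its essential supremum, which happens on a null set
    only. *)
Lemma in_X_bounded_version v : measurable Omega -> in_X Omega v ->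
  exists2 v', bounded_X Omega v' & \forall x \ae mu, Omega x -> v' x = v x.
Proof.
move=> mO Xv; have [mv fv ov] := Xv.
pose C := fine (Linfty_norm Omega v).
pose v' x := if enorm (v x) <= C then v x else 0.
have C0 : 0 <= C by exact/fine_ge0/Linfty_norm_ge0.
have vv' : \forall x \ae mu, Omega x -> v' x = v x.
  have : (Linfty_norm Omega v <= C%:E)%E.
    by rewrite fineK// ge0_fin_numE// Linfty_norm_ge0.
  by move=> /(Linfty_norm_leP _ C0); apply: filterS => x H Ox; rewrite /v' H.
exists v' => //; apply: ae_eq_bounded_X vv' => //; last first.
  exists C => x Ox; rewrite /v'; case: ifPn => [h|_]; last by rewrite normr0.
  by rewrite (le_trans (norm_le_enorm _)).
apply/(measurable_fun_rVP _ mO) => i.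
apply: (@eq_measurable_fun _ _ _ _ _
   (fun x => if enorm (v x) <= C then v x 0 i else 0)).
  by move=> x _; rewrite /v'; case: ifP => // _; rewrite mxE.
apply: measurable_fun_if => //.
  by apply: measurable_fun_ler => //; exact: measurable_enorm.
have mvi : measurable_fun Omega (fun x => v x 0 i).
  by move: mv => /(measurable_fun_rVP _ mO).
apply: (measurable_funS _ _ mvi) => //.
Qed.

End essential_bounds.
End bounded_fields.

(** * Paths in X bounded and equicontinuous at every point, and their time integrals *)

Section X_paths.
Context {R : realType} {d : nat}.
Local Notation mu := (lebesgue_rV R d).
Variables (Omega : set 'rV[R]_d) (mO : measurable Omega).
Hypothesis bO : bounded_set Omega.
Variable T : R.
Hypothesis T0 : 0 <= T.
Implicit Types (x y : 'rV[R]_d) (r t s e C del lam A : R).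
Implicit Types (f g : R -> 'rV[R]_d -> 'rV[R]_d).

Definition equicontinuous_path f := forall t, 0 <= t <= T -> forall e, 0 < e ->
  exists2 del : R, 0 < del & forall s, 0 <= s <= T -> `|s - t| < del ->
    forall x, Omega x -> `|f s x - f t x| <= e.

(** Counterpart of [in_C0X] without null sets, on which Picard iteration takes place;
    [in_C0X_version] leads from one to the other. *)
Definition X_path f :=
  (forall t, 0 <= t <= T -> bounded_X Omega (f t)) /\ equicontinuous_path f.

Lemma equicontinuous_path_continuous f x : equicontinuous_path f -> Omega x ->
  path_continuous T (f ^~ x).
Proof.
move=> cf Ox t t0T e e0; have [del del0 H] := cf t t0T e e0.
by exists del => // s s0T st; exact: H.
Qed.

Lemma path_continuous_coord (h : R -> 'rV[R]_d) i : path_continuous T h ->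
  path_continuous T (fun t => h t 0 i).
Proof.
move=> ch t t0T e e0; have [del del0 H] := ch t t0T e e0.
exists del => // s s0T st; apply: le_trans (H _ s0T st).
by have := coord_le_norm (h s - h t) i; rewrite !mxE.
Qed.

Lemma equicontinuous_path_bounded f : equicontinuous_path f ->
  (forall t, 0 <= t <= T -> bounded_on Omega (f t)) ->
  exists C, forall t, 0 <= t <= T -> forall x, Omega x -> `|f t x| <= C.
Proof.
move=> cf bf.
apply: (@segment_locally_bounded _ T (fun t C => forall x, Omega x -> `|f t x| <= C)).
  by move=> t C C' CC' H x Ox; rewrite (le_trans (H _ Ox)).
move=> t t0T; have [del del0 H] := cf t t0T 1 ltr01; have [C HC] := bf t t0T.
exists del => //; exists (C + 1) => s s0T st x Ox.
rewrite -(subrK (f t x) (f s x)) (le_trans (ler_normD _ _))// addrC.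
by rewrite lerD// ?HC// H.
Qed.

Definition tint f t x : 'rV[R]_d := \row_i prim (fun s => f s x 0 i) t.

Lemma tint0 f x : tint f 0 x = 0.
Proof. by apply/rowP => i; rewrite !mxE prim0. Qed.

Lemma tint_lipschitz f C s t x : equicontinuous_path f -> Omega x ->
  (forall t, 0 <= t <= T -> `|f t x| <= C) -> 0 <= s <= T -> 0 <= t <= T ->
  `|tint f s x - tint f t x| <= C * `|s - t|.
Proof.
move=> cf Ox fC s0T t0T.
have C0 : 0 <= C by apply: le_trans (fC _ s0T).
apply: norm_le_coord => [|i]; first by rewrite mulr_ge0.
rewrite !mxE; apply: prim_lipschitz s0T t0T.
  by apply: path_continuous_coord; exact: equicontinuous_path_continuous.
by move=> r r0T; rewrite (le_trans (coord_le_norm _ _))// fC.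
Qed.

Lemma tint_derivative f t e : equicontinuous_path f -> 0 <= t <= T -> 0 < e ->
  exists2 del : R, 0 < del & forall s, 0 <= s <= T -> `|s - t| < del ->
    forall x, Omega x ->
    `|tint f s x - tint f t x - (s - t) *: f t x| <= e * `|s - t|.
Proof.
move=> cf t0T e0; have [del del0 H] := cf t t0T e e0.
exists del => // s s0T st x Ox.
apply: norm_le_coord => [|i]; first by rewrite mulr_ge0// ltW.
rewrite !mxE.
apply: (@prim_derivative _ T (fun s => f s x 0 i) t e _ t0T del) => //.
  by apply: path_continuous_coord; exact: equicontinuous_path_continuous.
move=> r r0T rt; apply: le_trans (H _ r0T rt _ Ox).
by have := coord_le_norm (f r x - f t x) i; rewrite !mxE.
Qed.

(** Each integration in time divides a bound in the weighted norm by [lam]. *)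
Lemma tint_growth f g lam A x : 0 <= lam -> 0 <= A ->
  equicontinuous_path f -> equicontinuous_path g -> Omega x ->
  (forall s, 0 <= s <= T -> `|f s x - g s x| <= A * lam * expR (lam * s)) ->
  forall t, 0 <= t <= T -> `|tint f t x - tint g t x| <= A * expR (lam * t).
Proof.
move=> lam0 A0 cf cg Ox H t t0T.
apply: norm_le_coord => [|i]; first by rewrite mulr_ge0// expR_ge0.
have cfi : path_continuous T (fun s => f s x 0 i).
  by apply: path_continuous_coord; exact: equicontinuous_path_continuous.
have cgi : path_continuous T (fun s => g s x 0 i).
  by apply: path_continuous_coord; exact: equicontinuous_path_continuous.
have tT : t <= T by case/andP: t0T.
rewrite !mxE /prim -RintegralB//; last 2 first.
- exact: path_integrable (path_continuousW tT cfi).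
- exact: path_integrable (path_continuousW tT cgi).
apply: (@prim_growth _ T lam A (fun s => f s x 0 i - g s x 0 i)) => //.
  move=> s s0T e e0; have e20 : 0 < e / 2 by rewrite divr_gt0.
  have [del del0 Hf] := cfi s s0T _ e20; have [del' del'0 Hg] := cgi s s0T _ e20.
  exists (Num.min del del') => [|r r0T]; first by rewrite lt_min del0.
  rewrite lt_min => /andP[rs rs'].
  rewrite (_ : _ - _ - _ = (f r x 0 i - f s x 0 i) - (g r x 0 i - g s x 0 i)).
    by rewrite (le_trans (ler_normB _ _))// [leRHS]splitr lerD// ?Hf// Hg.
  by ring.
move=> s s0T; apply: le_trans (H s s0T).
by have := coord_le_norm (f s x - g s x) i; rewrite !mxE.
Qed.

Lemma tint_X_path f : X_path f -> X_path (tint f).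
Proof.
move=> [bf cf].
have [C fC] : exists C, forall t, 0 <= t <= T -> forall x, Omega x -> `|f t x| <= C.
  by apply: equicontinuous_path_bounded => // t /bf[].
split=> t t0T; last first.
  move=> e e0; exists (e / (`|C| + 1)); first by rewrite divr_gt0// ltr_wpDl.
  move=> s s0T st x Ox.
  rewrite (le_trans (tint_lipschitz cf Ox (fun t tT => fC t tT x Ox) s0T t0T))//.
  rewrite (@le_trans _ _ ((`|C| + 1) * `|s - t|))//.
    by rewrite ler_wpM2r// (le_trans (ler_norm _))// lerDl.
  by rewrite mulrC -ler_pdivlMr ?ltr_wpDl// ltW.
move: (t0T) => /andP[t0 tT].
have gT n (k : nat) : (k <= n.+1)%N -> 0 <= grid t n k <= T.
  by move=> kn; rewrite grid_ge0//= (le_trans (grid_le _ _)).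
apply: (@bounded_X_cvg _ _ _ mO bO (fun n x =>
  (t / n.+1%:R) *: \sum_(k < n.+1) f (grid t n k) x) _ (t * C)).
- move=> n; apply: bounded_XZ => //.
  apply: (@bounded_X_sum _ _ _ mO bO n.+1 (fun k => f (grid t n k))) => // k kn.
  by apply/bf/gT/ltnW.
- move=> n x Ox; rewrite normrZ ger0_norm ?divr_ge0// -mulrA ler_wpM2l//.
  rewrite mulrC ler_pdivrMr ?ltr0n// (le_trans (ler_norm_sum _ _ _))//.
  rewrite (@le_trans _ _ (\sum_(k < n.+1) C))//.
    by apply: ler_sum => k _; apply: fC => //; apply/gT/ltnW.
  by rewrite sumr_const card_ord mulr_natr.
- move=> x Ox i; rewrite mxE.
  have := @prim_riemann _ T (fun s => f s x 0 i) t; move=> H.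
  apply: cvg_trans (H _ _) => //; last first.
    by apply: path_continuous_coord; exact: equicontinuous_path_continuous.
  by apply: near_eq_cvg; apply: nearW => n; rewrite mxE summxE.
Qed.

Lemma X_path_cst v : bounded_X Omega v -> X_path (fun=> v).
Proof.
move=> bv; split=> // t _ e e0; exists 1 => // s _ _ x _.
by rewrite subrr normr0 ltW.
Qed.

Lemma X_pathD f g : X_path f -> X_path g -> X_path (fun t x => f t x + g t x).
Proof.
move=> [bf cf] [bg cg]; split=> [t t0T|t t0T e e0].
  by apply: bounded_XD => //; [exact: bf|exact: bg].
have e20 : 0 < e / 2 by rewrite divr_gt0.
have [del del0 Hf] := cf t t0T _ e20; have [del' del'0 Hg] := cg t t0T _ e20.
exists (Num.min del del') => [|r r0T]; first by rewrite lt_min del0.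
rewrite lt_min => /andP[rs rs'] x Ox; rewrite opprD addrACA.
by rewrite (le_trans (ler_normD _ _))// [leRHS]splitr lerD// ?Hf// Hg.
Qed.

Lemma X_pathZ a f : X_path f -> X_path (fun t x => a *: f t x).
Proof.
move=> [bf cf]; split=> [t t0T|t t0T e e0].
  by apply: bounded_XZ => //; exact: bf.
have e20 : 0 < e / (`|a| + 1) by rewrite divr_gt0// ltr_wpDl.
have [del del0 Hf] := cf t t0T _ e20; exists del => // s s0T st x Ox.
rewrite -scalerBr normrZ (@le_trans _ _ ((`|a| + 1) * (e / (`|a| + 1))))//.
  by rewrite ler_pM// ?Hf// lerDl.
by rewrite mulrC divfK// gt_eqF// ltr_wpDl.
Qed.

Lemma X_path_limit (f : nat -> R -> 'rV[R]_d -> 'rV[R]_d) g :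
  (forall n, X_path (f n)) ->
  (forall e, 0 < e -> exists N, forall n, (N <= n)%N -> forall t, 0 <= t <= T ->
     forall x, Omega x -> `|f n t x - g t x| <= e) ->
  X_path g.
Proof.
move=> Xf fg; split=> t t0T.
  have [N HN] := fg 1 ltr01.
  have [_ [C NC] _] := (Xf N).1 t t0T.
  (* From rank [N] on, the terms are within 1 of the limit, hence within 2 of [f N]: the common
     bound required for dominated convergence. *)
  apply: (@bounded_X_cvg _ _ _ mO bO (fun n => f (n + N) t) _ (C + 2)).
  - by move=> n; exact: (Xf _).1.
  - move=> n x Ox; rewrite -(subrK (f N t x) (f (n + N) t x)) addrC.
    rewrite (le_trans (ler_normD _ _))// lerD ?NC// -(subrKA (g t x)).
    rewrite (le_trans (ler_normD _ _))// -[2]/(1 + 1) lerD//.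
      by rewrite HN// leq_addl.
    by rewrite distrC HN.
  move=> x Ox i; apply/cvgrPdist_le => e e0; have [K HK] := fg e e0.
  exists K => // n /= Kn; rewrite distrC.
  have := HK (n + N)%N (leq_trans Kn (leq_addr _ _)) t t0T x Ox.
  by apply: le_trans; have := coord_le_norm (f (n + N)%N t x - g t x) i; rewrite !mxE.
move=> e e0; have e30 : 0 < e / 3 by rewrite divr_gt0.
have [N HN] := fg _ e30.
have [del del0 H] := (Xf N).2 t t0T _ e30; exists del => // s s0T st x Ox.
have -> : g s x - g t x = (g s x - f N s x) + (f N s x - f N t x) + (f N t x - g t x).
  by rewrite subrKA subrKA.
have -> : e = e / 3 + e / 3 + e / 3 by field.
rewrite (le_trans (ler_normD _ _))// lerD ?HN//.
by rewrite (le_trans (ler_normD _ _))// lerD ?H// distrC HN.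
Qed.

Lemma X_path_in_C0X f : X_path f -> in_C0X Omega T f.
Proof.
move=> [bf cf] t; rewrite in_itv /= => t0T; split.
  by apply: bounded_X_in_X => //; exact: bf.
apply/Linfty_cvg0P => e e0; have [del del0 H] := cf t t0T e e0.
exists del => //= s /=; rewrite distrC => st; rewrite in_itv /= => s0T.
by apply: aeW => x Ox; exact: H.
Qed.

(** The estimate is uniform over [Omega], hence valid for the essential norm; the initial value [h]
    cancels in difference quotients. *)
Lemma tint_strong_derivative f g h : X_path f ->
  (forall t x, g t x = h x + tint f t x) -> strong_derivative Omega T g f.
Proof.
move=> [bf cf] gE t; rewrite in_itv /= => t0T.
apply/Linfty_cvg0P => e e0; have [del del0 H] := tint_derivative cf t0T e0.
exists del => //= s /=; rewrite distrC => st s_neq_t; rewrite in_itv /= => s0T.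
apply: aeW => x Ox.
have st0 : 0 < `|s - t| by rewrite normr_gt0 subr_eq0.
rewrite -(ler_pM2r st0) (le_trans _ (H s s0T st x Ox))//.
rewrite mulrC -normrZ scalerBr scalerA divff ?subr_eq0// scale1r !gE.
by rewrite opprD addrACA subrr add0r.
Qed.

End X_paths.

(** * Degradation factors *)

Section lipschitz_profiles.
Context {R : realType}.
Implicit Types (f h : R -> R) (a b m M L r : R).

Lemma derivative_bound_lipschitz f L a b : (forall r, derivable f r 1) ->
  (forall r, a <= r <= b -> `|f^`()%classic r| <= L) -> a <= b ->
  `|f b - f a| <= L * (b - a).
Proof.
move=> df fL ab.
case: (@MVT_segment R f (f^`()%classic) a b ab).
- by move=> x _; apply: DeriveDef; [exact: df|rewrite derive1E].
- apply: continuous_subspaceT => x; apply: differentiable_continuous.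
  exact/derivable1_diffP.
move=> c cab ->; rewrite normrM [`|b - a|]ger0_norm ?subr_ge0// ler_wpM2r ?subr_ge0// fL//.
Qed.

(** The derivative is continuous, hence bounded on [m, M], and [h] is unchanged when its argument is
    clamped to [m, M], an operation that does not increase distances. *)
Lemma constant_outside_lipschitz h m M : m < M -> (forall r, derivable h r 1) ->
  (forall r, derivable h^`()%classic r 1) ->
  (forall r, r <= m -> h r = h m) -> (forall r, M <= r -> h r = h M) ->
  exists2 L, 0 <= L & (forall a b, `|h a - h b| <= L * `|a - b|) /\
    forall r, `|h r| <= L.
Proof.
move=> mM dh ddh hm hM.
have cdh : {within `[m, M], continuous h^`()%classic}.
  apply: continuous_subspaceT => x; apply: differentiable_continuous.
  exact/derivable1_diffP.
have [c1 _ Hc1] := EVT_max (ltW mM) cdh.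
have [c2 _ Hc2] := EVT_min (ltW mM) cdh.
pose L := `|h^`()%classic c1| + `|h^`()%classic c2|.
have L0 : 0 <= L by rewrite addr_ge0.
have HL r : m <= r <= M -> `|h^`()%classic r| <= L.
  move=> rmM; have rI : r \in `[m, M] by rewrite in_itv.
  rewrite ler_norml; apply/andP; split.
    rewrite (le_trans _ (Hc2 _ rI))// lerNl (le_trans (ler_norm _))// normrN.
    by rewrite lerDr.
  by rewrite (le_trans (Hc1 _ rI))// (le_trans (ler_norm _))// lerDl.
pose k r := Num.min (Num.max r m) M.
have hk r : h r = h (k r).
  rewrite /k; case: (leP r m) => [rm|mr].
    by rewrite min_l ?(ltW mM)// hm.
  by case: (leP r M) => // Mr; rewrite hM// ltW.
have kI r : m <= k r <= M by rewrite /k le_min le_max lexx orbT (ltW mM) ge_min lexx orbT.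
have klip a b : a <= b -> k a <= k b /\ k b - k a <= b - a.
  move=> ab; rewrite /k; split.
    by rewrite le_min ge_min ge_max !le_max ab lexx !orbT /= ge_min lexx orbT.
  case: (leP a m) => am; case: (leP b m) => bm; rewrite ?(min_l (ltW mM)).
  - by rewrite subrr subr_ge0.
  - by rewrite lerB// ge_min lexx.
  - by rewrite leNgt in bm; move: bm; rewrite (lt_le_trans am ab).
  - case: (leP a M) => aM; case: (leP b M) => bM //.
    + by rewrite lerD2r ltW.
    + by move: aM; rewrite ltNge (le_trans ab).
    + by rewrite subrr subr_ge0.
have lip a b : a <= b -> `|h b - h a| <= L * (b - a).
  move=> ab; have [kab kba] := klip _ _ ab.
  rewrite hk (hk a) (@le_trans _ _ (L * (k b - k a)))//; last by rewrite ler_wpM2l.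
  apply: derivative_bound_lipschitz => // r /andP[ar rb]; apply: HL.
  have /andP[+ _] := kI a; have /andP[_ +] := kI b.
  by move=> /(le_trans rb) -> /le_trans ->.
(* [L] is the Lipschitz constant; the rest bounds [h] itself, starting from its value at [m]. *)
exists (L + (`|h m| + L * (M - m))).
  by rewrite !addr_ge0// mulr_ge0// subr_ge0 ltW.
split=> [a b|r].
  rewrite (@le_trans _ _ (L * `|a - b|))//; last first.
    by rewrite ler_wpM2r// lerDl addr_ge0// mulr_ge0// subr_ge0 ltW.
  have [ab|/ltW ba] := leP a b.
    by rewrite distrC [`|a - b|]distrC [`|b - a|]ger0_norm ?subr_ge0// lip.
  by rewrite [`|a - b|]ger0_norm ?subr_ge0// lip.
rewrite hk ler_wpDl// -(subrK (h m) (h (k r))) addrC.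
have /andP[mk kM] := kI r.
rewrite (le_trans (ler_normD _ _))// lerD2l (le_trans (lip _ _ mk))//.
by rewrite ler_wpM2l// lerD2r.
Qed.

Lemma smooth_derivable h : smooth h -> forall r, derivable h r 1.
Proof. by move=> sh r; exact: (sh 0). Qed.

Lemma smooth_derivable1 h : smooth h -> forall r, derivable h^`()%classic r 1.
Proof. by move=> sh r; have := sh 1 r; rewrite derive1n1. Qed.

Lemma maxr_lipschitz a b : `|Num.max a 0 - Num.max b 0| <= `|a - b|.
Proof.
wlog ab : a b / b <= a.
  move=> H; have [ba|/ltW ab] := leP b a; first exact: H.
  by rewrite distrC [leRHS]distrC H.
rewrite [leRHS]ger0_norm ?subr_ge0//.
case: (leP a 0) => a0; case: (leP b 0) => b0.
- by rewrite subrr normr0 subr_ge0.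
- by move: b0; rewrite ltNge (le_trans ab).
- by rewrite subr0 gtr0_norm// lerDl oppr_ge0.
- by rewrite ger0_norm// subr_ge0.
Qed.

Lemma prim_dist T f g t C : path_continuous T f -> path_continuous T g ->
  0 <= t <= T -> (forall s, 0 <= s <= t -> `|f s - g s| <= C) ->
  `|prim f t - prim g t| <= C * t.
Proof.
move=> cf cg /andP[t0 tT] H.
have cft := path_continuousW tT cf; have cgt := path_continuousW tT cg.
rewrite /prim -RintegralB//; last 2 first.
- exact: path_integrable.
- exact: path_integrable.
have c : path_continuous t (fun s => f s - g s).
  move=> s sT e e0; have e20 : 0 < e / 2 by rewrite divr_gt0.
  have [del del0 Hf] := cft s sT _ e20; have [del' del'0 Hg] := cgt s sT _ e20.
  exists (Num.min del del') => [|r rT]; first by rewrite lt_min del0.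
  rewrite lt_min => /andP[rs rs']; rewrite opprD addrACA -opprD.
  by rewrite (le_trans (ler_normB _ _))// [leRHS]splitr lerD// ?Hf// Hg.
have := @prim_incr _ t (fun s => f s - g s) 0 t 0 C c (lexx _) t0 (lexx _).
rewrite prim0 !subr0 mulr0 subr0; apply => s st; rewrite subr0; exact: H.
Qed.

End lipschitz_profiles.

Section degradation.
Context {R : realType} {d : nat}.
Variables (Omega : set 'rV[R]_d) (mO : measurable Omega).
Variables (T : R) (T0 : 0 < T).
Implicit Types (x y : 'rV[R]_d) (w : R -> 'rV[R]_d -> 'rV[R]_d) (s t C : R).

(** No uniformity or boundedness in space: this is what a [continuous_version] provides, hence the
    class of paths in which two arbitrary solutions are compared. *)
Definition measurable_path w := (forall t, 0 <= t <= T -> measurable_fun Omega (w t)) /\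
  (forall x, Omega x -> path_continuous T (w ^~ x)).

Lemma strain_path w y x : path_continuous T (w ^~ y) ->
  path_continuous T (w ^~ x) -> path_continuous T (fun s => strain y x (w s)).
Proof.
move=> cy cx t t0T e e0.
pose K := d%:R * 2 * (enorm (y - x))^-1.
have K0 : 0 <= K by rewrite !mulr_ge0// invr_ge0 enorm_ge0.
have e'0 : 0 < e / (K + 1) by rewrite divr_gt0// ltr_wpDl.
have [del del0 Hy] := cy t t0T _ e'0; have [del' del'0 Hx] := cx t t0T _ e'0.
exists (Num.min del del') => [|s s0T]; first by rewrite lt_min del0.
rewrite lt_min => /andP[st st']; rewrite strainB.
rewrite (le_trans (@strain_le _ _ _ _ _ (e / (K + 1)) _ _))// ?Hy ?Hx//.
rewrite mulrAC -/K mulrCA ger_pMr// ler_pdivrMr ?ltr_wpDl// mul1r lerDl//.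
Qed.

Lemma path_continuousZ (f : R -> R) a : path_continuous T f ->
  path_continuous T (fun s => a * f s).
Proof.
move=> cf t t0T e e0; have e'0 : 0 < e / (`|a| + 1) by rewrite divr_gt0// ltr_wpDl.
have [del del0 H] := cf t t0T _ e'0; exists del => // s s0T st.
rewrite -mulrBr normrM (@le_trans _ _ ((`|a| + 1) * (e / (`|a| + 1))))//.
  by rewrite ler_pM// ?H// lerDl.
by rewrite mulrC divfK// gt_eqF// ltr_wpDl.
Qed.

Lemma scaled_strain_path w y x : path_continuous T (w ^~ y) ->
  path_continuous T (w ^~ x) ->
  path_continuous T (fun s => scaled_strain y x (w s)).
Proof. by move=> cy cx; apply: path_continuousZ; exact: strain_path. Qed.

Lemma positive_part_path (f : R -> R) a : path_continuous T f ->
  path_continuous T (fun s => Num.max (f s - a) 0).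
Proof.
move=> cf t t0T e e0; have [del del0 H] := cf t t0T _ e0.
exists del => // s s0T st; apply: le_trans (maxr_lipschitz _ _) _.
by rewrite opprB addrA subrK H.
Qed.

Lemma measurable_product_fst (f : 'rV[R]_d -> 'rV[R]_d) :
  measurable_fun Omega f ->
  measurable_fun (Omega `*` Omega) (fun z => f z.1).
Proof.
move=> mf; apply: (measurable_comp mO) => //.
- by move=> _ [z [? ?] <-].
- by apply: (measurable_funS measurableT) => //; exact: measurable_fst.
Qed.

Lemma measurable_product_snd (f : 'rV[R]_d -> 'rV[R]_d) :
  measurable_fun Omega f ->
  measurable_fun (Omega `*` Omega) (fun z => f z.2).
Proof.
move=> mf; apply: (measurable_comp mO) => //.
- by move=> _ [z [? ?] <-].
- by apply: (measurable_funS measurableT) => //; exact: measurable_snd.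
Qed.

Let mOO : measurable (Omega `*` Omega).
Proof. exact: measurableX. Qed.

Lemma measurable_bond :
  measurable_fun (Omega `*` Omega) (fun z => z.1 - z.2).
Proof.
apply: measurable_rVB => //.
  by apply: (measurable_funS measurableT) => //; exact: measurable_fst.
by apply: (measurable_funS measurableT) => //; exact: measurable_snd.
Qed.

Lemma measurable_bond_length :
  measurable_fun (Omega `*` Omega) (fun z => enorm (z.1 - z.2)).
Proof. by apply: measurable_enorm => //; exact: measurable_bond. Qed.

Lemma measurable_bond_direction :
  measurable_fun (Omega `*` Omega) (fun z => bond_direction z.1 z.2).
Proof.
apply: measurable_rVZ => //; last exact: measurable_bond.
apply: measurable_inv_ge0 => //; first by move=> z _; exact: enorm_ge0.
exact: measurable_bond_length.
Qed.

Lemma measurable_strain v : measurable_fun Omega v ->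
  measurable_fun (Omega `*` Omega) (fun z => strain z.1 z.2 v).
Proof.
move=> mv; apply: measurable_dotrv => //; last exact: measurable_bond_direction.
apply: measurable_rVZ => //.
  apply: measurable_inv_ge0 => //; first by move=> z _; exact: enorm_ge0.
  exact: measurable_bond_length.
apply: measurable_rVB => //.
  exact: measurable_product_fst.
exact: measurable_product_snd.
Qed.

Lemma measurable_scaled_strain v : measurable_fun Omega v ->
  measurable_fun (Omega `*` Omega) (fun z => scaled_strain z.1 z.2 v).
Proof.
move=> mv; apply: measurable_funM; last exact: measurable_strain.
by apply: measurable_sqrt => //; exact: measurable_bond_length.
Qed.

Lemma measurable_bigmax (d' : measure_display) (S : measurableType d') (D : set S)
    n (F : 'I_n -> S -> R) (G : S -> R) : measurable_fun D G ->
  (forall k, measurable_fun D (F k)) ->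
  measurable_fun D (fun z => \big[Num.max/G z]_(k < n) F k z).
Proof.
move=> mG; elim: n F => [|n IH] F mF.
  by under eq_fun do rewrite big_ord0.
under eq_fun do rewrite big_ord_recl.
by apply: measurable_maxr; [exact: mF|apply: IH => k; exact: mF].
Qed.

(* What cases (a) and (b) have in common; the rest of the proof uses nothing
   else.  The bounds also hold for [y = x], where the inverse is [0] and both
   strains vanish. *)
Definition regular_degradation
    (gamma : (R -> 'rV[R]_d -> 'rV[R]_d) -> 'rV[R]_d -> 'rV[R]_d -> R -> R) (K : R) :=
  [/\ forall w y x t, `|gamma w y x t| <= K,
   forall w w' y x t C,
     path_continuous T (w ^~ y) -> path_continuous T (w ^~ x) ->
     path_continuous T (w' ^~ y) -> path_continuous T (w' ^~ x) ->
     0 <= t <= T ->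
     (forall s, 0 <= s <= t -> `|w s y - w' s y| <= C /\ `|w s x - w' s x| <= C) ->
     `|gamma w y x t - gamma w' y x t| <= K * C * (Num.sqrt (enorm (y - x)))^-1,
   forall w y x s t B C,
     path_continuous T (w ^~ y) -> path_continuous T (w ^~ x) ->
     0 <= s <= T -> 0 <= t <= T ->
     (forall r, 0 <= r <= T -> `|w r y| <= B /\ `|w r x| <= B) ->
     (forall r, 0 <= r <= T -> `|r - t| <= `|s - t| ->
       `|w r y - w t y| <= C /\ `|w r x - w t x| <= C) ->
     `|gamma w y x s - gamma w y x t| <=
       K * (B * `|s - t| + C) * (Num.sqrt (enorm (y - x)))^-1,
   forall w y x t, gamma w y x t = gamma w x y t &
   forall w t, measurable_path w -> 0 <= t <= T ->
     measurable_fun (Omega `*` Omega) (fun z => gamma w z.1 z.2 t)].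

Lemma gammaA_regular rp xD h : 0 < rp -> degradation_profileA xD h ->
  exists2 K, 0 <= K & regular_degradation (gammaA rp h) K.
Proof.
move=> rp0 [[xD0 sh h0] [h1 _ hD]].
(* The left end is -1 and not 0 because [h] is prescribed to be 1 at negative arguments only. *)
have [|||L L0 [hlip hL]] := @constant_outside_lipschitz _ h (-1) xD _
    (smooth_derivable sh) (smooth_derivable1 sh).
- by rewrite (lt_trans _ xD0)// ltrN10.
- by move=> r r1; rewrite !h1// ?ltrN10// (le_lt_trans r1)// ltrN10.
- by move=> r r1; rewrite !hD.
(* [d * 2] comes from [scaled_strain_le]. It is multiplied by the duration [T] when two paths are
   compared, and stands alone when two times are. *)
pose c := d%:R * 2 * (T + 1) : R.
have c0 : 0 <= c by rewrite !mulr_ge0// addr_ge0// ltW.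
have s0 y x : 0 <= (Num.sqrt (enorm (y - x)))^-1 :> R by rewrite invr_ge0 sqrtr_ge0.
pose q w y x s := Num.max (scaled_strain y x (w s) - rp) 0.
have cq w y x : path_continuous T (w ^~ y) -> path_continuous T (w ^~ x) ->
    path_continuous T (q w y x).
  by move=> cy cx; apply: positive_part_path; exact: scaled_strain_path.
exists (L * (1 + c)); first by rewrite mulr_ge0// addr_ge0.
split.
- by move=> w y x t; rewrite (le_trans (hL _))// ler_peMr// lerDl.
- move=> w w' y x t C cy cx cy' cx' t0T wC; move: (t0T) => /andP[t0 tT].
  have C0 : 0 <= C by have [|+ _] := wC 0; [rewrite lexx|exact: le_trans].
  set si := (Num.sqrt (enorm (y - x)))^-1.
  have si0 : 0 <= si by exact: s0.
  have -> : L * (1 + c) * C * si = L * ((1 + c) * (C * si)) by ring.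
  rewrite (le_trans (hlip _ _))// ler_wpM2l//.
  rewrite (@le_trans _ _ (d%:R * 2 * C * si * t))//.
    apply: prim_dist t0T _; [exact: cq|exact: cq|move=> s st].
    apply: le_trans (maxr_lipschitz _ _) _.
    rewrite opprB addrA subrK scaled_strainB.
    by apply: scaled_strain_le; case: (wC s st).
  rewrite mulrDl mul1r ler_wpDl ?mulr_ge0//.
  have -> : c * (C * si) = d%:R * 2 * C * si * (T + 1) by rewrite /c; ring.
  by rewrite ler_wpM2l ?mulr_ge0// ler_wpDr.
- move=> w y x s t B C cy cx s0T t0T wB wC.
  have B0 : 0 <= B by have [+ _] := wB _ t0T; exact: le_trans.
  have C0 : 0 <= C by have [|+ _] := wC t t0T; [rewrite subrr normr0|exact: le_trans].
  set si := (Num.sqrt (enorm (y - x)))^-1.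
  have si0 : 0 <= si by exact: s0.
  have -> : L * (1 + c) * (B * `|s - t| + C) * si =
            L * ((1 + c) * ((B * `|s - t| + C) * si)) by ring.
  rewrite (le_trans (hlip _ _))// ler_wpM2l//.
  rewrite (@le_trans _ _ (d%:R * 2 * B * si * `|s - t|))//.
    apply: (prim_lipschitz (cq _ _ _ cy cx)) => // r r0T.
    (* As [rp] is positive, the positive part in the integrand is at most the modulus of the
       strain. *)
    rewrite (@le_trans _ _ `|scaled_strain y x (w r)|)//; last first.
      by apply: scaled_strain_le; case: (wB r r0T).
    rewrite /q; case: (leP (scaled_strain y x (w r) - rp) 0) => [_|p0].
      by rewrite normr0.
    by rewrite gtr0_norm// (le_trans _ (ler_norm _))// gerBl ltW.
  have -> : d%:R * 2 * B * si * `|s - t| = d%:R * 2 * (B * `|s - t| * si) by ring.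
  apply: ler_pM; rewrite ?mulr_ge0//.
    have -> : 1 + c = d%:R * 2 + (1 + d%:R * 2 * T) by rewrite /c; ring.
    by rewrite lerDl addr_ge0// !mulr_ge0// ltW.
  by rewrite ler_wpM2r// lerDl.
- move=> w y x t; rewrite /gammaA; congr (h _).
  by apply: eq_Rintegral => s _; rewrite scaled_strainC.
- move=> w t [mw cw] t0T; move: (t0T) => /andP[t0 tT].
  apply: (measurableT_comp (continuous_measurable_fun _)).
    move=> r; apply: differentiable_continuous; apply/derivable1_diffP.
    exact: smooth_derivable.
  (* Each Riemann sum involves finitely many times, at which the strains are measurable in the pair
     of points. *)
  apply: (@measurable_fun_cvg _ _ _ _ (fun n z =>
    t / n.+1%:R * \sum_(k < n.+1) q w z.1 z.2 (grid t n k))) => [n|z [z1 z2]].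
    apply: measurable_funM => //; apply: measurable_sum => k.
    apply: measurable_maxr => //; apply: measurable_funB => //.
    apply: measurable_scaled_strain; apply: mw.
    by rewrite grid_ge0//= (le_trans _ tT)// grid_le// ltnW.
  by apply: prim_riemann t0T; apply: cq; exact: cw.
Qed.

Lemma gammaB_regular rp rD h : degradation_profileB rp rD h ->
  exists2 K, 0 <= K & regular_degradation (gammaB h) K.
Proof.
move=> [[rpD sh h0] [h1 _ hD]].
have [||L L0 [hlip hL]] := @constant_outside_lipschitz _ h rp rD rpD
    (smooth_derivable sh) (smooth_derivable1 sh).
- by move=> r r1; rewrite !h1.
- by move=> r r1; rewrite !hD.
have s0 y x : 0 <= (Num.sqrt (enorm (y - x)))^-1 :> R by rewrite invr_ge0 sqrtr_ge0.
pose q w y x s := strain y x (w s).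
(* 4 is the 2 of [strain_le] times the 2 of [psup_time]; the 1 lets the same constant bound [h]. *)
exists (L * (1 + d%:R * 4)); first by rewrite mulr_ge0// addr_ge0// mulr_ge0.
split.
- by move=> w y x t; rewrite (le_trans (hL _))// ler_peMr// lerDl mulr_ge0.
- move=> w w' y x t C cy cx cy' cx' t0T wC.
  have C0 : 0 <= C by have [|+ _] := wC 0; [rewrite lexx; case/andP: t0T|exact: le_trans].
  set si := (Num.sqrt (enorm (y - x)))^-1.
  have si0 : 0 <= si by exact: s0.
  have -> : L * (1 + d%:R * 4) * C * si = L * ((1 + d%:R * 4) * (C * si)) by ring.
  rewrite (le_trans (hlip _ _))// ler_wpM2l// -mulrBr normrM.
  rewrite ger0_norm ?sqrtr_ge0//.
  rewrite (@le_trans _ _ (Num.sqrt (enorm (y - x)) *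
      (d%:R * 2 * C * (enorm (y - x))^-1)))//.
    rewrite ler_wpM2l ?sqrtr_ge0//.
    apply: (psup_dist _ _ t0T); [exact: strain_path|exact: strain_path|move=> s st].
    by rewrite strainB; apply: strain_le; case: (wC s st).
  rewrite mulrCA (sqrtMinv (enorm_ge0 _)) -/si -(mulrA (d%:R * 2)) ler_wpM2r ?mulr_ge0//.
  by rewrite ler_wpDl// ler_wpM2l// ler_nat.
- move=> w y x s t B C cy cx s0T t0T wB wC.
  have B0 : 0 <= B by have [+ _] := wB _ t0T; exact: le_trans.
  have C0 : 0 <= C by have [|+ _] := wC t t0T; [rewrite subrr normr0|exact: le_trans].
  set si := (Num.sqrt (enorm (y - x)))^-1.
  have si0 : 0 <= si by exact: s0.
  have -> : L * (1 + d%:R * 4) * (B * `|s - t| + C) * si =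
            L * ((1 + d%:R * 4) * ((B * `|s - t| + C) * si)) by ring.
  rewrite (le_trans (hlip _ _))// ler_wpM2l// -mulrBr normrM.
  rewrite ger0_norm ?sqrtr_ge0//.
  rewrite (@le_trans _ _ (Num.sqrt (enorm (y - x)) *
      ((d%:R * 2 * C * (enorm (y - x))^-1) *+ 2)))//.
    rewrite ler_wpM2l ?sqrtr_ge0//.
    apply: (psup_time (strain_path cy cx) s0T t0T) => r r0T rt.
    by rewrite strainB; apply: strain_le; case: (wC r r0T rt).
  rewrite -[X in _ * X <= _]mulr_natr (_ : Num.sqrt _ * _ =
    d%:R * 4 * (C * (Num.sqrt (enorm (y - x)) * (enorm (y - x))^-1))); last by ring.
  rewrite (sqrtMinv (enorm_ge0 _)) -/si.
  apply: ler_pM; rewrite ?mulr_ge0//; first by rewrite lerDr.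
  by rewrite ler_wpM2r// lerDr mulr_ge0.
- move=> w y x t; rewrite /gammaB enormC /max_strain.
  have -> // : (fun s => strain y x (w s)) = (fun s => strain x y (w s)).
  by apply/funext => s; rewrite strainC.
- move=> w t [mw cw] t0T; move: (t0T) => /andP[t0 tT].
  apply: (measurableT_comp (continuous_measurable_fun _)).
    move=> r; apply: differentiable_continuous; apply/derivable1_diffP.
    exact: smooth_derivable.
  apply: measurable_funM.
    by apply: measurable_sqrt => //; exact: measurable_bond_length.
  apply: (@measurable_fun_cvg _ _ _ _ (fun n z =>
    \big[Num.max/q w z.1 z.2 0]_(k < n.+2) q w z.1 z.2 (grid t n k))) => [n|z [z1 z2]].
    have mq s : 0 <= s <= T -> measurable_fun (Omega `*` Omega) (fun z => q w z.1 z.2 s).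
      by move=> s0T; apply: measurable_strain; exact: mw.
    apply: measurable_bigmax => [|k]; apply: mq.
      by rewrite lexx ltW.
    by rewrite grid_ge0//= (le_trans _ tT)// grid_le// -ltnS.
  by apply: psup_grid t0T; apply: strain_path; exact: cw.
Qed.

End degradation.

(** * Peridynamic force *)

Section singular_integrals.
Context {R : realType} {d : nat}.
Local Notation mu := (lebesgue_rV R d).
Variables (Omega : set 'rV[R]_d) (mO : measurable Omega).
Hypothesis bO : bounded_set Omega.
Variables (K0 : R) (K0_ge0 : 0 <= K0).
Hypothesis K0_bound : forall x, Omega x ->
  (\int[mu]_(y in Omega) ((enorm (y - x))^-1)%:E <= K0%:E)%E.
Implicit Types (x y : 'rV[R]_d) (C : R).

Let mOO : measurable (Omega `*` Omega).
Proof. exact: measurableX. Qed.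

Lemma measurable_inv_distance x :
  measurable_fun Omega (fun y => (enorm (y - x))^-1).
Proof.
apply: measurable_inv_ge0 => [y _|]; first exact: enorm_ge0.
by apply: measurable_enorm => //; apply: measurable_rVB.
Qed.

(** The domination is asked for almost every [y] only, since two solutions can be compared only off
    a null set. *)
Lemma singular_integral_le (f : 'rV[R]_d -> R) x C : Omega x -> 0 <= C ->
  measurable_fun Omega f ->
  (\forall y \ae mu, Omega y -> `|f y| <= C * (enorm (y - x))^-1) ->
  [/\ mu.-integrable Omega (EFin \o f),
   (\int[mu]_(y in Omega) `|(f y)%:E| <= (C * K0)%:E)%E &
  `|\int[mu]_(y in Omega) f y| <= C * K0].
Proof.
move=> Ox C0 mf fC.
have le : (\int[mu]_(y in Omega) `|(f y)%:E| <= (C * K0)%:E)%E.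
  apply: (@le_trans _ _ (\int[mu]_(y in Omega) (C * (enorm (y - x))^-1)%:E)%E).
    apply: ae_ge0_le_integral => //.
    - by apply/measurableT_comp => //; exact/measurable_EFinP.
    - by move=> y _; rewrite lee_fin mulr_ge0// invr_ge0 enorm_ge0.
    - apply/measurable_EFinP; apply: measurable_funM => //.
      exact: measurable_inv_distance.
  under eq_integral do rewrite EFinM.
  rewrite ge0_integralZl_EFin//; last 2 first.
  - by move=> y _; rewrite lee_fin invr_ge0 enorm_ge0.
  - by apply/measurable_EFinP; exact: measurable_inv_distance.
  by rewrite EFinM lee_wpmul2l// ?K0_bound// lee_fin.
have intf : mu.-integrable Omega (EFin \o f).
  apply/integrableP; split; first exact/measurable_EFinP.
  exact: le_lt_trans le (ltry _).
split=> //; apply: (le_trans (le_normr_Rintegral mO intf)).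
rewrite -lee_fin; apply: le_trans le.
rewrite /Rintegral fineK//.
rewrite ge0_fin_numE; last exact: integral_ge0.
by case/integrableP: intf.
Qed.

Lemma Rintegral_sum_ord n (f : 'I_n -> 'rV[R]_d -> R) :
  (forall i, mu.-integrable Omega (EFin \o f i)) ->
  mu.-integrable Omega (EFin \o (fun x => \sum_i f i x)) /\
  \int[mu]_(x in Omega) (\sum_i f i x) = \sum_i \int[mu]_(x in Omega) f i x.
Proof.
elim: n f => [|n IH] f intf.
  under [X in EFin \o X]eq_fun do rewrite big_ord0.
  under eq_Rintegral do rewrite big_ord0.
  rewrite big_ord0 Rintegral_cst// mul0r; split=> //; exact: integrable0.
have [i1 i2] := IH (fun i => f (lift ord0 i)) (fun i => intf _).
under [X in EFin \o X]eq_fun do rewrite big_ord_recl.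
under eq_Rintegral do rewrite big_ord_recl.
rewrite big_ord_recl -i2 RintegralD//; split=> //.
exact: (integrableD mO (intf ord0) i1).
Qed.

Section pair_integrals.
Variables (h : 'rV[R]_d * 'rV[R]_d -> R) (C : R) (C0 : 0 <= C).
Hypothesis mh : measurable_fun (Omega `*` Omega) h.
Hypothesis h_le : forall x y, Omega x -> Omega y ->
  `|h (x, y)| <= C * (enorm (y - x))^-1.

(** Extension by 0, Fubini's theorem being applied on the whole product space. *)
Let H : 'rV[R]_d * 'rV[R]_d -> \bar R := (EFin \o h) \_ (Omega `*` Omega).

Let mH : measurable_fun setT H.
Proof. by apply/(measurable_restrictT _ mOO); exact/measurable_EFinP. Qed.

Let H_in x : Omega x -> (fun y => H (x, y)) = (fun y => (h (x, y))%:E) \_ Omega.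
Proof.
by move=> Ox; apply/funext => y; rewrite /H /patch in_setX (mem_set Ox).
Qed.

Let H_in2 y : Omega y -> (fun x => H (x, y)) = (fun x => (h (x, y))%:E) \_ Omega.
Proof.
by move=> Oy; apply/funext => x; rewrite /H /patch in_setX (mem_set Oy) andbT.
Qed.

Let H_out x : ~ Omega x -> (fun y => H (x, y)) = cst 0%E.
Proof.
by move=> Ox; apply/funext => y; rewrite /H /patch in_setX memNset.
Qed.

Let H_out2 y : ~ Omega y -> (fun x => H (x, y)) = cst 0%E.
Proof.
by move=> Oy; apply/funext => x; rewrite /H /patch in_setX andbC memNset.
Qed.

Lemma measurable_section1 x : Omega x -> measurable_fun Omega (fun y => h (x, y)).
Proof.
move=> Ox; apply: (measurable_comp mOO) mh _ => //.
  by move=> _ [y Oy <-].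
by apply: (measurable_funS measurableT) => //; exact: pair1_measurable.
Qed.

Lemma measurable_section2 y : Omega y -> measurable_fun Omega (fun x => h (x, y)).
Proof.
move=> Ox; apply: (measurable_comp mOO) mh _ => //.
  by move=> _ [x Oy <-].
by apply: (measurable_funS measurableT) => //; exact: pair2_measurable.
Qed.

Let int1 x : Omega x -> mu.-integrable Omega (fun y => (h (x, y))%:E).
Proof.
move=> Ox; have [] // := @singular_integral_le (fun y => h (x, y)) x C Ox C0.
  exact: measurable_section1.
by apply: aeW => y Oy; exact: h_le.
Qed.

Let int2 y : Omega y -> mu.-integrable Omega (fun x => (h (x, y))%:E).
Proof.
move=> Oy; have [] // := @singular_integral_le (fun x => h (x, y)) y C Oy C0.
  exact: measurable_section2.
by apply: aeW => x Ox; rewrite enormC; exact: h_le.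
Qed.

(** Tonelli: the inner integral of the modulus is at most [C * K0] on [Omega] and 0 elsewhere, and
    [Omega] has finite measure. *)
Let intH : (mu \x mu)%E.-integrable setT H.
Proof.
apply/(integrable12ltyP mu mu mH).
have mabs : measurable_fun setT (abse \o H) by apply: measurableT_comp.
apply: (@le_lt_trans _ _ (\int[mu]_x (C * K0 * \1_Omega x)%:E)%E).
  apply: ge0_le_integral => //.
  - by move=> x _; exact: integral_ge0.
  - exact: (measurable_fun_fubini_tonelli_F _ mabs (fun z => abse_ge0 (H z))).
  - by apply/measurable_EFinP; apply: measurable_funM => //; exact: measurable_indic.
  move=> x _; have [Ox|nOx] := pselect (Omega x).
    have -> : (fun y => `|H (x, y)|%E) = (fun y => `|(h (x, y))%:E|%E) \_ Omega.
      apply/funext => y; rewrite (congr1 (fun f => f y) (H_in Ox)) /patch.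
      by case: ifP => // _; rewrite abse0.
    rewrite -integral_mkcond indicE mem_set// mulr1.
    have [] // := @singular_integral_le (fun y => h (x, y)) x C Ox C0.
      exact: measurable_section1.
    by apply: aeW => y Oy; exact: h_le.
  have -> : (fun y => `|H (x, y)|%E) = cst 0%E.
    by apply/funext => y; rewrite (congr1 (fun f => f y) (H_out nOx)); exact: abse0.
  by rewrite integral0 lee_fin !mulr_ge0.
under eq_integral do rewrite EFinM.
rewrite ge0_integralZl_EFin//; last 2 first.
- by apply/measurable_EFinP.
- by rewrite mulr_ge0.
rewrite integral_indic// setIT lte_mul_pinfty ?lee_fin ?mulr_ge0//.
exact: bounded_set_measure.
Qed.

Let inner1 x : Omega x ->
  fubini_F mu H x = (\int[mu]_(y in Omega) h (x, y))%:E.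
Proof.
move=> Ox; rewrite /fubini_F (H_in Ox) -integral_mkcond /Rintegral fineK//.
by apply: integrable_fin_num => //; exact: int1.
Qed.

Let inner2 y : Omega y ->
  fubini_G mu H y = (\int[mu]_(x in Omega) h (x, y))%:E.
Proof.
move=> Oy; rewrite /fubini_G (H_in2 Oy) -integral_mkcond /Rintegral fineK//.
by apply: integrable_fin_num => //; exact: int2.
Qed.

Lemma measurable_inner_integral :
  measurable_fun Omega (fun x => \int[mu]_(y in Omega) h (x, y)).
Proof.
apply: (@eq_measurable_fun _ _ _ _ _ (fun x => fine (fubini_F mu H x))).
  by move=> x /set_mem Ox; rewrite inner1.
apply: (measurableT_comp (fine_measurable measurableT)).
by apply: (measurable_funS measurableT) => //; exact: (measurable_fubini_F intH).
Qed.

Lemma Rintegral_fubini :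
  \int[mu]_(x in Omega) \int[mu]_(y in Omega) h (x, y) =
  \int[mu]_(y in Omega) \int[mu]_(x in Omega) h (x, y).
Proof.
rewrite /Rintegral; congr fine.
have -> : (\int[mu]_(x in Omega) (fine (\int[mu]_(y in Omega) (h (x, y))%:E))%:E =
    \int[mu]_x fubini_F mu H x)%E.
  rewrite integral_mkcond; apply: eq_integral => x _.
  have [Ox|nOx] := pselect (Omega x); first by rewrite patchT ?inE// inner1.
  by rewrite patchC ?inE// /fubini_F (H_out nOx) integral0.
have -> : (\int[mu]_(y in Omega) (fine (\int[mu]_(x in Omega) (h (x, y))%:E))%:E =
    \int[mu]_y fubini_G mu H y)%E.
  rewrite integral_mkcond; apply: eq_integral => y _.
  have [Oy|nOy] := pselect (Omega y); first by rewrite patchT ?inE// inner2.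
  by rewrite patchC ?inE// /fubini_G (H_out2 nOy) integral0.
exact: (Fubini intH).
Qed.

End pair_integrals.

(* Exchanging [x] and [y] in the double integral that tests the field against
   a rigid motion changes its sign. *)
Lemma central_field_bounded_X (k : 'rV[R]_d -> 'rV[R]_d -> R) C : 0 <= C ->
  measurable_fun (Omega `*` Omega) (fun z => k z.1 z.2) ->
  (forall x y, Omega x -> Omega y -> `|k y x| <= C * (enorm (y - x))^-1) ->
  (forall x y, Omega x -> Omega y -> k y x = k x y) ->
  bounded_X Omega (fun x => \row_i
    \int[mu]_(y in Omega) (k y x * bond_direction y x 0 i)).
Proof.
move=> C0 mk kC ksym.
(* Pairs are ordered as (x, y) from here on, while [k] takes [y] first; its symmetry makes up for
   the exchange. *)
have mki : measurable_fun (Omega `*` Omega) (fun z => k z.2 z.1).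
  apply: (@eq_measurable_fun _ _ _ _ _ (fun z => k z.1 z.2)) => //.
  by move=> z /set_mem[z1 z2]; rewrite ksym.
have mdir : measurable_fun (Omega `*` Omega) (fun z => bond_direction z.2 z.1).
  apply: (@eq_measurable_fun _ _ _ _ _ (fun z => (-1) *: bond_direction z.1 z.2)).
    by move=> z _; rewrite scaleN1r -bond_directionC.
  by apply: measurable_rVZ => //; exact: measurable_bond_direction.
have mh i : measurable_fun (Omega `*` Omega)
    (fun z => k z.2 z.1 * bond_direction z.2 z.1 0 i).
  by apply: measurable_funM => //; move: mdir => /(measurable_fun_rVP _ mOO).
have hC i x y : Omega x -> Omega y ->
    `|k y x * bond_direction y x 0 i| <= C * (enorm (y - x))^-1.
  move=> Ox Oy; rewrite normrM -[leRHS]mulr1 ler_pM ?kC//.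
  by rewrite (le_trans (coord_le_norm _ _))// bond_direction_le1.
have ms i x : Omega x ->
    measurable_fun Omega (fun y => k y x * bond_direction y x 0 i).
  by move=> Ox; exact: (measurable_section1 (mh i) Ox).
split.
- apply/(measurable_fun_rVP _ mO) => i; under eq_fun do rewrite mxE.
  apply: (@measurable_inner_integral
    (fun z => k z.2 z.1 * bond_direction z.2 z.1 0 i) C C0) => // x y; exact: hC.
- exists (C * K0) => x Ox; apply: norm_le_coord => [|i]; first by rewrite mulr_ge0.
  rewrite mxE.
  have [||_ _] // := @singular_integral_le (fun y => k y x * bond_direction y x 0 i) x C Ox C0.
    exact: ms.
  by apply: aeW => y Oy; exact: hC.
move=> z rz.
have [Cz zCz] := rigid_motion_bounded bO rz.
pose h (p : 'rV[R]_d * 'rV[R]_d) := k p.2 p.1 * dotrv (bond_direction p.2 p.1) (z p.1).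
have C'0 : 0 <= C * (d%:R * `|Cz|) by rewrite !mulr_ge0.
have mhh : measurable_fun (Omega `*` Omega) h.
  apply: measurable_funM => //; apply: measurable_dotrv => //.
  apply: measurable_product_fst => //; exact: rigid_motion_measurable.
have hh x y : Omega x -> Omega y -> `|h (x, y)| <= C * (d%:R * `|Cz|) * (enorm (y - x))^-1.
  move=> Ox Oy; rewrite /h /= normrM mulrAC ler_pM ?kC//.
  rewrite (le_trans (dotrv_le _ _))// ler_wpM2l// -[leRHS]mul1r ler_pM ?bond_direction_le1//.
  by rewrite (le_trans (zCz _ Ox))// ler_norm.
have inth x : Omega x -> mu.-integrable Omega (fun y => (h (x, y))%:E).
  move=> Ox; have [||] // := @singular_integral_le (fun y => h (x, y)) x _ Ox C'0.
    exact: measurable_section1.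
  by apply: aeW => y Oy; exact: hh.
have -> : \int[mu]_(x in Omega) dotrv (\row_i
    \int[mu]_(y in Omega) (k y x * bond_direction y x 0 i)) (z x) =
    \int[mu]_(x in Omega) \int[mu]_(y in Omega) h (x, y).
  apply: eq_Rintegral => x /set_mem Ox.
  have intki i : mu.-integrable Omega (EFin \o (fun y => k y x * bond_direction y x 0 i)).
    have [||] // := @singular_integral_le (fun y => k y x * bond_direction y x 0 i) x C Ox C0.
      exact: ms.
    by apply: aeW => y Oy; exact: hC.
  have hE y : h (x, y) = \sum_i (k y x * bond_direction y x 0 i) * z x 0 i.
    by rewrite /h /= mulr_sumr; apply: eq_bigr => i _; rewrite mulrA.
  under [RHS]eq_Rintegral do rewrite hE.
  have [|_ ->] := @Rintegral_sum_ord d (fun i y => (k y x * bond_direction y x 0 i) * z x 0 i).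
    by move=> i; exact: (integrableZr mO (z x 0 i) (intki i)).
  by apply: eq_bigr => i _; rewrite mxE RintegralZr.
set Q := LHS.
(* After Fubini, [k] is symmetric and the bond direction changes sign; by [rigid_motion_bond], the
   rigid motion has the same component along the bond at [x] and at [y]. *)
have : Q = - Q.
  rewrite {1}/Q (@Rintegral_fubini h _ C'0)// -mulN1r /Q.
  rewrite -RintegralZl//.
    apply: eq_Rintegral => x /set_mem Ox.
    rewrite -RintegralZl//; last exact: inth.
    apply: eq_Rintegral => y /set_mem Oy.
    rewrite /h /= ksym// bond_directionC dotrvNl mulrN mulN1r.
    by rewrite (rigid_motion_bond _ _ rz).
  have mQ := @measurable_inner_integral h _ C'0 mhh hh.
  apply: (@measurable_bounded_integrable _ _ _ mu _ Omega) => //.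
    exact: bounded_set_measure.
  exists (C * (d%:R * `|Cz|) * K0); split; first exact: num_real.
  move=> e Ce x Ox /=; apply: le_trans (ltW Ce).
  have [] // := @singular_integral_le (fun y => h (x, y)) x _ Ox C'0.
    exact: measurable_section1.
  by apply: aeW => y Oy; exact: hh.
by move/eqP; rewrite -subr_eq0 opprK -mulr2n mulrn_eq0 /= => /eqP.
Qed.

End singular_integrals.

Section kernel_bounds.
Context {R : realType} {d : nat}.
Variables (Omega : set 'rV[R]_d) (eps M : R) (eps0 : 0 < eps).
Variables (J : R -> R) (hJ : influence_function M J).

Lemma rho_kernel_bounded : exists2 K : R, 0 <= K &
  forall y x, `|rho_kernel Omega J eps y x| <= K.
Proof.
case: hJ => J0 Jdecr _ JM _.
(* [J] is at most [J 0 = M] by monotonicity; the other factor is the modulus of the normalizing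
   constant. *)
exists (M * `|(eps * (unit_ball_volume R d * eps ^+ d))^-1|).
  by rewrite mulr_ge0// -JM J0.
move=> y x; rewrite /rho_kernel normrM ler_wpM2r//.
have a0 : 0 <= enorm (y - x) / eps by rewrite divr_ge0 ?enorm_ge0// ltW.
rewrite normrM (ger0_norm (J0 _ a0)) -[leRHS]mul1r ler_pM ?J0//.
  by rewrite indicE; case: (y \in Omega); rewrite ?normr1 ?normr0.
by rewrite -JM Jdecr.
Qed.

(** [J] is monotone on [0, +oo) only; precomposition with the positive part makes it monotone on the
    line, hence measurable. *)
Lemma influence_measurable : measurable_fun setT (fun r : R => J (Num.max r 0)).
Proof.
case: hJ => _ Jdecr _ _ _.
apply: nonincreasing_measurable => // r s rs; apply: Jdecr.
  by rewrite le_max lexx orbT.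
by rewrite ge_max !le_max rs lexx orbT.
Qed.

End kernel_bounds.

(** * Bounds, Lipschitz and time estimates of the force *)

Section bond_forces.
Context {R : realType} {d : nat}.
Local Notation mu := (lebesgue_rV R d).
Variables (Omega : set 'rV[R]_d) (mO : measurable Omega).
Variables (T eps M : R) (eps0 : 0 < eps).
Variables (J g : R -> R) (hJ : influence_function M J).
Variable gamma : (R -> 'rV[R]_d -> 'rV[R]_d) -> 'rV[R]_d -> 'rV[R]_d -> R -> R.
Variables (Kg : R) (Kg0 : 0 <= Kg) (hgamma : regular_degradation Omega T gamma Kg).
Variables (Kr : R) (Kr0 : 0 <= Kr).
Hypothesis rho_kernel_le : forall y x, `|rho_kernel Omega J eps y x| <= Kr.
Variables (Lg : R) (Lg0 : 0 <= Lg).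
Hypothesis g_bounded : forall r, `|g^`()%classic r| <= Lg.
Hypothesis g_lipschitz : forall a b,
  `|g^`()%classic a - g^`()%classic b| <= Lg * `|a - b|.
Hypothesis mg : measurable_fun setT (g^`()%classic).
Variable rad : R.
Hypothesis rad_max : forall x y, Omega x -> Omega y -> enorm (y - x) <= rad.
Implicit Types (x y : 'rV[R]_d) (w : R -> 'rV[R]_d -> 'rV[R]_d) (s t C B : R).

(** Chosen so that the integrand of [force_density] is this scalar times the bond direction, the
    form treated by [central_field_bounded_X]. *)
Definition bond_force w t y x : R :=
  2 * rho_kernel Omega J eps y x / Num.sqrt (enorm (y - x)) *
  gamma w y x t * g^`()%classic (scaled_strain y x (w t)).

Lemma rho_kernelC y x : Omega x -> Omega y ->
  rho_kernel Omega J eps y x = rho_kernel Omega J eps x y.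
Proof. by move=> Ox Oy; rewrite /rho_kernel enormC !indicE !mem_set. Qed.

Lemma bond_forceC w t y x : Omega x -> Omega y ->
  bond_force w t y x = bond_force w t x y.
Proof.
move=> Ox Oy; case: hgamma => _ _ _ gC _.
by rewrite /bond_force (rho_kernelC Ox Oy) (enormC y x) gC (scaled_strainC y x).
Qed.

Let si y x := (Num.sqrt (enorm (y - x)))^-1.
Let si0 y x : 0 <= si y x. Proof. by rewrite invr_ge0 sqrtr_ge0. Qed.

Let si_sq y x : si y x * si y x = (enorm (y - x))^-1.
Proof. by rewrite /si -invfM -expr2 sqr_sqrtr// enorm_ge0. Qed.

(** Since [Omega] is bounded, the weaker singularity is dominated by the stronger one, and a single
    kernel serves for all estimates. *)
Let si_le y x : Omega x -> Omega y ->
  si y x <= Num.sqrt rad * (enorm (y - x))^-1.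
Proof.
move=> Ox Oy; rewrite /si -(sqrtMinv (enorm_ge0 _)) ler_wpM2r//.
  by rewrite invr_ge0 enorm_ge0.
by rewrite ler_wsqrtr// rad_max.
Qed.

(** In the last factor, [Num.sqrt rad] serves for the size of the force, 1 for the variation of the
    degradation factor and [2 * d] for that of the scaled strain. *)
Definition force_bound : R :=
  2 * Kr * (Kg * Lg) * (Num.sqrt rad + (1 + 2 * d%:R)).

Lemma force_bound_ge0 : 0 <= force_bound.
Proof.
by rewrite !mulr_ge0// ?addr_ge0 ?sqrtr_ge0// mulr_ge0.
Qed.

Lemma bond_force_le w t y x : Omega x -> Omega y ->
  `|bond_force w t y x| <= force_bound * (enorm (y - x))^-1.
Proof.
move=> Ox Oy; case: hgamma => gK _ _ _ _.
rewrite /bond_force -/(si y x); have := rho_kernel_le y x.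
set rk := rho_kernel _ _ _ _ _; move: rk => rk rkK.
set G := gamma _ _ _ _; set D := (g^`())%classic _.
have -> : 2 * rk * si y x * G * D = 2 * (rk * (si y x * (G * D))) by ring.
rewrite normrM [`|2|]ger0_norm// !normrM.
rewrite (ger0_norm (si0 _ _)).
rewrite (@le_trans _ _ (2 * (Kr * (Num.sqrt rad * (enorm (y - x))^-1 * (Kg * Lg)))))//.
  rewrite ler_wpM2l//; apply: ler_pM => //; rewrite ?mulr_ge0//.
  apply: ler_pM; [exact: si0|exact: mulr_ge0|exact: si_le|].
  by apply: ler_pM => //; [exact: gK|exact: g_bounded].
have -> : 2 * (Kr * (Num.sqrt rad * (enorm (y - x))^-1 * (Kg * Lg))) =
  2 * Kr * (Kg * Lg) * Num.sqrt rad * (enorm (y - x))^-1 by ring.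
rewrite /force_bound.
rewrite ler_wpM2r ?invr_ge0 ?enorm_ge0// ler_wpM2l//.
  by rewrite !mulr_ge0// Kr0.
by rewrite lerDl addr_ge0// mulr_ge0.
Qed.

(* The two factors [(sqrt |y - x|)^-1] come from the prefactor and from the
   Lipschitz estimates of the scaled strain and of the degradation factor. *)
Let bond_force_diff a y x g1 g2 r1 r2 : 0 <= a -> `|g1| <= Kg -> `|g2| <= Kg ->
  `|g1 - g2| <= Kg * a * si y x -> `|r1 - r2| <= d%:R * 2 * a * si y x ->
  `|2 * rho_kernel Omega J eps y x / Num.sqrt (enorm (y - x)) * g1 * g^`()%classic r1 -
    2 * rho_kernel Omega J eps y x / Num.sqrt (enorm (y - x)) * g2 * g^`()%classic r2|
  <= force_bound * a * (enorm (y - x))^-1.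
Proof.
move=> a0 g1K g2K g12 r12; rewrite -/(si y x).
have -> : 2 * rho_kernel Omega J eps y x * si y x * g1 * g^`()%classic r1 -
    2 * rho_kernel Omega J eps y x * si y x * g2 * g^`()%classic r2 =
    2 * rho_kernel Omega J eps y x * si y x * ((g1 - g2) * g^`()%classic r1 +
      g2 * (g^`()%classic r1 - g^`()%classic r2)) by ring.
rewrite 3!normrM [`|2|]ger0_norm// (ger0_norm (si0 _ _)).
rewrite (@le_trans _ _ (2 * Kr * si y x *
    (Kg * a * si y x * Lg + Kg * (Lg * (d%:R * 2 * a * si y x)))))//.
  apply: ler_pM; rewrite ?mulr_ge0//.
    by rewrite ler_wpM2r// ler_wpM2l// rho_kernel_le.
  rewrite (le_trans (ler_normD _ _))// !normrM lerD// ler_pM//.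
  by rewrite (le_trans (g_lipschitz _ _))// ler_wpM2l.
have -> : 2 * Kr * si y x *
    (Kg * a * si y x * Lg + Kg * (Lg * (d%:R * 2 * a * si y x))) =
    2 * Kr * (Kg * Lg) * (1 + 2 * d%:R) * a * (si y x * si y x) by ring.
rewrite si_sq ler_wpM2r ?invr_ge0 ?enorm_ge0// ler_wpM2r// ler_wpM2l//.
  by rewrite !mulr_ge0// Kr0.
by rewrite lerDr sqrtr_ge0.
Qed.

Lemma bond_force_lipschitz w w' t y x C :
  path_continuous T (w ^~ y) -> path_continuous T (w ^~ x) ->
  path_continuous T (w' ^~ y) -> path_continuous T (w' ^~ x) ->
  0 <= t <= T ->
  (forall s, 0 <= s <= t -> `|w s y - w' s y| <= C /\ `|w s x - w' s x| <= C) ->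
  `|bond_force w t y x - bond_force w' t y x| <=
    force_bound * C * (enorm (y - x))^-1.
Proof.
move=> cy cx cy' cx' t0T wC; case: hgamma => gK glip _ _ _.
have /andP[t0 tT] := t0T.
have [wCy wCx] : `|w t y - w' t y| <= C /\ `|w t x - w' t x| <= C.
  by apply: wC; rewrite t0 lexx.
apply: bond_force_diff => //; first exact: le_trans wCx.
  exact: glip.
by rewrite scaled_strainB; exact: scaled_strain_le.
Qed.

(** [B * |s - t|] accounts for the history accumulated between the two times, [C] for the variation
    of the path. *)
Lemma bond_force_time w y x s t B C :
  path_continuous T (w ^~ y) -> path_continuous T (w ^~ x) ->
  0 <= s <= T -> 0 <= t <= T ->
  (forall r, 0 <= r <= T -> `|w r y| <= B /\ `|w r x| <= B) ->
  (forall r, 0 <= r <= T -> `|r - t| <= `|s - t| ->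
    `|w r y - w t y| <= C /\ `|w r x - w t x| <= C) ->
  `|bond_force w s y x - bond_force w t y x| <=
    force_bound * (B * `|s - t| + C) * (enorm (y - x))^-1.
Proof.
move=> cy cx s0T t0T wB wC; case: hgamma => gK _ gtime _ _.
have [wCy wCx] : `|w s y - w t y| <= C /\ `|w s x - w t x| <= C by exact: wC.
have B0 : 0 <= B by have [+ _] := wB _ t0T; exact: le_trans.
have C0 : 0 <= C by apply: le_trans wCx.
apply: bond_force_diff => //; first by rewrite addr_ge0// mulr_ge0.
  exact: gtime.
by rewrite scaled_strainB; apply: scaled_strain_le; rewrite ler_wpDl// mulr_ge0.
Qed.

Lemma bond_force_measurable w t : measurable_path Omega T w -> 0 <= t <= T ->
  measurable_fun (Omega `*` Omega) (fun z => bond_force w t z.1 z.2).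
Proof.
move=> mw t0T; case: hgamma => _ _ _ _ gm.
have mOO : measurable (Omega `*` Omega) by exact: measurableX.
have ma := measurable_bond_length mO.
apply: measurable_funM; last first.
  apply: (measurableT_comp mg); apply: measurable_scaled_strain => //.
  by case: mw => mw _; exact: mw.
apply: measurable_funM; last exact: gm.
apply: measurable_funM; last first.
  apply: measurable_inv_ge0 => [z _|]; first exact: sqrtr_ge0.
  exact: measurable_sqrt.
apply: measurable_funM => //; rewrite /rho_kernel.
apply: measurable_funM => //.
(* On [Omega * Omega] the indicator is 1 and the argument of [J] is nonnegative, so it may be
   replaced by its positive part. *)
apply: (@eq_measurable_fun _ _ _ _ _
  (fun z : 'rV[R]_d * 'rV[R]_d => J (Num.max (enorm (z.1 - z.2) * eps^-1) 0))).
  move=> z /set_mem [z1 z2]; rewrite indicE mem_set// mul1r max_l//.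
  by rewrite mulr_ge0 ?enorm_ge0// invr_ge0 ltW.
apply: (measurableT_comp (influence_measurable hJ)).
exact: measurable_funM.
Qed.

Hypothesis bO : bounded_set Omega.
Variables (K0 : R) (K0_ge0 : 0 <= K0).
Hypothesis K0_bound : forall x, Omega x ->
  (\int[mu]_(y in Omega) ((enorm (y - x))^-1)%:E <= K0%:E)%E.

Local Notation force := (force_density Omega J eps g gamma).

Lemma force_bounded_X w t : measurable_path Omega T w -> 0 <= t <= T ->
  bounded_X Omega (force w t).
Proof.
move=> mw t0T.
have := @central_field_bounded_X _ _ _ mO bO K0 K0_ge0 K0_bound (bond_force w t)
  _ force_bound_ge0 (bond_force_measurable mw t0T)
  (fun x y Ox Oy => bond_force_le w t Ox Oy)
  (fun x y Ox Oy => bond_forceC w t Ox Oy).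
move=> /(bounded_XZ mO bO (-1)).
by under eq_fun do rewrite scaleN1r.
Qed.

Lemma bond_force_section w t x : measurable_path Omega T w -> 0 <= t <= T ->
  Omega x -> measurable_fun Omega (fun y => bond_force w t y x).
Proof.
move=> mw t0T Ox.
have mOO : measurable (Omega `*` Omega) by exact: measurableX.
exact: (measurable_section2 mO (bond_force_measurable mw t0T) Ox).
Qed.

Lemma bond_direction_section x i :
  measurable_fun Omega (fun y => bond_direction y x 0 i).
Proof.
have : measurable_fun Omega (fun y => bond_direction y x).
  apply: measurable_rVZ => //; first exact: measurable_inv_distance.
  by apply: measurable_rVB.
by move=> /(measurable_fun_rVP _ mO).
Qed.

(** With two paths and two times, this covers both the Lipschitz estimate and the continuity in
    time. *)
Lemma force_dist w w' s t x C : measurable_path Omega T w ->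
  measurable_path Omega T w' -> 0 <= s <= T -> 0 <= t <= T -> Omega x -> 0 <= C ->
  (\forall y \ae mu, Omega y ->
    `|bond_force w s y x - bond_force w' t y x| <= C * (enorm (y - x))^-1) ->
  `|force w s x - force w' t x| <= C * K0.
Proof.
move=> mw mw' s0T t0T Ox C0 ww'.
apply: norm_le_coord => [|i]; first by rewrite mulr_ge0.
rewrite !mxE opprK addrC.
have fin v r : measurable_path Omega T v -> 0 <= r <= T -> mu.-integrable Omega
    (EFin \o (fun y => bond_force v r y x * bond_direction y x 0 i)).
  move=> mv r0T.
  have [] // := @singular_integral_le _ _ Omega mO K0 K0_bound
    (fun y => bond_force v r y x * bond_direction y x 0 i) x _ Ox force_bound_ge0.
    apply: measurable_funM; first exact: bond_force_section.
    exact: bond_direction_section.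
  apply: aeW => y Oy; rewrite normrM -[leRHS]mulr1 ler_pM ?bond_force_le//.
  by rewrite (le_trans (coord_le_norm _ _))// bond_direction_le1.
rewrite distrC -RintegralB//; last 2 first.
- exact: fin.
- exact: fin.
have [] // := @singular_integral_le _ _ Omega mO K0 K0_bound
    (fun y => bond_force w s y x * bond_direction y x 0 i -
      bond_force w' t y x * bond_direction y x 0 i) x C Ox C0.
  apply: measurable_funB; apply: measurable_funM;
    [exact: bond_force_section|exact: bond_direction_section
    |exact: bond_force_section|exact: bond_direction_section].
apply: filterS ww' => y ww' Oy; rewrite -mulrBl normrM -[leRHS]mulr1 ler_pM ?ww'//.
by rewrite (le_trans (coord_le_norm _ _))// bond_direction_le1.
Qed.

(** Every bond at [x] involves the history at [x], which must be controlled exactly there; the other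
    end [y] is integrated, so that null sets are harmless. *)
Lemma force_lipschitz w w' t x C : measurable_path Omega T w ->
  measurable_path Omega T w' -> 0 <= t <= T -> Omega x -> 0 <= C ->
  (forall s, 0 <= s <= t -> `|w s x - w' s x| <= C) ->
  (\forall y \ae mu, Omega y -> forall s, 0 <= s <= t -> `|w s y - w' s y| <= C) ->
  `|force w t x - force w' t x| <= force_bound * K0 * C.
Proof.
move=> mw mw' t0T Ox C0 wx wy; rewrite mulrAC.
apply: force_dist => //; first by rewrite mulr_ge0// force_bound_ge0.
apply: filterS wy => y wy Oy.
have [_ cw] := mw; have [_ cw'] := mw'.
apply: bond_force_lipschitz t0T _ => //; [exact: cw|exact: cw|exact: cw'|exact: cw'|].
by move=> s st; split; [exact: wy|exact: wx].
Qed.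

Lemma X_path_measurable w : X_path Omega T w -> measurable_path Omega T w.
Proof.
move=> [bw cw]; split=> [t /bw[]//|x Ox].
exact: equicontinuous_path_continuous cw Ox.
Qed.

Lemma force_X_path w : X_path Omega T w -> X_path Omega T (force w).
Proof.
move=> Xw; have mw := X_path_measurable Xw; have [bw cw] := Xw.
split=> [t t0T|t t0T e e0]; first exact: force_bounded_X.
have [B wB] : exists B, forall t, 0 <= t <= T -> forall x, Omega x -> `|w t x| <= B.
  by apply: equicontinuous_path_bounded => // s /bw[].
pose K := force_bound * K0.
have K_ge0 : 0 <= K by rewrite mulr_ge0// force_bound_ge0.
(* The final bound is [K * (c + c)]: one [c] from the modulus of continuity of [w], one from
   [B * |s - t|]. The added 1 keeps the denominator positive. *)
pose c := e / (K * 2 + 1).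
have c0 : 0 < c by rewrite divr_gt0// ltr_wpDl// mulr_ge0.
have [del del0 H] := cw t t0T c c0.
exists (Num.min del (c / (`|B| + 1))) => [|s s0T].
  by rewrite lt_min del0 divr_gt0// ltr_wpDl.
rewrite lt_min => /andP[st st'] x Ox.
have B0 : 0 <= B by apply: le_trans (wB _ t0T _ Ox).
have Bc : B * `|s - t| <= c.
  rewrite (@le_trans _ _ ((`|B| + 1) * `|s - t|))//.
    by rewrite ler_wpM2r// (le_trans (ler_norm _))// lerDl.
  by rewrite mulrC -ler_pdivlMr ?ltr_wpDl// ltW.
apply: (@le_trans _ _ (force_bound * (B * `|s - t| + c) * K0)).
  apply: force_dist => //.
    rewrite mulr_ge0 ?force_bound_ge0// addr_ge0//; [exact: mulr_ge0|exact: ltW].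
  have [_ cpw] := mw.
  apply: aeW => y Oy; apply: bond_force_time => //; [exact: cpw|exact: cpw| |].
    by move=> r r0T; split; exact: wB.
  move=> r r0T rt; have rtd : `|r - t| < del by exact: le_lt_trans st.
  by split; apply: H.
rewrite mulrAC -/K (@le_trans _ _ (K * (c + c)))//; first by rewrite ler_wpM2l// lerD2r.
have -> : e = (K * 2 + 1) * c by rewrite /c mulrC divfK// gt_eqF// ltr_wpDl// mulr_ge0.
have -> : K * (c + c) = K * 2 * c by ring.
by rewrite ler_wpM2r ?(ltW c0)// lerDl.
Qed.

End bond_forces.

Section peridynamic_force.
Context {R : realType} {d : nat}.
Local Notation mu := (lebesgue_rV R d).

Lemma cohesive_derivative_regular (rm re rc rp : R) g :
  cohesive_potential rm re rc rp g -> exists2 L : R, 0 <= L &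
  [/\ forall r, `|g^`()%classic r| <= L,
      forall a b, `|g^`()%classic a - g^`()%classic b| <= L * `|a - b| &
      measurable_fun setT (g^`()%classic)].
Proof.
move=> [_ [[dg ddg _ [M1 [_ b1]] [M2 [_ b2]]] _]].
(* [bounded_fun] makes every number strictly above [M1], respectively [M2], a bound; one [L] bounds
   both derivatives, and the second gives the Lipschitz property. *)
pose L := (`|M1| + 1) + (`|M2| + 1).
have L1 r : `|g^`()%classic r| <= L.
  rewrite (@le_trans _ _ (`|M1| + 1))//.
    by apply: b1 => //; rewrite (le_lt_trans (ler_norm _))// ltrDl.
  by rewrite lerDl addr_ge0.
have L2 r : `|g^`()^`()%classic r| <= L.
  rewrite (@le_trans _ _ (`|M2| + 1))//.
    by apply: (b2 (`|M2| + 1)) => //; rewrite (le_lt_trans (ler_norm _))// ltrDl.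
  by rewrite lerDr addr_ge0.
exists L; first by rewrite !addr_ge0.
split=> //.
  move=> a b; have [ab|/ltW ba] := leP a b.
    rewrite distrC [`|a - b|]distrC [`|b - a|]ger0_norm ?subr_ge0//.
    exact: derivative_bound_lipschitz.
  rewrite [`|a - b|]ger0_norm ?subr_ge0//; exact: derivative_bound_lipschitz.
apply: continuous_measurable_fun => r; apply: differentiable_continuous.
exact/derivable1_diffP.
Qed.

(** Interface with the rest of the proof, where the force enters through these two properties
    only. *)
Lemma peridynamic_force_regular (hd : (2 <= d)%N) (Omega : set 'rV[R]_d)
    (T eps M rm re rc rp : R) (J g : R -> R)
    (gamma : (R -> 'rV[R]_d -> 'rV[R]_d) -> 'rV[R]_d -> 'rV[R]_d -> R -> R) :
  measurable Omega -> bounded_set Omega -> 0 < T -> 0 < eps ->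
  influence_function M J -> cohesive_potential rm re rc rp g ->
  degradation_factor rp gamma ->
  exists2 K : R, 0 <= K &
    (forall w, X_path Omega T w ->
       X_path Omega T (force_density Omega J eps g gamma w)) /\
    forall w w' (t : R) x (C : R), measurable_path Omega T w -> measurable_path Omega T w' ->
      0 <= t <= T -> Omega x -> 0 <= C ->
      (forall s, 0 <= s <= t -> `|w s x - w' s x| <= C) ->
      (\forall y \ae mu, Omega y ->
         forall s, 0 <= s <= t -> `|w s y - w' s y| <= C) ->
      `|force_density Omega J eps g gamma w t x -
        force_density Omega J eps g gamma w' t x| <= K * C.
Proof.
move=> mO bO T0 eps0 hJ hg hgamma.
have rp0 : 0 < rp by case: hg => [[_ _ rc0 rcp] _]; exact: lt_trans rcp.
have [Kg Kg0 gK] : exists2 Kg : R, 0 <= Kg & regular_degradation Omega T gamma Kg.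
  case: hgamma => -[xD [h [hh ->]]].
    exact: gammaA_regular hh.
  exact: gammaB_regular hh.
have [Lg Lg0 [g1 g2 mg]] := cohesive_derivative_regular hg.
have [Kr Kr0 hKr] := rho_kernel_bounded Omega eps0 hJ.
have [rad rad0 [_ rad_max]] := bounded_set_cube bO.
have [K0 K00 hK0] := singular_kernel_integral hd mO bO.
exists (@force_bound R d Kg Kr Lg rad * K0).
  by rewrite mulr_ge0// force_bound_ge0.
split=> [w|w w' t x C].
  by move=> Xw; apply: (force_X_path mO eps0 hJ Kg0 gK Kr0 hKr Lg0 g1 g2 mg
    rad_max bO K00 hK0 Xw).
by apply: (force_lipschitz mO eps0 hJ Kg0 gK Kr0 hKr Lg0 g1 g2 mg rad_max K00 hK0).
Qed.

End peridynamic_force.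

(** * Existence for the integral equation *)

Section picard.
Context {R : realType} {d : nat}.
Local Notation mu := (lebesgue_rV R d).

Lemma geometric_small (D e : R) : 0 < e ->
  exists N, forall n, (N <= n)%N -> D / 2 ^+ n <= e.
Proof.
move=> e0; exists (Num.bound (`|D| / e)) => n Nn.
rewrite ler_pdivrMr ?exprn_gt0// mulrC -ler_pdivrMr//.
rewrite (@le_trans _ _ (`|D| / e))//.
  by apply: ler_wpM2r; [rewrite invr_ge0 ltW|exact: ler_norm].
rewrite (le_trans (ltW (archi_boundP _)))//; first by rewrite divr_ge0// ltW.
by rewrite -natrX ler_nat (leq_trans Nn)// ltnW// ltn_expl.
Qed.

(** The explicit rate, the sum of the geometric tail, makes limits taken point by point uniform in
    time and space. *)
Lemma geometric_cauchy (u : R^nat) (D : R) :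
  (forall n, `|u n.+1 - u n| <= D / 2 ^+ n) ->
  forall n, `|u n - limn u| <= D * 2 / 2 ^+ n.
Proof.
move=> uD.
have D0 : 0 <= D by have := uD 0; rewrite expr0 divr1; exact: le_trans.
have tail n k : `|u (n + k)%N - u n| <= D * 2 / 2 ^+ n - D * 2 / 2 ^+ (n + k).
  elim: k => [|k IH]; first by rewrite addn0 !subrr normr0.
  rewrite addnS -(subrKA (u (n + k)%N)) (le_trans (ler_normD _ _))//.
  have -> : D * 2 / 2 ^+ n - D * 2 / 2 ^+ (n + k).+1 =
      D / 2 ^+ (n + k) + (D * 2 / 2 ^+ n - D * 2 / 2 ^+ (n + k)).
    by rewrite exprS; field; rewrite !expf_neq0.
  by rewrite lerD.
have tail' n k : `|u (n + k)%N - u n| <= D * 2 / 2 ^+ n.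
  by rewrite (le_trans (tail n k))// gerBl !mulr_ge0// invr_ge0 exprn_ge0.
have cu : cvgn u.
  apply/cauchy_cvgP/cauchy_ballP => e e0.
  have e20 : 0 < e / 4 by rewrite divr_gt0.
  have [N HN] := geometric_small (D * 2) e20.
  have close n : (N <= n)%N -> `|u n - u N| <= e / 4.
    by move=> Nn; rewrite -(subnKC Nn) (le_trans (tail' _ _))// HN.
  exists ([set u n | n in [set n | (N <= n)%N]], [set u n | n in [set n | (N <= n)%N]]).
    by split; exists N => // n Nn; exists n.
  move=> [_ _] [[n Nn <-] [m Nm <-]] /=; rewrite /ball /=.
  rewrite -(subrKA (u N)) (le_lt_trans (ler_normD _ _))//.
  rewrite (@le_lt_trans _ _ (e / 4 + e / 4))//.
    by rewrite lerD ?close// distrC close.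
  have -> : e / 4 + e / 4 = e / 2 by field.
  by rewrite ltr_pdivrMr// ltr_pMr// ltr1n.
move=> n; apply/ler_addgt0Pr => e e0.
have /cvgrPdist_le /(_ e e0)[N _ HN] := cu.
have := HN (n + N)%N (leq_addl _ _) => /= lN.
rewrite -(subrKA (u (n + N)%N)) (le_trans (ler_normD _ _))// lerD//.
  by rewrite distrC.
by rewrite distrC.
Qed.

Section fixed_domain.
Variables (Omega : set 'rV[R]_d) (mO : measurable Omega).
Hypothesis bO : bounded_set Omega.
Variables (T : R) (T0 : 0 < T) (lam : R) (lam0 : 0 < lam).
Implicit Types (x : 'rV[R]_d) (s t C e : R) (f g w : R -> 'rV[R]_d -> 'rV[R]_d).

Lemma expR_ge1 t : 0 <= t -> 1 <= expR (lam * t).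
Proof. by move=> t0; rewrite -expR0 ler_expR mulr_ge0// ltW. Qed.

(** Banach's fixed point theorem expressed through bounds at all points of [Omega], so that the
    fixed point equation holds at every such point and not up to a null set. *)
Lemma picard (Phi : (R -> 'rV[R]_d -> 'rV[R]_d) -> R -> 'rV[R]_d -> 'rV[R]_d) f0 :
  X_path Omega T f0 -> (forall f, X_path Omega T f -> X_path Omega T (Phi f)) ->
  (forall f g C, X_path Omega T f -> X_path Omega T g -> 0 <= C ->
    (forall t, 0 <= t <= T -> forall x, Omega x ->
       `|f t x - g t x| <= C * expR (lam * t)) ->
    forall t, 0 <= t <= T -> forall x, Omega x ->
       `|Phi f t x - Phi g t x| <= C / 2 * expR (lam * t)) ->
  exists2 w, X_path Omega T w &
    forall t, 0 <= t <= T -> forall x, Omega x -> w t x = Phi w t x.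
Proof.
move=> X0 PhiX Phi_contr.
pose F n := iter n Phi f0.
have XF n : X_path Omega T (F n) by elim: n => // n; exact: PhiX.
have [C C0 FC] : exists2 C, 0 <= C & forall t, 0 <= t <= T -> forall x, Omega x ->
    `|F 1 t x - F 0 t x| <= C.
  have bnd n : exists C, forall t, 0 <= t <= T -> forall x, Omega x -> `|F n t x| <= C.
    have [bF cF] := XF n.
    by apply: equicontinuous_path_bounded => // t /bF[].
  have [B1 HB1] := bnd 1; have [B2 HB2] := bnd 0.
  exists (`|B1| + `|B2|) => [|t tT x Ox]; first by rewrite addr_ge0.
  rewrite (le_trans (ler_normB _ _))// lerD//.
    by rewrite (le_trans (HB1 _ tT _ Ox))// ler_norm.
  by rewrite (le_trans (HB2 _ tT _ Ox))// ler_norm.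
have FS n t x : 0 <= t <= T -> Omega x ->
    `|F n.+1 t x - F n t x| <= C / 2 ^+ n * expR (lam * t).
  elim: n t x => [t x tT Ox|n IH t x tT Ox].
    rewrite expr0 divr1 (le_trans (FC _ tT _ Ox))// ler_peMr//.
    by rewrite expR_ge1//; case/andP: tT.
  rewrite exprSr invfM mulrA.
  apply: (Phi_contr (F n.+1) (F n) (C / 2 ^+ n) (XF _) (XF _)) => //.
    by rewrite divr_ge0// exprn_ge0.
  by move=> s sT y Oy; exact: IH.
(* Largest weight on [0, T]; it turns the weighted rate into an unweighted one. *)
pose E := expR (lam * T).
have tE t : 0 <= t <= T -> expR (lam * t) <= E.
  by move=> /andP[_ tT]; rewrite ler_expR ler_wpM2l// ltW.
pose w t x : 'rV[R]_d := \row_i limn (fun n => F n t x 0 i).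
have Fw n t x : 0 <= t <= T -> Omega x -> `|F n t x - w t x| <= C * E * 2 / 2 ^+ n.
  move=> tT Ox; apply: norm_le_coord => [|i].
    by rewrite !mulr_ge0 ?expR_ge0// invr_ge0 exprn_ge0.
  rewrite !mxE; apply: (@geometric_cauchy (fun n => F n t x 0 i)) => k.
  have := coord_le_norm (F k.+1 t x - F k t x) i; rewrite !mxE => /le_trans; apply.
  rewrite (le_trans (FS _ _ _ tT Ox))// mulrAC ler_wpM2r ?invr_ge0 ?exprn_ge0//.
  by rewrite ler_wpM2l// tE.
have Xw : X_path Omega T w.
  apply: (@X_path_limit _ _ _ mO bO T F) => // e e0.
  have [N HN] := geometric_small (C * E * 2) e0.
  by exists N => n Nn t tT x Ox; rewrite (le_trans (Fw _ _ _ tT Ox))// HN.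
exists w => // t tT x Ox; apply/eqP; rewrite -subr_eq0 -normr_le0.
apply/ler_addgt0Pl => e e0; rewrite addr0.
have e20 : 0 < e / 2 by rewrite divr_gt0.
(* The second [E] pays for the weight that the contraction estimate between [F N] and [w]
   reintroduces. *)
have [N HN] := geometric_small (C * E * 2 * E) e20.
have E1 : 1 <= E by rewrite expR_ge1// ltW.
have small k : (N <= k)%N -> C * E * 2 / 2 ^+ k <= e / 2.
  move=> Nk; apply: le_trans (HN _ Nk); rewrite ler_wpM2r ?invr_ge0 ?exprn_ge0//.
  by rewrite ler_peMr// !mulr_ge0// expR_ge0.
rewrite -(subrKA (F N.+1 t x)) (le_trans (ler_normD _ _))// [leRHS]splitr lerD//.
  by rewrite distrC (le_trans (Fw _ _ _ tT Ox))// small.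
have C'0 : 0 <= C * E * 2 / 2 ^+ N by rewrite !mulr_ge0 ?expR_ge0// invr_ge0 exprn_ge0.
apply: (le_trans (Phi_contr _ _ _ (XF N) Xw C'0 _ t tT x Ox)).
  move=> s sT y Oy; rewrite (le_trans (Fw _ _ _ sT Oy))// ler_peMr// expR_ge1//.
  by case/andP: sT.
apply: le_trans (HN N (leqnn _)).
have -> : C * E * 2 * E / 2 ^+ N = C * E * 2 / 2 ^+ N * E by ring.
rewrite ler_pM ?expR_ge0// ?tE//; first by rewrite divr_ge0.
by rewrite ler_pdivrMr// ler_peMr// ler1n.
Qed.

Lemma tint_contraction (u v f g : R -> 'rV[R]_d -> 'rV[R]_d) h A :
  0 <= A -> X_path Omega T f -> X_path Omega T g ->
  (forall t x, u t x = h x + tint f t x) ->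
  (forall t x, v t x = h x + tint g t x) ->
  (forall t, 0 <= t <= T -> forall x, Omega x ->
     `|f t x - g t x| <= A * expR (lam * t)) ->
  forall t, 0 <= t <= T -> forall x, Omega x ->
     `|u t x - v t x| <= A / lam * expR (lam * t).
Proof.
move=> A0 [_ cf] [_ cg] uE vE fg t tT x Ox.
rewrite uE vE opprD addrACA subrr add0r.
apply: (@tint_growth _ _ Omega T) => //; [exact: ltW|by rewrite divr_ge0// ltW|].
move=> s sT; rewrite divfK ?gt_eqF// fg//.
Qed.

End fixed_domain.

Section existence.
Variables (Omega : set 'rV[R]_d) (mO : measurable Omega).
Hypothesis bO : bounded_set Omega.
Variables (T rho K : R) (T0 : 0 < T) (rho0 : 0 < rho) (K0 : 0 <= K).
Variable L : (R -> 'rV[R]_d -> 'rV[R]_d) -> R -> 'rV[R]_d -> 'rV[R]_d.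
Hypothesis LX : forall w, X_path Omega T w -> X_path Omega T (L w).
Hypothesis L_lip : forall w w' t x C, X_path Omega T w -> X_path Omega T w' ->
  0 <= t <= T -> Omega x -> 0 <= C ->
  (forall s y, 0 <= s <= t -> Omega y -> `|w s y - w' s y| <= C) ->
  `|L w t x - L w' t x| <= K * C.

(* Two time integrations gain the factor [1 / lam^2] in the norm weighted by
   [e^(- lam t)]; this rate makes [K / (rho lam^2)] at most [1/2]. *)
Definition growth_rate : R := 1 + 2 * K / rho.

Lemma growth_rate_gt0 : 0 < growth_rate.
Proof. by rewrite ltr_pwDl// !mulr_ge0// invr_ge0 ltW. Qed.

Lemma growth_rate_half (C : R) : 0 <= C ->
  K * C / rho / growth_rate / growth_rate <= C / 2.
Proof.
move=> C0.
have lam0 := growth_rate_gt0.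
have lam1 : 1 <= growth_rate by rewrite lerDl !mulr_ge0// invr_ge0 ltW.
rewrite ler_pdivrMr// ler_pdivrMr//.
have -> : K * C / rho = C / 2 * (2 * K / rho) by field; rewrite gt_eqF.
rewrite -(mulrA (C / 2)) ler_wpM2l ?divr_ge0//.
rewrite (@le_trans _ _ growth_rate)//; first by rewrite lerDr.
by rewrite ler_peMr// ltW.
Qed.

Lemma integral_equation_solution u0 v0 b : bounded_X Omega u0 ->
  bounded_X Omega v0 -> X_path Omega T b ->
  exists2 w, X_path Omega T w & forall t, 0 <= t <= T -> forall x, Omega x ->
    w t x = u0 x + tint (fun s y => v0 y +
      tint (fun r z => rho^-1 *: (b r z + (-1) *: L w r z)) s y) t x.
Proof.
move=> Xu0 Xv0 Xb.
pose acc w r z := rho^-1 *: (b r z + (-1) *: L w r z).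
pose vel w s y := v0 y + tint (acc w) s y.
have T0' := ltW T0.
have Xacc w : X_path Omega T w -> X_path Omega T (acc w).
  by move=> Xw; apply: X_pathZ => //; apply: X_pathD => //; apply: X_pathZ => //; exact: LX.
have Xvel w : X_path Omega T w -> X_path Omega T (vel w).
  move=> Xw; apply: X_pathD => //; first exact: X_path_cst.
  by apply: tint_X_path => //; exact: Xacc.
apply: (@picard Omega mO bO T T0 growth_rate growth_rate_gt0
  (fun w t x => u0 x + tint (vel w) t x) (fun=> u0)).
- exact: X_path_cst.
- move=> w Xw; apply: X_pathD => //; first exact: X_path_cst.
  by apply: tint_X_path => //; exact: Xvel.
move=> f g C Xf Xg C0 fg t tT x Ox.
have lam0 := growth_rate_gt0.
have A0 : 0 <= K * C / rho by rewrite !mulr_ge0// invr_ge0 ltW.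
apply: (@le_trans _ _ (K * C / rho / growth_rate / growth_rate *
    expR (growth_rate * t))); last first.
  by rewrite ler_wpM2r ?expR_ge0// growth_rate_half.
apply: (@tint_contraction Omega T _ lam0 (fun s y => u0 y + tint (vel f) s y)
  (fun s y => u0 y + tint (vel g) s y) (vel f) (vel g) u0) => //; [|exact: Xvel|exact: Xvel|].
  by rewrite divr_ge0// ltW.
apply: (@tint_contraction Omega T _ lam0 (vel f) (vel g) (acc f) (acc g) v0) => //.
- exact: Xacc.
- exact: Xacc.
move=> s sT y Oy; rewrite /acc -scalerBr opprD addrACA subrr add0r -scalerBr.
rewrite normrZ gtr0_norm ?invr_gt0// scaleN1r normrN.
have -> : K * C / rho * expR (growth_rate * s) =
    rho^-1 * (K * (C * expR (growth_rate * s))) by ring.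
rewrite ler_wpM2l ?invr_ge0 ?(ltW rho0)//.
apply: L_lip => //; first by rewrite mulr_ge0// expR_ge0.
(* [L] at time [s] sees the times [r <= s], where the weight is at most the one at [s]. *)
move=> r z /andP[r0 rs] Oz; case/andP: sT => s0 sT.
rewrite (le_trans (fg r _ z Oz))//; first by rewrite r0 (le_trans rs).
by rewrite ler_wpM2l// ler_expR ler_wpM2l// ltW.
Qed.

End existence.
End picard.

(** * Continuous versions and essential bounds *)

Section versions.
Context {R : realType} {d : nat}.
Local Notation mu := (lebesgue_rV R d).

Lemma ae_countable (I : countType) (P : I -> 'rV[R]_d -> Prop) :
  (forall i, \forall x \ae mu, P i x) -> \forall x \ae mu, forall i, P i x.
Proof.
move=> H.
have : \forall x \ae mu, forall n : nat,
    (fun n x => forall i : I, unpickle n = Some i -> P i x) n x.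
  apply/ae_foralln => n; case: (unpickle n) => [i|]; last by apply: aeW.
  by apply: filterS (H i) => x Pix j [<-].
by apply: filterS => x Px i; apply: (Px (pickle i)); rewrite pickleK.
Qed.

(** Approximation from below keeps the rational time in [0, T] and its weight below the one at [t];
    for [t = 0] the rational is 0 itself. *)
Lemma rat_below (t e : R) : 0 <= t -> 0 < e ->
  exists r : rat, 0 <= (ratr r : R) <= t /\ `|ratr r - t| < e.
Proof.
move=> t0 e0; have [t00|tn0] := eqVneq t 0.
  by exists 0; rewrite t00 rmorph0 lexx subrr normr0.
have tgt0 : 0 < t by rewrite lt_neqAle eq_sym tn0.
have [|r] := @rat_in_itvoo R (Num.max 0 (t - e)) t.
  by rewrite gt_max tgt0 ltrBlDr ltrDl.
rewrite in_itv /= gt_max => /andP[/andP[r0 rte] rt]; exists r.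
rewrite (ltW r0) (ltW rt); split=> //.
by rewrite distrC gtr0_norm ?subr_gt0// ltrBlDr -ltrBlDl.
Qed.

Variables (Omega : set 'rV[R]_d) (mO : measurable Omega).
Variable T : R.
Implicit Types (x : 'rV[R]_d) (s t C e : R) (f g w b : R -> 'rV[R]_d -> 'rV[R]_d).

Lemma in_C0X_ae b t e : in_C0X Omega T b -> 0 <= t <= T -> 0 < e ->
  exists2 del : R, 0 < del & forall s, 0 <= s <= T -> `|s - t| < del ->
    \forall x \ae mu, Omega x -> `|b s x - b t x| <= e.
Proof.
move=> cb t0T e0; have [|_ /Linfty_cvg0P /(_ e e0)] := cb t; first by rewrite in_itv.
move=> [del /= del0 H]; exists del => // s s0T st.
by apply: H => /=; [rewrite distrC|rewrite in_itv].
Qed.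

(* Off a null set, all the bounds on [b p - b q] for rational times [p] and [q]
   hold simultaneously, so [b] extends there continuously from the rational
   times; the limit is a version of [b] because [b] is continuous. *)
Lemma in_C0X_version b : in_C0X Omega T b -> exists2 b', X_path Omega T b' &
  forall t, 0 <= t <= T -> \forall x \ae mu, Omega x -> b' t x = b t x.
Proof.
move=> cb.
have Xb t : 0 <= t <= T -> in_X Omega (b t).
  by move=> tT; have [] := cb t; rewrite ?in_itv.
have bfin t : 0 <= t <= T -> \forall x \ae mu, Omega x ->
    `|b t x| <= fine (Linfty_norm Omega (b t)).
  by move=> /Xb[_ ? _]; exact: Linfty_norm_fin.
pose N s t := fine (Linfty_norm Omega (fun x => b s x - b t x)).
have Nfin s t : 0 <= s <= T -> 0 <= t <= T ->
    (Linfty_norm Omega (fun x => b s x - b t x)%R < +oo)%E.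
  move=> sT tT; apply: (@le_lt_trans _ _ (d%:R * (fine (Linfty_norm Omega (b s)) +
    fine (Linfty_norm Omega (b t))))%:E); last exact: ltry.
  apply: Linfty_norm_le.
    by rewrite addr_ge0// fine_ge0// Linfty_norm_ge0.
  move: (bfin s sT) (bfin t tT); apply: filterS2 => x bs bt Ox.
  by rewrite (le_trans (ler_normB _ _))// lerD ?bs// bt.
have Nae s t : 0 <= s <= T -> 0 <= t <= T ->
    \forall x \ae mu, Omega x -> `|b s x - b t x| <= N s t.
  by move=> sT tT; exact: Linfty_norm_fin (Nfin s t sT tT).
have Nle s t C : 0 <= s <= T -> 0 <= t <= T -> 0 <= C ->
    (\forall x \ae mu, Omega x -> `|b s x - b t x| <= C) -> N s t <= d%:R * C.
  move=> sT tT C0 H; rewrite -lee_fin fineK.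
    exact: Linfty_norm_le.
  by rewrite ge0_fin_numE ?Linfty_norm_ge0// Nfin.
pose dom (r : rat) := 0 <= (ratr r : R) <= T.
have [A [mA A0 goodA]] : exists A, [/\ measurable A, mu A = 0 &
    forall x, Omega x -> ~ A x ->
    (forall p q : rat, dom p -> dom q ->
      `|b (ratr p) x - b (ratr q) x| <= N (ratr p) (ratr q)) /\
    forall p : rat, dom p -> `|b (ratr p) x| <= fine (Linfty_norm Omega (b (ratr p)))].
  pose good x (p : rat * rat) := Omega x -> dom p.1 -> dom p.2 ->
      `|b (ratr p.1) x - b (ratr p.2) x| <= N (ratr p.1) (ratr p.2) /\
      `|b (ratr p.1) x| <= fine (Linfty_norm Omega (b (ratr p.1))).
  have : \forall x \ae mu, forall p, (fun p x => good x p) p x.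
    apply: ae_countable => -[p q]; rewrite /good /=.
    have [dp|ndp] := boolP (dom p); last by apply: aeW => x _.
    have [dq|ndq] := boolP (dom q); last by apply: aeW => x _.
    move: (Nae _ _ dp dq) (bfin _ dp); apply: filterS2 => x Hx bx Ox _ _.
    by split; [exact: Hx|exact: bx].
  move=> [A [mA A0 HA]]; exists A; split=> // x Ox nAx.
  have Hx : forall p, good x p by apply: contrapT => nP; apply: nAx; exact: HA.
  split=> [p q dp dq|p dp]; first by have [] := Hx (p, q) Ox dp dq.
  by have [] := Hx (p, p) Ox dp dp.
have aeA : \forall x \ae mu, ~ A x.
  by exists A; split => // x /= /contrapT.
have k20 k : 0 < (2 ^+ k)^-1 :> R by rewrite invr_gt0 exprn_gt0.
(* The condition on [t] is inside the existential so that the chosen rational is a total function of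
   [t] and [k]. *)
have ex t k : exists r : rat, 0 <= t <= T -> dom r /\
    \forall x \ae mu, Omega x -> `|b (ratr r) x - b t x| <= (2 ^+ k)^-1.
  have [tT|] := boolP (0 <= t <= T); last by exists 0.
  have [del del0 H] := in_C0X_ae cb tT (k20 k).
  have [r [/andP[r0 rt] rdel]] := rat_below (proj1 (andP tT)) del0.
  have dr : dom r by rewrite /dom r0 (le_trans rt)//; case/andP: tT.
  by exists r => _; split=> //; exact: H.
pose r t k := projT1 (cid (ex t k)).
have rP t k : 0 <= t <= T -> dom (r t k) /\
    \forall x \ae mu, Omega x -> `|b (ratr (r t k)) x - b t x| <= (2 ^+ k)^-1.
  by move=> tT; rewrite /r; case: cid => q /= /(_ tT).
(* The value 0 on the null set [A] makes the later bounds on [b'] hold at every point of [Omega]. *)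
pose b' t x : 'rV[R]_d :=
  \row_i (\1_(~` A) x * limn (fun k => b (ratr (r t k)) x 0 i)).
have b'A t x : A x -> b' t x = 0.
  by move=> Ax; apply/rowP => i; rewrite !mxE indicE memNset ?mul0r//; exact.
(* Consecutive approximations differ by at most [d * 2 / 2 ^+ k], with [d] from the comparison of
   norms in [Nle]; the last 2 is the sum of the geometric tail. *)
have approx t x k : 0 <= t <= T -> Omega x -> ~ A x ->
    `|b (ratr (r t k)) x - b' t x| <= d%:R * 2 * 2 / 2 ^+ k.
  move=> tT Ox nAx; apply: norm_le_coord => [|i].
    by rewrite divr_ge0// exprn_ge0.
  rewrite !mxE indicE mem_set// mul1r.
  apply: (@geometric_cauchy _ (fun k => b (ratr (r t k)) x 0 i)) => n.
  have [d1 H1] := rP t n.+1 tT; have [d2 H2] := rP t n tT.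
  have [Hx _] := goodA x Ox nAx.
  have := coord_le_norm (b (ratr (r t n.+1)) x - b (ratr (r t n)) x) i.
  rewrite !mxE => /le_trans; apply; apply: (le_trans (Hx _ _ d1 d2)).
  rewrite -mulrA; apply: (Nle _ _ _ d1 d2) => //.
  move: H1 H2; apply: filterS2 => y H1 H2 Oy.
  rewrite -(subrKA (b t y)) (le_trans (ler_normD _ _))//.
  rewrite -[2 / _]/((1 + 1) / 2 ^+ n) mulrDl mul1r lerD//; last by rewrite distrC H2.
  rewrite (le_trans (H1 Oy))// lef_pV2 ?posrE ?exprn_gt0//.
  by rewrite ler_weXn2l// ler1n.
(* An essential bound on [b s - b t] becomes a bound at every point, up to the factor [d]: it is
   transferred to nearby rational times, where it holds off [A]. *)
have modulus s t C : 0 <= s <= T -> 0 <= t <= T -> 0 <= C ->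
    (\forall x \ae mu, Omega x -> `|b s x - b t x| <= C) ->
    forall x, Omega x -> `|b' s x - b' t x| <= d%:R * C.
  move=> sT tT C0 stC x Ox.
  have [Ax|nAx] := pselect (A x); first by rewrite !b'A// subrr normr0 mulr_ge0.
  apply/ler_addgt0Pr => e e0.
  (* 10 = 2 + 4 + 4: the difference between rational times, then [approx] at [s] and at [t]. *)
  have [k Hk] := geometric_small (d%:R * 10) e0; have {}Hk := Hk k (leqnn _).
  have [d1 H1] := rP s k sT; have [d2 H2] := rP t k tT.
  have [Hx _] := goodA x Ox nAx.
  have a1 := approx s x k sT Ox nAx; have a2 := approx t x k tT Ox nAx.
  have a3 : `|b (ratr (r s k)) x - b (ratr (r t k)) x| <= d%:R * (C + 2 / 2 ^+ k).
    apply: (le_trans (Hx _ _ d1 d2)); apply: (Nle _ _ _ d1 d2) => //.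
      by rewrite addr_ge0// divr_ge0// exprn_ge0.
    move: H1 H2 stC; apply: filterS3 => y H1 H2 stC Oy.
    have -> : b (ratr (r s k)) y - b (ratr (r t k)) y =
      (b (ratr (r s k)) y - b s y) + (b s y - b t y) - (b (ratr (r t k)) y - b t y).
      by apply/rowP => i; rewrite !mxE; ring.
    have -> : C + 2 / 2 ^+ k = (2 ^+ k)^-1 + C + (2 ^+ k)^-1 by ring.
    rewrite (le_trans (ler_normB _ _))// lerD ?H2//.
    by rewrite (le_trans (ler_normD _ _))// lerD ?H1// stC.
  have -> : b' s x - b' t x = (b (ratr (r s k)) x - b (ratr (r t k)) x) -
    (b (ratr (r s k)) x - b' s x) + (b (ratr (r t k)) x - b' t x).
    by apply/rowP => i; rewrite !mxE; ring.
  apply: (@le_trans _ _ (d%:R * (C + 2 / 2 ^+ k) + d%:R * 2 * 2 / 2 ^+ k +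
      d%:R * 2 * 2 / 2 ^+ k)).
    rewrite (le_trans (ler_normD _ _))// lerD//.
    by rewrite (le_trans (ler_normB _ _))// lerD.
  rewrite (_ : _ + _ + _ = d%:R * C + d%:R * 10 / 2 ^+ k); last by ring.
  by rewrite lerD2l.
have b'b t : 0 <= t <= T -> \forall x \ae mu, Omega x -> b' t x = b t x.
  move=> tT.
  have : \forall x \ae mu, forall k : nat, (fun k x => Omega x ->
      `|b (ratr (r t k)) x - b t x| <= (2 ^+ k)^-1) k x.
    by apply/ae_foralln => k; case: (rP t k tT).
  move: aeA; apply: filterS2 => x nAx Hx Ox.
  apply/eqP; rewrite -subr_eq0 -normr_le0; apply/ler_addgt0Pl => e e0; rewrite addr0.
  have [k Hk] := geometric_small (d%:R * 4 + 1) e0; have {}Hk := Hk k (leqnn _).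
  apply: le_trans Hk; rewrite -(subrKA (b (ratr (r t k)) x)).
  rewrite (le_trans (ler_normD _ _))// mulrDl mul1r lerD ?Hx//.
  rewrite distrC (le_trans (approx t x k tT Ox nAx))//.
  by rewrite -(mulrA d%:R) -natrM.
exists b' => //; split=> t tT; last first.
  move=> e e0; have e'0 : 0 < e / (d%:R + 1) by rewrite divr_gt0// ltr_wpDl.
  have [del del0 H] := in_C0X_ae cb tT e'0.
  exists del => // s sT st x Ox.
  apply: le_trans (modulus _ _ _ sT tT (ltW e'0) (H s sT st) x Ox) _.
  by rewrite mulrCA ger_pMr// ler_pdivrMr ?ltr_wpDl// mul1r lerDl.
apply: ae_eq_bounded_X (b'b t tT) => //; first exact: Xb.
  apply/(measurable_fun_rVP _ mO) => i.
  apply: (@measurable_fun_cvg _ _ _ _ (fun k x =>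
      \1_(~` A) x * b (ratr (r t k)) x 0 i)) => [k|x Ox].
    apply: measurable_funM.
      by apply: measurable_indic; exact: measurableC.
    have [dk _] := rP t k tT; have [mb _ _] := Xb _ dk.
    by move: mb => /(measurable_fun_rVP _ mO).
  have [Ax|nAx] := pselect (A x).
    rewrite b'A// mxE; apply: cvg_near_cst; apply: nearW => k.
    by rewrite indicE memNset ?mul0r//; exact.
  apply/cvgrPdist_le => e e0.
  have [k Hk] := geometric_small (d%:R * 2 * 2) e0.
  exists k => // n /= kn; rewrite indicE mem_set// mul1r distrC.
  apply: le_trans (Hk n kn); apply: le_trans (approx t x n tT Ox nAx).
  by have := coord_le_norm (b (ratr (r t n)) x - b' t x) i; rewrite !mxE.
have [d0 _] := rP t 0 tT.
exists (fine (Linfty_norm Omega (b (ratr (r t 0)))) + d%:R * 4) => x Ox.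
have [Ax|nAx] := pselect (A x).
  by rewrite b'A// normr0 addr_ge0// ?fine_ge0// ?Linfty_norm_ge0// mulr_ge0.
rewrite -(subrK (b (ratr (r t 0)) x) (b' t x)) addrC (le_trans (ler_normD _ _))//.
rewrite lerD//; first by have [_] := goodA x Ox nAx; exact.
rewrite distrC (le_trans (approx t x 0 tT Ox nAx))//.
by rewrite expr0 divr1 -mulrA -natrM.
Qed.

(** Multiplied out by [s - t], the estimate includes [s = t] and has the form required by the growth
    lemma. *)
Lemma strong_derivative_ae u u' t e : strong_derivative Omega T u u' ->
  0 <= t <= T -> 0 < e -> exists2 del : R, 0 < del &
    forall s, 0 <= s <= T -> `|s - t| < del -> \forall x \ae mu, Omega x ->
    `|u s x - u t x - (s - t) *: u' t x| <= e * `|s - t|.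
Proof.
move=> du tT e0.
have tT' : t \in `[0, T] by rewrite in_itv.
have /Linfty_cvg0P /(_ e e0)[del /= del0 H] := du t tT'.
exists del => // s sT st; have [->|s_neq_t] := eqVneq s t.
  by apply: aeW => x _; rewrite !subrr scale0r subr0 !normr0 mulr0.
have := H s; rewrite /= distrC in_itv => /(_ st s_neq_t sT).
apply: filterS => x Hx Ox.
have st0 : s - t != 0 by rewrite subr_eq0.
rewrite [leRHS]mulrC -[X in `|X| <= _](scalerKV st0) normrZ ler_wpM2l//.
by rewrite scalerBr scalerK// Hx.
Qed.

(** The null sets may depend on the time, so the paths at a fixed point cannot be integrated;
    [growth_bound] propagates the essential bound itself. *)
Lemma ae_growth (z z1 : R -> 'rV[R]_d -> 'rV[R]_d) (lam A : R) : 0 <= lam -> 0 <= A ->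
  (forall t, 0 <= t <= T -> forall e, 0 < e -> exists2 del : R, 0 < del &
    forall s, 0 <= s <= T -> `|s - t| < del -> \forall x \ae mu, Omega x ->
    `|z s x - z t x - (s - t) *: z1 t x| <= e * `|s - t|) ->
  (forall t, 0 <= t <= T -> \forall x \ae mu, Omega x ->
    `|z1 t x| <= A * lam * expR (lam * t)) ->
  (\forall x \ae mu, Omega x -> `|z 0 x| <= A) ->
  forall t, 0 <= t <= T -> \forall x \ae mu, Omega x ->
    `|z t x| <= A * expR (lam * t).
Proof.
move=> lam0 A0 dz z1A z0A.
apply: (@growth_bound R T lam A
  (fun t C => \forall x \ae mu, Omega x -> `|z t x| <= C)) => //.
- by move=> t C C' CC'; apply: filterS => x H Ox; rewrite (le_trans (H Ox)).
- move=> t C tT H.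
  (* Closedness: the errors are restricted to 1 / (k + 1), for which countably many null sets
     suffice. *)
  have : \forall x \ae mu, forall k : nat,
      (fun k x => Omega x -> `|z t x| <= C + k.+1%:R^-1) k x.
    by apply/ae_foralln => k; apply: H; rewrite invr_gt0.
  apply: filterS => x Hx Ox; apply/ler_addgt0Pr => e e0.
  rewrite (le_trans (Hx (Num.bound e^-1) Ox))// lerD2l.
  rewrite invf_ple ?posrE// (le_trans (ltW (archi_boundP _)))// ?invr_ge0 ?(ltW e0)//.
  by rewrite ler_nat.
move=> c cT e e0; have [del del0 H] := dz c cT e e0.
exists del => // s sT sc C.
have Q : \forall x \ae mu, Omega x ->
    `|z s x - z c x| <= `|s - c| * (A * lam * expR (lam * c) + e).
  move: (H s sT sc) (z1A c cT); apply: filterS2 => x Hx z1x Ox.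
  rewrite mulrDr -(subrK ((s - c) *: z1 c x) (z s x - z c x)) addrC.
  rewrite (le_trans (ler_normD _ _))// lerD//; last by rewrite [leRHS]mulrC Hx.
  by rewrite normrZ ler_wpM2l// z1x.
split=> [cs zc|sc' zs].
  move: Q zc; apply: filterS2 => x Q zc Ox.
  rewrite -(subrK (z c x) (z s x)) addrC (le_trans (ler_normD _ _))//.
  by rewrite lerD ?zc// -[s - c]ger0_norm ?subr_ge0// Q.
move: Q zs; apply: filterS2 => x Q zs Ox.
rewrite -(subrK (z s x) (z c x)) addrC (le_trans (ler_normD _ _))//.
rewrite lerD ?zs// distrC -[X in X * _]ger0_norm ?subr_ge0//.
by rewrite [X in X * _]distrC Q.
Qed.

(** Exchanges the two quantifiers: the exceptional sets of rational times have a null union, and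
    continuity of the paths extends the bound to all times. *)
Lemma ae_path_bound w w' (lam C : R) : 0 <= lam -> 0 <= C ->
  (forall x, Omega x -> path_continuous T (w ^~ x)) ->
  (forall x, Omega x -> path_continuous T (w' ^~ x)) ->
  (forall s, 0 <= s <= T -> \forall x \ae mu, Omega x ->
    `|w s x - w' s x| <= C * expR (lam * s)) ->
  \forall x \ae mu, Omega x -> forall s, 0 <= s <= T ->
    `|w s x - w' s x| <= C * expR (lam * s).
Proof.
move=> lam0 C0 cw cw' H.
have : \forall x \ae mu, forall r : rat, 0 <= (ratr r : R) <= T -> Omega x ->
    `|w (ratr r) x - w' (ratr r) x| <= C * expR (lam * ratr r).
  apply: ae_countable => r; have [rT|] := boolP (0 <= (ratr r : R) <= T).
    by apply: filterS (H _ rT) => x Hx _.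
  by move=> _; apply: aeW.
apply: filterS => x Hx Ox s sT; apply/ler_addgt0Pr => e e0.
have e20 : 0 < e / 2 by rewrite divr_gt0.
have [del del0 Hw] := cw x Ox s sT _ e20; have [del' del'0 Hw'] := cw' x Ox s sT _ e20.
have /andP[s0 s_T] := sT.
have mdel : 0 < Num.min del del' by rewrite lt_min del0.
have [r [/andP[r0 rs]]] := rat_below s0 mdel; rewrite lt_min => /andP[rd rd'].
have rT : 0 <= (ratr r : R) <= T by rewrite r0 (le_trans rs).
have -> : w s x - w' s x = (w (ratr r) x - w' (ratr r) x) -
    (w (ratr r) x - w s x) + (w' (ratr r) x - w' s x).
  by apply/rowP => i; rewrite !mxE; ring.
have -> : e = e / 2 + e / 2 by field.
rewrite [leRHS]addrA (le_trans (ler_normD _ _))// lerD ?Hw'//.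
rewrite (le_trans (ler_normB _ _))// lerD ?Hw//.
rewrite (le_trans (Hx r rT Ox))// ler_wpM2l// ler_expR ler_wpM2l//.
Qed.

End versions.

(** * Well-posedness *)

Section well_posedness.
Context {R : realType} {d : nat}.
Local Notation mu := (lebesgue_rV R d).
Variables (Omega : set 'rV[R]_d) (mO : measurable Omega).
Hypothesis bO : bounded_set Omega.
Variables (T eps rho K : R) (T0 : 0 < T) (rho0 : 0 < rho) (K0 : 0 <= K).
Variables (J g : R -> R).
Variable gamma : (R -> 'rV[R]_d -> 'rV[R]_d) -> 'rV[R]_d -> 'rV[R]_d -> R -> R.
Local Notation force := (force_density Omega J eps g gamma).
Hypothesis force_X : forall w, X_path Omega T w -> X_path Omega T (force w).
Hypothesis force_lip : forall w w' (t : R) x (C : R),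
  measurable_path Omega T w -> measurable_path Omega T w' ->
  0 <= t <= T -> Omega x -> 0 <= C ->
  (forall s, 0 <= s <= t -> `|w s x - w' s x| <= C) ->
  (\forall y \ae mu, Omega y ->
     forall s, 0 <= s <= t -> `|w s y - w' s y| <= C) ->
  `|force w t x - force w' t x| <= K * C.
Implicit Types (x : 'rV[R]_d) (s t C e : R) (u v w b : R -> 'rV[R]_d -> 'rV[R]_d).

Lemma continuous_version_measurable_path u w : continuous_version Omega T u w ->
  measurable_path Omega T w.
Proof.
move=> [uw cw]; split=> [t tT|x Ox].
  by have [] := uw t; rewrite ?in_itv.
by apply/path_continuousP; exact: cw.
Qed.

Lemma difference_derivative u u' v v' : strong_derivative Omega T u v ->
  strong_derivative Omega T u' v' ->
  forall t, 0 <= t <= T -> forall e, 0 < e -> exists2 del : R, 0 < del &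
    forall s, 0 <= s <= T -> `|s - t| < del -> \forall x \ae mu, Omega x ->
    `|(u s x - u' s x) - (u t x - u' t x) - (s - t) *: (v t x - v' t x)| <=
      e * `|s - t|.
Proof.
move=> du du' t tT e e0; have e20 : 0 < e / 2 by rewrite divr_gt0.
have [del del0 H] := strong_derivative_ae du tT e20.
have [del' del'0 H'] := strong_derivative_ae du' tT e20.
exists (Num.min del del') => [|s sT]; first by rewrite lt_min del0.
rewrite lt_min => /andP[st st'].
move: (H s sT st) (H' s sT st'); apply: filterS2 => x Hx Hx' Ox.
have -> : (u s x - u' s x) - (u t x - u' t x) - (s - t) *: (v t x - v' t x) =
    (u s x - u t x - (s - t) *: v t x) - (u' s x - u' t x - (s - t) *: v' t x).
  by apply/rowP => i; rewrite !mxE; ring.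
rewrite (le_trans (ler_normB _ _))// [e]splitr mulrDl lerD//.
  exact: Hx.
exact: Hx'.
Qed.

Lemma solution_unique b (u0 v0 : 'rV[R]_d -> 'rV[R]_d) u u' :
  solution Omega T eps rho J g gamma b u0 v0 u ->
  solution Omega T eps rho J g gamma b u0 v0 u' ->
  forall t, 0 <= t <= T -> u t = u' t %[ae mu in Omega].
Proof.
move=> [u1 [u2 [w [[cu cu1 _ du du1] vw uu0 u1v0 eqn]]]].
move=> [u1' [u2' [w' [[cu' cu1' _ du' du1'] vw' uu0' u1v0' eqn']]]].
have mw := continuous_version_measurable_path vw.
have mw' := continuous_version_measurable_path vw'.
have dz := difference_derivative du du'; have dz1 := difference_derivative du1 du1'.
(* An a priori bound starts the iteration: both solutions are continuous in X on a compact
   interval. *)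
have [D HD] : exists D, forall t, 0 <= t <= T ->
    \forall x \ae mu, Omega x -> `|u t x - u' t x| <= D.
  apply: segment_locally_bounded => [t C C' CC'|t tT].
    by apply: filterS => x H Ox; rewrite (le_trans (H Ox)).
  have [del del0 H] := in_C0X_ae cu tT ltr01.
  have [del' del'0 H'] := in_C0X_ae cu' tT ltr01.
  have tT' : t \in `[0, T] by rewrite in_itv.
  have [[_ ut _] _] := cu t tT'; have [[_ ut' _] _] := cu' t tT'.
  exists (Num.min del del'); first by rewrite lt_min del0.
  exists ((1 + fine (Linfty_norm Omega (u t))) + (1 + fine (Linfty_norm Omega (u' t)))).
  move=> s sT; rewrite lt_min => /andP[st st'].
  have A := H s sT st; have A' := H' s sT st'.
  have B := Linfty_norm_fin ut; have B' := Linfty_norm_fin ut'.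
  near=> x => Ox.
  rewrite (le_trans (ler_normB _ _))// lerD//.
    rewrite -(subrK (u t x) (u s x)) (le_trans (ler_normD _ _))// lerD//.
      by move: Ox; near: x.
    by move: Ox; near: x.
  rewrite -(subrK (u' t x) (u' s x)) (le_trans (ler_normD _ _))// lerD//.
    by move: Ox; near: x.
  by move: Ox; near: x.
pose lam := growth_rate rho K.
have lam0 : 0 < lam by exact: growth_rate_gt0.
have contract C : 0 <= C ->
    (forall t, 0 <= t <= T -> \forall x \ae mu, Omega x ->
      `|u t x - u' t x| <= C * expR (lam * t)) ->
    (forall t, 0 <= t <= T -> \forall x \ae mu, Omega x ->
      `|u t x - u' t x| <= C / 2 * expR (lam * t)).
  move=> C0 uC.
  (* The force reads the continuous versions, so the bound must hold along whole paths off a single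
     null set. *)
  have wC : \forall x \ae mu, Omega x -> forall s, 0 <= s <= T ->
      `|w s x - w' s x| <= C * expR (lam * s).
    apply: ae_path_bound => //; [exact: ltW|by case: mw|by case: mw'|].
    move=> s sT; have sT' : s \in `[0, T] by rewrite in_itv.
    have [_ ws] := vw.1 s sT'; have [_ ws'] := vw'.1 s sT'.
    move: ws ws' (uC s sT); apply: filterS3 => x ws ws' us Ox.
    by rewrite ws// ws'// us.
  have A0 : 0 <= K * C / rho by rewrite !mulr_ge0// invr_ge0 ltW.
  have u2C t : 0 <= t <= T -> \forall x \ae mu, Omega x ->
      `|u2 t x - u2' t x| <= K * C / rho / lam * lam * expR (lam * t).
    move=> tT; have tT' : t \in `[0, T] by rewrite in_itv.
    have wCt : \forall x \ae mu, Omega x -> forall s, 0 <= s <= t ->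
        `|w s x - w' s x| <= C * expR (lam * t).
      apply: filterS wC => x wC Ox s /andP[s0 st].
      have /andP[t0 tT2] := tT.
      rewrite (le_trans (wC Ox s _))//; first by rewrite s0 (le_trans st).
      by rewrite ler_wpM2l// ler_expR ler_wpM2l// ltW.
    move: wCt (eqn t tT') (eqn' t tT') => wCt; move: (wCt); apply: filterS3 => x wx ex ex' Ox.
    (* The data [b] cancels between the two equations of motion. *)
    have -> : u2 t x - u2' t x = rho^-1 *: (force w' t x - force w t x).
      apply: (scalerI (lt0r_neq0 rho0)).
      rewrite scalerA divff ?gt_eqF// scale1r scalerBr.
      apply/eqP; rewrite -subr_eq0.
      have -> : rho *: u2 t x - rho *: u2' t x - (force w' t x - force w t x) =
        (rho *: u2 t x + force w t x) - (rho *: u2' t x + force w' t x).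
        move: (force w t x) (force w' t x) (u2 t x) (u2' t x) => F F' a a'.
        by apply/rowP => i; rewrite !mxE; ring.
      by rewrite (ex Ox) (ex' Ox) subrr.
    rewrite normrZ gtr0_norm ?invr_gt0// divfK ?gt_eqF//.
    have -> : K * C / rho * expR (lam * t) = rho^-1 * (K * (C * expR (lam * t))) by ring.
    rewrite ler_wpM2l ?invr_ge0 ?(ltW rho0)// distrC.
    apply: force_lip => //; first by rewrite mulr_ge0// expR_ge0.
    exact: wx.
  have z0 : \forall x \ae mu, Omega x -> u 0 x - u' 0 x = 0.
    by move: uu0 uu0'; apply: filterS2 => x ux ux' Ox; rewrite ux// ux'// subrr.
  have z10 : \forall x \ae mu, Omega x -> u1 0 x - u1' 0 x = 0.
    by move: u1v0 u1v0'; apply: filterS2 => x ux ux' Ox; rewrite ux// ux'// subrr.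
  have A1 : 0 <= K * C / rho / lam by rewrite divr_ge0// ltW.
  have u1C : forall t, 0 <= t <= T -> \forall x \ae mu, Omega x ->
      `|u1 t x - u1' t x| <= K * C / rho / lam * expR (lam * t).
    apply: (ae_growth (ltW lam0) A1 dz1 u2C).
    by apply: filterS z10 => x zx Ox; rewrite zx// normr0.
  have A2 : 0 <= K * C / rho / lam / lam by rewrite divr_ge0// ltW.
  have {}uC : forall t, 0 <= t <= T -> \forall x \ae mu, Omega x ->
      `|u t x - u' t x| <= K * C / rho / lam / lam * expR (lam * t).
    apply: (ae_growth (ltW lam0) A2 dz).
      by move=> t tT; rewrite divfK ?gt_eqF//; exact: u1C.
    by apply: filterS z0 => x zx Ox; rewrite zx// normr0.
  move=> t tT; apply: filterS (uC t tT) => x uCx Ox; apply: (le_trans (uCx Ox)).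
  by rewrite ler_wpM2r ?expR_ge0// growth_rate_half.
(* Repeated halving of the constant, which at the limit leaves 0 off countably many null sets. *)
have iter n : forall t, 0 <= t <= T -> \forall x \ae mu, Omega x ->
    `|u t x - u' t x| <= `|D| / 2 ^+ n * expR (lam * t).
  elim: n => [t tT|n IH]; last first.
    by rewrite exprSr invfM mulrA; apply: contract.
  apply: filterS (HD t tT) => x Dx Ox; rewrite expr0 divr1.
  rewrite (le_trans (Dx Ox))// (le_trans (ler_norm _))// ler_peMr//.
  by rewrite expR_ge1//; case/andP: tT.
move=> t tT.
have : \forall x \ae mu, forall n : nat, (fun n x => Omega x ->
    `|u t x - u' t x| <= `|D| / 2 ^+ n * expR (lam * t)) n x.
  by apply/ae_foralln => n; exact: iter.
apply: filterS => x Hx Ox; apply/eqP; rewrite -subr_eq0 -normr_le0.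
apply/ler_addgt0Pl => e e0; rewrite addr0.
have [n Hn] := geometric_small (`|D| * expR (lam * t)) e0.
by rewrite (le_trans (Hx n Ox))// mulrAC Hn.
Unshelve. all: by end_near.
Qed.

Lemma solution_exists b (u0 v0 : 'rV[R]_d -> 'rV[R]_d) : in_X Omega u0 -> in_X Omega v0 ->
  in_C0X Omega T b -> exists u, solution Omega T eps rho J g gamma b u0 v0 u.
Proof.
move=> /(in_X_bounded_version mO)[u0' Xu0 u0E] /(in_X_bounded_version mO)[v0' Xv0 v0E].
move=> /(in_C0X_version mO)[b' Xb bE].
have force_lip' w w' t x C : X_path Omega T w -> X_path Omega T w' ->
    0 <= t <= T -> Omega x -> 0 <= C ->
    (forall s y, 0 <= s <= t -> Omega y -> `|w s y - w' s y| <= C) ->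
    `|force w t x - force w' t x| <= K * C.
  move=> Xw Xw' tT Ox C0 H; apply: force_lip => //.
  - exact: X_path_measurable.
  - exact: X_path_measurable.
  - by move=> s st; exact: H.
  - by apply: aeW => y Oy s st; exact: H.
have [w Xw wE] := integral_equation_solution mO bO T0 rho0 K0 force_X force_lip' Xu0 Xv0 Xb.
pose acc r z := rho^-1 *: (b' r z + (-1) *: force w r z).
pose vel s y := v0' y + tint acc s y.
(* The solution is the right-hand side of the integral equation and not [w]: differentiation
   requires the formula for all arguments, whereas [w] satisfies it on [0, T] and [Omega] only.
   There [w] agrees with [u] and serves as its continuous version. *)
pose u s y := u0' y + tint vel s y.
have Xacc : X_path Omega T acc.
  by apply: X_pathZ => //; apply: X_pathD => //; apply: X_pathZ => //; exact: force_X.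
have Xvel : X_path Omega T vel.
  apply: X_pathD => //; first exact: X_path_cst.
  by apply: tint_X_path => //; exact: ltW.
have Xu : X_path Omega T u.
  apply: X_pathD => //; first exact: X_path_cst.
  by apply: tint_X_path => //; exact: ltW.
exists u, vel, acc, w; split.
- split; [exact: X_path_in_C0X|exact: X_path_in_C0X|exact: X_path_in_C0X| |].
    exact: (@tint_strong_derivative _ _ Omega T vel u u0').
  exact: (@tint_strong_derivative _ _ Omega T acc vel v0').
- split=> [t|x Ox]; last first.
    by apply/path_continuousP; case: Xw => _ cw; exact: equicontinuous_path_continuous cw Ox.
  rewrite in_itv /= => tT; split; first by case: Xw => bw _; have [] := bw t tT.
  by apply: aeW => x Ox; exact: wE.
- by apply: filterS u0E => x u0x Ox; rewrite /u tint0 addr0 u0x.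
- by apply: filterS v0E => x v0x Ox; rewrite /vel tint0 addr0 v0x.
move=> t; rewrite in_itv /= => tT; apply: filterS (bE t tT) => x bx Ox.
by rewrite /acc scalerA divff ?gt_eqF// scale1r scaleN1r subrK bx.
Qed.

End well_posedness.

Theorem theorem3p1 (R : realType) (d : nat) (hd : d = 2%N \/ d = 3%N)
  (Omega : set 'rV[R]_d) (hOmega : bounded_domain Omega)
  (T eps rho : R) (hT : 0 < T) (heps : 0 < eps) (hrho : 0 < rho)
  (M : R) (J : R -> R) (hJ : influence_function M J)
  (rm re rc rp : R) (g : R -> R) (hg : cohesive_potential rm re rc rp g)
  (gamma : (R -> 'rV[R]_d -> 'rV[R]_d) -> 'rV[R]_d -> 'rV[R]_d -> R -> R)
  (hgamma : degradation_factor rp gamma)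
  (u0 v0 : 'rV[R]_d -> 'rV[R]_d) (hu0 : in_X Omega u0) (hv0 : in_X Omega v0)
  (b : R -> 'rV[R]_d -> 'rV[R]_d) (hb : in_C0X Omega T b) :
  exists u : R -> 'rV[R]_d -> 'rV[R]_d,
    solution Omega T eps rho J g gamma b u0 v0 u /\
    forall u' : R -> 'rV[R]_d -> 'rV[R]_d,
      solution Omega T eps rho J g gamma b u0 v0 u' ->
      forall t : R, t \in `[0, T] -> u' t = u t %[ae lebesgue_rV R d in Omega].
Proof.
have [oO _ _ bO] := hOmega.
have mO := open_measurable_rV oO.
have d2 : (2 <= d)%N by case: hd => ->.
have [K K0 [FX Flip]] := peridynamic_force_regular d2 mO bO hT heps hJ hg hgamma.
have [u su] := solution_exists mO bO hT hrho K0 FX Flip hu0 hv0 hb.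
exists u; split=> // u' su' t; rewrite in_itv /= => tT.
exact: (solution_unique hrho K0 Flip su' su tT).
Qed.
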